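(* Let $s\in\mathbb{R}$ and $\delta>0$. Let $u_\delta\in L^1_{loc}((0,+\infty);H^s(\mathbb{R}^d;\mathbb{R}^d))$ be a distributional solution to the linear peridynamics model with initial data $(u_0,v_0)=(0,0)$. Then $u_\delta\equiv0$.
   Context: Fix $d\ge1$, $\kappa\in(0,\infty)$, $\alpha\in(0,1)$, and $\chi\in L^\infty(\mathbb{R})$ with $\operatorname{supp}\chi\subset[-1,1]$, $0\le\chi\le1$, $\chi\equiv1$ on $[-\tfrac12,\tfrac12]$. For $\delta>0$ let $\chi_\delta(y)=\chi(|y|/\delta)$, $y\in\mathbb{R}^d$. For a smooth, sufficiently decaying $u:\mathbb{R}^d\to\mathbb{R}^d$, $$K_\delta[u](x)=-\frac{\kappa}{\delta^{2(1-\alpha)}}\lim_{\varepsilon\to0}\int_{\{|y|>\varepsilon\}}\chi_\delta(y)\frac{u(x)-u(x-y)}{|y|^{d+2\alpha}}\,dy .$$ Fourier transform: $\hat u(\xi)=(2\pi)^{-d/2}\int u(x)e^{-ix\cdot\xi}dx$. For $s\in\mathbb{R}$, $H^s(\mathbb{R}^d;\mathbb{R}^d)=\{u\in\mathscr S':(1+|\xi|^2)^{s/2}\hat u\in L^2\}$. A function $u\in L^1_{loc}((0,\infty);H^s)$ is regarded as a distribution on $\mathbb{R}\times\mathbb{R}^d$ via $\langle u,\varphi\rangle=\int_0^\infty\langle u(t,\cdot),\varphi(t,\cdot)\rangle dt$ (with $H^{s}$–$H^{-s}$ duality). Distributional solution: given $u_0,v_0\in\mathcal D'(\mathbb{R}^d;\mathbb{R}^d)$,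 a distribution $u$ on $\mathbb{R}\times\mathbb{R}^d$ with $\operatorname{supp}u\subset[0,\infty)\times\mathbb{R}^d$ is a distributional solution of $\partial_{tt}u-K_\delta[u]=0$, $u(0)=u_0$, $\partial_tu(0)=v_0$ if $\langle u,\partial_{tt}\varphi-K_\delta[\varphi]\rangle=-\langle u_0,\partial_t\varphi(0,\cdot)\rangle+\langle v_0,\varphi(0,\cdot)\rangle$ for all $\varphi\in C^\infty_c(\mathbb{R}\times\mathbb{R}^d;\mathbb{R}^d)$, with $K_\delta$ acting in $x$ for each fixed $t$. *)

(* Defs.v *)
From HB Require Import structures.
From mathcomp Require Import all_boot all_order all_algebra.
From mathcomp Require Import all_classical all_reals all_analysis.
Set Implicit Arguments. Unset Strict Implicit. Unset Printing Implicit Defensive.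
Import Order.TTheory GRing.Theory Num.Theory.
Import numFieldNormedType.Exports.
Local Open Scope classical_set_scope.
Local Open Scope ring_scope.

(* Points of R^d are represented as d-tuples of reals (d.-tuple R carries the
   product (= Borel) sigma-algebra of MathComp-Analysis). *)
Section Defs.
Variable R : realType.
Variable d : nat.
Notation V := (d.-tuple R).

Definition vzero : V := [tuple (0:R) | i < d].
Definition vsub (x y : V) : V := [tuple tnth x i - tnth y i | i < d].
Definition vopp (x : V) : V := [tuple - tnth x i | i < d].
Definition dot (x y : V) : R := \sum_(i < d) tnth x i * tnth y i.
Definition enorm (x : V) : R := Num.sqrt (dot x x).
Definition setc (x : V) (k : nat) (r : R) : V :=
  [tuple if (i : nat) == k then r else tnth x i | i < d].

(* Integral over R^d, written as the iterated one-dimensional Lebesgue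
   integrals over the coordinates (equal to the Lebesgue integral on R^d by
   Tonelli/Fubini for the integrands used below).  iintE: nonnegative,
   extended-real valued;  iintR: real valued. *)
Fixpoint iintE (k : nat) (F : V -> \bar R) (x : V) : \bar R :=
  match k with
  | 0 => F x
  | k'.+1 => (\int[@lebesgue_measure R]_t iintE k' F (setc x k' t))%E
  end.
Fixpoint iintR (k : nat) (F : V -> R) (x : V) : R :=
  match k with
  | 0 => F x
  | k'.+1 => Rintegral (@lebesgue_measure R) setT (fun t => iintR k' F (setc x k' t))
  end.
Definition intE (F : V -> \bar R) : \bar R := iintE d F vzero.
Definition intR (F : V -> R) : R := iintR d F vzero.

(* Fourier transform hat psi (xi) = (2 pi)^(-d/2) \int psi(x) e^{-i x.xi} dx,
   component i:  Re = fourC psi i xi,  Im = - fourS psi i xi. *)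
Definition fnorm : R := powR (2 * pi) (- (d%:R / 2)).
Definition fourC (psi : V -> V) (i : 'I_d) (xi : V) : R :=
  fnorm * intR (fun x => tnth (psi x) i * cos (dot x xi)).
Definition fourS (psi : V -> V) (i : 'I_d) (xi : V) : R :=
  fnorm * intR (fun x => tnth (psi x) i * sin (dot x xi)).

(* An element u of H^s(R^d;R^d) is represented by its Fourier transform
   hat u = Ure + i Uim (Ure, Uim : V -> V).
   Squared H^s norm: \int (1+|xi|^2)^s |hat u(xi)|^2 dxi. *)
Definition hs2 (s : R) (Ure Uim : V -> V) : \bar R :=
  intE (fun xi => ((powR (1 + dot xi xi) s) *
     \sum_(i < d) (tnth (Ure xi) i ^+ 2 + tnth (Uim xi) i ^+ 2))%:E).

(* H^s -- H^{-s} duality <u, psi> = Re \int hat u(xi) . conj(hat psi(xi)) dxi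
   (for real-valued psi; the extension of the L^2 pairing \int u psi). *)
Definition pairing (Ure Uim : V -> V) (psi : V -> V) : R :=
  intR (fun xi => \sum_(i < d)
     (tnth (Ure xi) i * fourC psi i xi - tnth (Uim xi) i * fourS psi i xi)).

Definition esqrt (x : \bar R) : \bar R :=
  match x with
  | r%:E => (Num.sqrt r)%:E
  | +oo%E => +oo%E
  | -oo%E => 0%E
  end.

Definition Kdelta (kappa alpha : R) (chi : R -> R) (delta : R)
    (f : V -> V) (x : V) : V :=
  [tuple - (kappa / powR delta (2 * (1 - alpha))) *
      lim ((intR (fun y => if eps < enorm y then
              chi (enorm y / delta) * (tnth (f x) i - tnth (f (vsub x y)) i)
                / powR (enorm y) (d%:R + 2 * alpha) else 0))
           @[eps --> 0^'+])
   | i < d].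

Definition pd (k : option 'I_d) (G : R -> V -> R) : R -> V -> R :=
  fun t x => match k with
  | None => derive1 (fun r => G r x) t
  | Some i => derive1 (fun r => G t (setc x i r)) (tnth x i)
  end.
Definition pd_exists (k : option 'I_d) (G : R -> V -> R) (t : R) (x : V) : Prop :=
  match k with
  | None => derivable (fun r => G r x) t 1
  | Some i => derivable (fun r => G t (setc x i r)) (tnth x i) 1
  end.
Definition iterpd (ks : seq (option 'I_d)) (G : R -> V -> R) : R -> V -> R :=
  foldr pd G ks.
Definition jcont (G : R -> V -> R) : Prop :=
  forall t x e, 0 < e -> exists2 r, 0 < r & forall t' x',
    `|t' - t| < r -> enorm (vsub x' x) < r -> `|G t' x' - G t x| < e.
Definition smooth (G : R -> V -> R) : Prop :=
  forall ks, (forall k t x, pd_exists k (iterpd ks G) t x) /\ jcont (iterpd ks G).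

Definition test_fun (phi : R -> V -> V) : Prop :=
  (forall i : 'I_d, smooth (fun t x => tnth (phi t x) i)) /\
  exists M : R, forall t x, M < `|t| \/ M < enorm x -> phi t x = vzero.

Definition dtt (phi : R -> V -> V) (t : R) (x : V) : V :=
  [tuple derive1 (fun r => derive1 (fun r' => tnth (phi r' x) i) r) t | i < d].

(* u in L^1_loc((0,+oo); H^s(R^d;R^d)), u(t) real valued *)
Definition L1loc_Hs (s : R) (Ure Uim : R -> V -> V) : Prop :=
  (forall i : 'I_d, measurable_fun setT (fun p : R * V => tnth (Ure p.1 p.2) i) /\
                    measurable_fun setT (fun p : R * V => tnth (Uim p.1 p.2) i)) /\
  (forall t xi, Ure t (vopp xi) = Ure t xi /\ Uim t (vopp xi) = vopp (Uim t xi)) /\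
  (forall a b, 0 < a -> a < b ->
     (\int[@lebesgue_measure R]_(t in `[a, b]) esqrt (hs2 s (Ure t) (Uim t)) < +oo)%E).

Definition defines_distribution (Ure Uim : R -> V -> V) : Prop :=
  forall phi, test_fun phi ->
    (@lebesgue_measure R).-integrable [set t | 0 < t]
       (fun t => (pairing (Ure t) (Uim t) (phi t))%:E).

(* distributional solution of u_tt - K_delta[u] = 0 with u(0) = 0, u_t(0) = 0 *)
Definition dist_solution_zero (kappa alpha : R) (chi : R -> R) (delta : R)
    (Ure Uim : R -> V -> V) : Prop :=
  forall phi, test_fun phi ->
    Rintegral (@lebesgue_measure R) [set t | 0 < t]
      (fun t => pairing (Ure t) (Uim t)
          (fun x => vsub (dtt phi t x) (Kdelta kappa alpha chi delta (phi t) x)))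
    = 0.

End Defs.

(* Main.v *)
(** With angular frequency [omega (xi) >= 0] the operator [K_delta] is the Fourier multiplier
    [- omega (xi) ^ 2], and [omega ^ 2] grows at most quadratically.  Testing the equation with
    [a (t) b (x - z)] for all translates [z] of a bump [b] and using uniqueness for the Fourier
    transform, one gets for almost every [xi] that [y (t) = \hat u (t, xi)] satisfies
    [\int_0^oo (a'' + omega ^ 2 a) y dt = 0], simultaneously for a countable family of bumps [a]
    rich enough to say that the mollifications of [y] solve [g'' = - omega ^ 2 g].
    A priori [y] is only integrable away from [t = 0], so at first [a] must be supported in
    [(0, oo)].  d'Alembert's identity [y (t) + y (t + 2) = 2 cos (omega) y (t + 1)] then bounds
    [y] on [(0, 1)] by its values on [(1, 3)], uniformly in [xi]; hence [y] is integrable up to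
    [t = 0] and every [a] becomes admissible.  The mollifications of [y] extended by zero now
    solve the equation on the whole line and vanish for very negative times, so they are zero
    by conservation of energy, and [y = 0] by Lebesgue differentiation. *)

Require Import Defs.
From HB Require Import structures.
From mathcomp Require Import all_boot all_order all_algebra.
From mathcomp Require Import all_classical all_reals all_analysis.
From mathcomp Require Import measurable_realfun ring lra.
Import Order.TTheory GRing.Theory Num.Theory.
Import numFieldNormedType.Exports.
Local Open Scope classical_set_scope.
Local Open Scope ring_scope.
Set Implicit Arguments. Unset Strict Implicit. Unset Printing Implicit Defensive.

(** * Lebesgue measure on the space of tuples *)

Section IteratedIntegral.
Variable R : realType.
Variable d : nat.
Local Notation V := (d.-tuple R).
Local Notation leb := (@lebesgue_measure R).

(** Uniformity in the frequency is what carries the equation to [t = 0]. Tests supported in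
    [(0, oo)] are passed by solutions with arbitrary initial data, so zero data can only enter
    through bumps [a] reaching [t <= 0]. For such [a] the equation at a single [xi] is extracted
    from an integral over all frequencies: Fubini and Fourier uniqueness require
    [a (t) \hat u (t, xi)] to be jointly integrable in [(xi, t)], up to a weight in [xi].
    Boundedness of [y] near 0 for each separate [xi] would not give this, and estimates through
    Cauchy data would involve derivatives of [y] and constants depending on [omega]; the coefficient
    [2 cos (omega)] is at most 2 whatever the symbol. The weight is a negative power of
    [\prod_j (1 + xi_j ^ 2)], large enough to absorb any [s], and the rapidly decaying transform of
    [b] supplies both this weight and a compensation for the growth of the symbol. Since fields are
    real and bumps even, complex numbers never appear: all transforms are cosine integrals with a
    free phase, and the phase [- pi / 2] produces the sines. *)

Lemma measurable_setc (k : nat) :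
  measurable_fun setT (fun p : V * R => setc p.1 k p.2).
Proof.
apply/measurable_fun_tnthP => i.
rewrite (_ : _ \o _ = fun p : V * R => if (i : nat) == k then p.2 else tnth p.1 i); last first.
  by apply/funext => p /=; rewrite tnth_mktuple.
case: (_ == _); first exact: measurable_snd.
exact: measurableT_comp (measurable_tnth i) measurable_fst.
Qed.

Lemma measurable_setcr (k : nat) (x : V) : measurable_fun setT (setc x k).
Proof.
apply: (measurableT_comp (g := fun t => (x, t)) (measurable_setc k)).
exact: measurable_fun_pair.
Qed.

Local Open Scope ereal_scope.

Lemma iintE_ge0 k (F : V -> \bar R) x : (forall y, 0 <= F y) -> 0 <= iintE k F x.
Proof.
by move=> F0; elim: k x => //= k IH x; apply: integral_ge0 => t _; exact: IH.
Qed.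

Lemma measurable_iintE_param dT (T : measurableType dT) k (F : T * V -> \bar R) :
  measurable_fun setT F -> (forall p, 0 <= F p) ->
  measurable_fun setT (fun p : T * V => iintE k (fun y => F (p.1, y)) p.2).
Proof.
move=> mF F0; elim: k => [|k IH] /=.
  by rewrite (_ : (fun p => _) = F)//; apply/funext => -[].
pose G (q : (T * V) * R) := iintE k (fun y => F (q.1.1, y)) (setc q.1.2 k q.2).
have mG : measurable_fun setT G.
  pose phi (q : (T * V) * R) := (q.1.1, setc q.1.2 k q.2).
  apply: (measurableT_comp (f := fun p : T * V => iintE k (fun y => F (p.1, y)) p.2)
     (g := phi)) => //.
  apply: measurable_fun_pair; first exact: measurableT_comp.
  apply: (measurableT_comp (g := fun q : (T * V) * R => (q.1.2, q.2)) (measurable_setc k)).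
  by apply: measurable_fun_pair => //; exact: measurableT_comp.
have G0 : forall q, 0 <= G q by move=> q; apply: iintE_ge0.
exact: (measurable_fun_fubini_tonelli_F (m2 := leb) G mG G0).
Qed.

Lemma measurable_iintE k (F : V -> \bar R) :
  measurable_fun setT F -> (forall p, 0 <= F p) -> measurable_fun setT (iintE k F).
Proof.
move=> mF F0.
have := @measurable_iintE_param _ unit k (F \o snd).
move=> /(_ (measurableT_comp mF measurable_snd) (fun p => F0 _)) h.
apply: (measurableT_comp (f := fun p : unit * V => iintE k F p.2) (g := fun x => (tt, x))) => //.
exact: measurable_fun_pair.
Qed.

Lemma measurable_iintE_setc k (F : V -> \bar R) x :
  measurable_fun setT F -> (forall p, 0 <= F p) ->
  measurable_fun setT (fun t => iintE k F (setc x k t)).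
Proof.
by move=> mF F0; apply: (measurableT_comp (measurable_iintE k mF F0)); exact: measurable_setcr.
Qed.

Lemma eq_iintE k (F G : V -> \bar R) x : F =1 G -> iintE k F x = iintE k G x.
Proof. by move/funext->. Qed.

Lemma le_iintE k (F G : V -> \bar R) x :
  measurable_fun setT F -> measurable_fun setT G ->
  (forall y, 0 <= F y) -> (forall y, F y <= G y) -> iintE k F x <= iintE k G x.
Proof.
move=> mF mG F0 FG; have G0 y : 0 <= G y by exact: le_trans (F0 y) (FG y).
elim: k x => //= k IH x; apply: ge0_le_integral => //.
- by move=> t _; exact: iintE_ge0.
- exact: measurable_iintE_setc.
- exact: measurable_iintE_setc.
Qed.

Lemma iintEZl k (F : V -> \bar R) (c : R) x : measurable_fun setT F ->
  (forall p, 0 <= F p) -> (0 <= c)%R ->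
  iintE k (fun y => c%:E * F y) x = c%:E * iintE k F x.
Proof.
move=> mF F0 c0; elim: k x => //= k IH x.
under eq_integral do rewrite IH.
rewrite ge0_integralZl//; first exact: measurable_iintE_setc.
by move=> t _; exact: iintE_ge0.
Qed.

Lemma iintE_nneseries k (F : nat -> V -> \bar R) x :
  (forall n, measurable_fun setT (F n)) -> (forall n p, 0 <= F n p) ->
  iintE k (fun y => \sum_(0 <= n <oo) F n y) x = \sum_(0 <= n <oo) iintE k (F n) x.
Proof.
move=> mF F0; elim: k x => //= k IH x.
under eq_integral do rewrite IH.
rewrite integral_nneseries//; first by move=> n; exact: measurable_iintE_setc.
by move=> n t _; exact: iintE_ge0.
Qed.

Lemma iintE_cst0 k x : iintE k (fun _ : V => 0 : \bar R) x = 0.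
Proof. by elim: k x => //= k IH x; under eq_integral do rewrite IH; rewrite integral0. Qed.

Lemma iintED k (F G : V -> \bar R) x :
  measurable_fun setT F -> (forall p, 0 <= F p) ->
  measurable_fun setT G -> (forall p, 0 <= G p) ->
  iintE k (fun y => F y + G y) x = iintE k F x + iintE k G x.
Proof.
move=> mF F0 mG G0; elim: k x => //= k IH x.
under eq_integral do rewrite IH.
rewrite ge0_integralD//; try exact: measurable_iintE_setc.
all: by move=> t _; exact: iintE_ge0.
Qed.

Lemma iintE_fsum k (I : choiceType) (A : set I) (F : I -> V -> \bar R) x :
  finite_set A -> (forall i, measurable_fun setT (F i)) -> (forall i p, 0 <= F i p) ->
  iintE k (fun y => \sum_(i \in A) F i y)%R x = (\sum_(i \in A) iintE k (F i) x)%R.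
Proof.
move=> fA mF F0.
have H (s : seq I) : iintE k (fun y => (\sum_(i <- s) F i y)%R) x = (\sum_(i <- s) iintE k (F i) x)%R.
  elim: s => [|i s IH].
    rewrite big_nil -[RHS](iintE_cst0 k x); apply: eq_iintE => y; exact: big_nil.
  rewrite big_cons -IH -iintED//.
  - by apply: eq_iintE => y; rewrite big_cons.
  - exact: emeasurable_sum.
  - by move=> p; exact: sume_ge0.
rewrite fsbig_finite//= -H; apply: eq_iintE => y; exact: fsbig_finite.
Qed.

Lemma iintE_monotone k (F : nat -> V -> \bar R) x :
  (forall n, measurable_fun setT (F n)) -> (forall n p, 0 <= F n p) ->
  (forall y, {homo F^~ y : n m / (n <= m)%N >-> n <= m}) ->
  iintE k (fun y => limn (F^~ y)) x = limn (fun n => iintE k (F n) x).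
Proof.
move=> mF F0 ndF; elim: k x => //= k IH x.
under eq_integral do rewrite IH.
rewrite monotone_convergence//.
- by move=> n; exact: measurable_iintE_setc.
- by move=> n t _; exact: iintE_ge0.
- by move=> t _ n m nm; apply: le_iintE => // y; exact: ndF.
Qed.

(** The statement is phrased with iterated one-dimensional integrals. Turning them into a measure
    gives access to Fubini, dominated convergence and almost-everywhere arguments on tuples. *)
Definition mud (A : set V) : \bar R := intE (fun x => (\1_A x)%:E).

Let mud0 : mud set0 = 0.
Proof. by rewrite /mud indic0 /intE iintE_cst0. Qed.

Let mud_ge0 A : 0 <= mud A.
Proof. by apply: iintE_ge0 => y; rewrite lee_fin. Qed.

Let mud_sigma_additive : semi_sigma_additive mud.
Proof.
move=> F mF tF mUF; have -> : mud (\bigcup_n F n) = \sum_(0 <= n <oo) mud (F n).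
  rewrite /mud /intE -iintE_nneseries//.
  - by apply: eq_iintE => x; rewrite indic_bigcup.
  - by move=> n; apply/measurable_EFinP; exact: measurable_indic.
by apply: is_cvg_ereal_nneg_natsum => n _; exact: mud_ge0.
Qed.

HB.instance Definition _ := isMeasure.Build _ _ _ mud mud0 mud_ge0 mud_sigma_additive.

Import HBNNSimple.

Lemma integral_mud_sfun (f : {nnsfun V >-> R}) :
  \int[mud]_x (f x)%:E = intE (fun x => (f x)%:E).
Proof.
rewrite integralT_nnsfun sintegralE /intE.
transitivity (iintE d (fun y => \sum_(r \in range f) (r%:E * (\1_(f @^-1` [set r]) y)%:E)%E)%R (vzero R d)).
  rewrite iintE_fsum//.
  - apply: eq_fsbigr => r /set_mem[y _ <-].
    rewrite iintEZl//.
    by apply/measurable_EFinP; exact: measurable_indic.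
  - move=> r; apply/measurable_EFinP; apply: measurable_funM => //.
  - move=> r y; exact: nnfun_muleindic_ge0.
apply: eq_iintE => y; rewrite [in RHS](fimfunE f y) -fsumEFin//.
Qed.

Lemma integral_mud (F : V -> \bar R) : measurable_fun setT F -> (forall x, 0 <= F x) ->
  \int[mud]_x F x = intE F.
Proof.
move=> mF F0.
pose g := nnsfun_approx measurableT mF.
have FE y : F y = limn (fun n => (g n y)%:E).
  by apply/esym/cvg_lim => //; exact: cvg_nnsfun_approx.
have nd y : {homo (fun n => (g n y)%:E) : n m / (n <= m)%N >-> n <= m}.
  move=> n m nm; rewrite lee_fin; have /lefP := nd_nnsfun_approx measurableT mF nm; exact.
under eq_integral do rewrite FE.
rewrite monotone_convergence//.
- rewrite /intE (@eq_iintE _ F (fun y => limn (fun n => (g n y)%:E)))//.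
  rewrite iintE_monotone//.
  + by congr (limn _); apply/funext => n; rewrite integral_mud_sfun.
  + by move=> n; apply/measurable_EFinP.
  + by move=> n p; rewrite lee_fin.
- by move=> n; apply/measurable_EFinP.
- by move=> n p _; rewrite lee_fin.
Qed.

(** With time as the parameter, this makes the spatial pairing measurable in [t]. No integrability
    is required: [fine] of a difference of measurable extended functions is measurable even where
    the integral diverges. *)
Lemma measurable_iintR_param dT (T : measurableType dT) k (F : T * V -> R) :
  measurable_fun setT F ->
  measurable_fun setT (fun p : T * V => iintR k (fun y => F (p.1, y)) p.2).
Proof.
move=> mF; elim: k => [|k IH] /=.
  by rewrite (_ : (fun p => _) = F)//; apply/funext => -[].
pose G (q : (T * V) * R) := iintR k (fun y => F (q.1.1, y)) (setc q.1.2 k q.2).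
have mG : measurable_fun setT G.
  pose phi (q : (T * V) * R) := (q.1.1, setc q.1.2 k q.2).
  apply: (measurableT_comp (f := fun p : T * V => iintR k (fun y => F (p.1, y)) p.2)
     (g := phi)) => //.
  apply: measurable_fun_pair; first exact: measurableT_comp.
  apply: (measurableT_comp (g := fun q : (T * V) * R => (q.1.2, q.2)) (measurable_setc k)).
  by apply: measurable_fun_pair => //; exact: measurableT_comp.
have mGE : measurable_fun setT (EFin \o G) by apply/measurable_EFinP.
apply: (measurableT_comp (f := fine) (g := fun p => \int[leb]_t (G (p, t))%:E)) => //.
rewrite (_ : (fun p => _) = fun p => \int[leb]_t (EFin \o G)^\+ (p, t) - \int[leb]_t (EFin \o G)^\- (p, t)); last first.
  apply/funext => p; rewrite [LHS]integralE.
  by congr (_ - _); apply: eq_integral => t _; rewrite ?funeposE ?funenegE.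
apply: emeasurable_funB.
  by apply: (measurable_fun_fubini_tonelli_F (m2 := leb) (EFin \o G)^\+) => //; exact: measurable_funepos.
by apply: (measurable_fun_fubini_tonelli_F (m2 := leb) (EFin \o G)^\-) => //; exact: measurable_funeneg.
Qed.

Lemma measurable_iintR k (F : V -> R) : measurable_fun setT F -> measurable_fun setT (iintR k F).
Proof.
move=> mF.
have := @measurable_iintR_param _ unit k (F \o snd).
move=> /(_ (measurableT_comp mF measurable_snd)) h.
apply: (measurableT_comp (f := fun p : unit * V => iintR k F p.2) (g := fun x => (tt, x))) => //.
exact: measurable_fun_pair.
Qed.

(** [iintR] applies [fine] after every one-dimensional integral, so a divergent inner integral
    silently takes a default value. Absolute convergence confines this to a null set of each outer
    variable, which the next integral does not see. *)
Lemma iintR_iintE k (F : V -> R) x : measurable_fun setT F ->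
  iintE k (abse \o (EFin \o F)) x < +oo ->
  [/\ iintE k (EFin \o F)^\+ x < +oo,
     iintE k (EFin \o F)^\- x < +oo &
     (iintR k F x)%:E = iintE k (EFin \o F)^\+ x - iintE k (EFin \o F)^\- x].
Proof.
move=> mF.
have mFE : measurable_fun setT (EFin \o F) by apply/measurable_EFinP.
have mP : measurable_fun setT (EFin \o F)^\+ by exact: measurable_funepos.
have mN : measurable_fun setT (EFin \o F)^\- by exact: measurable_funeneg.
have mA : measurable_fun setT (abse \o (EFin \o F)) by exact: measurableT_comp.
have PA y : (EFin \o F)^\+ y <= (abse \o (EFin \o F)) y.
  by rewrite fune_abse /=; apply: leeDl.
have NA y : (EFin \o F)^\- y <= (abse \o (EFin \o F)) y.
  by rewrite fune_abse /=; apply: leeDr.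
have LP k' y : iintE k' (EFin \o F)^\+ y <= iintE k' (abse \o (EFin \o F)) y.
  by apply: le_iintE => // z; exact: funepos_ge0.
have LN k' y : iintE k' (EFin \o F)^\- y <= iintE k' (abse \o (EFin \o F)) y.
  by apply: le_iintE => // z; exact: funeneg_ge0.
elim: k x => [|k IH] x.
  move=> _; split; rewrite /= ?ltey ?funepos_fin_num//.
  - by rewrite funeposE /maxe; case: ifP.
  - by rewrite funenegE /maxe; case: ifP.
  - exact: (congr1 (fun g => g x) (funeposneg (EFin \o F))).
move=> H; have HP := le_lt_trans (LP k.+1 x) H; have HN := le_lt_trans (LN k.+1 x) H.
split => //.
have IP : leb.-integrable setT (fun t => iintE k (EFin \o F)^\+ (setc x k t)).
  apply/integrableP; split; first exact: measurable_iintE_setc.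
  by under eq_integral do rewrite gee0_abs ?iintE_ge0//.
have IN : leb.-integrable setT (fun t => iintE k (EFin \o F)^\- (setc x k t)).
  apply/integrableP; split; first exact: measurable_iintE_setc.
  by under eq_integral do rewrite gee0_abs ?iintE_ge0//.
have IA : leb.-integrable setT (fun t => iintE k (abse \o (EFin \o F)) (setc x k t)).
  apply/integrableP; split; first by apply: measurable_iintE_setc => // y; exact: abse_ge0.
  suff -> : \int[leb]_t `|iintE k (abse \o (EFin \o F)) (setc x k t)| = iintE k.+1 (abse \o (EFin \o F)) x by [].
  apply: eq_integral => t _.
  by rewrite gee0_abs//; apply: iintE_ge0 => y; exact: abse_ge0.
rewrite /= -integralB// /Rintegral.
have E : \int[leb]_t (iintR k F (setc x k t))%:E =
  \int[leb]_t (iintE k (EFin \o F)^\+ (setc x k t) - iintE k (EFin \o F)^\- (setc x k t)).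
  apply: ae_eq_integral => //.
  - apply/measurable_EFinP; apply: (measurableT_comp (measurable_iintR k mF)).
    exact: measurable_setcr.
  - by apply: emeasurable_funB; exact: measurable_iintE_setc.
  - have := integrable_ae measurableT IA; apply: filterS => t /(_ I) At _.
    have [|_ _ ->] // := IH (setc x k t).
    by rewrite ltey; apply: contraTN At => /eqP /= ->.
rewrite E fineK//; apply: integrable_fin_num => //.
exact: integrableB.
Qed.

Lemma intR_mud (F : V -> R) : mud.-integrable setT (EFin \o F) -> intR F = Rintegral mud setT F.
Proof.
move=> /integrableP[mFE H]; have mF : measurable_fun setT F by apply/measurable_EFinP.
have [|_ _ E] := iintR_iintE (k := d) (x := vzero R d) mF.
  by move: H; rewrite integral_mud//; exact: measurableT_comp.
apply: EFin_inj; rewrite /intR E /Rintegral integralE !integral_mud ?fineK//.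
- by rewrite -!E.
- exact: measurable_funeneg.
- exact: measurable_funepos.
Qed.

End IteratedIntegral.

(** * Reflection, translation and dilation of Lebesgue integrals *)

Section PreservingMaps.
Variable R : realType.
Local Open Scope ereal_scope.

(** The identity is proved for nonnegative functions through the pushforward, then for positive and
    negative parts separately, so divergent integrals are covered too. *)
Lemma integral_preserving dT (T : measurableType dT) (mu : {measure set T -> \bar R})
    (phi : T -> T) (f : T -> \bar R) :
  measurable_fun setT phi -> (forall A, measurable A -> mu (phi @^-1` A) = mu A) ->
  measurable_fun setT f -> \int[mu]_x f (phi x) = \int[mu]_x f x.
Proof.
move=> mphi phiA.
have H (g : T -> \bar R) : measurable_fun setT g -> (forall x, 0 <= g x) ->
    \int[mu]_x g (phi x) = \int[mu]_x g x.
  move=> mg g0.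
  have := ge0_integral_pushforward mphi mu (D := setT) (f := g) measurableT mg (fun x _ => g0 x).
  rewrite preimage_setT => <-.
  by apply: eq_measure_integral => A mA _; exact: phiA.
move=> mf; rewrite integralE [RHS]integralE.
rewrite -(H f^\+ (measurable_funepos mf) (funepos_ge0 _)).
rewrite -(H f^\- (measurable_funeneg mf) (funeneg_ge0 _)).
by congr (_ - _); apply: eq_integral => t _; rewrite ?funeposE ?funenegE.
Qed.

Local Notation leb := (@lebesgue_measure R).

Lemma integral_lebesgueN (f : R -> \bar R) : measurable_fun setT f ->
  \int[leb]_x f (- x)%R = \int[leb]_x f x.
Proof.
move=> mf; apply: (@integral_preserving _ _ leb (fun x => - x)%R) => //; first exact: oppr_measurable.
by move=> A mA; exact: lebesgue_measureN.
Qed.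

(** Lebesgue measure is determined by its values on half-open intervals; the same argument handles
    dilations after rescaling the measure. *)
Lemma lebesgue_measure_shift (c : R) (A : set R) : measurable A ->
  pushforward leb ((fun x => x + c)%R : _ -> measurableTypeR R) A = leb A.
Proof.
move=> mA; apply/esym.
pose phi : measurableTypeR R -> measurableTypeR R := (fun x => x + c)%R.
have mphi : measurable_fun setT phi by exact: measurable_funD.
suff H : forall X : set R, ocitv X -> leb X = pushforward leb phi X.
  exact: (lebesgue_measure_unique H mA).
move=> _ [[a b]] _ <- /=; rewrite /pushforward/phi.
have -> : ((fun x : measurableTypeR R => x + c)%R @^-1` `]a, b]) = `](a - c)%R, (b - c)%R]%classic.
  by apply/seteqP; split => x /=; rewrite !in_itv/= ltrBlDr lerBrDr.
rewrite !lebesgue_measure_itv/= !lte_fin ltrD2r; case: ifP => // _.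
by rewrite -!EFinB; congr EFin; ring.
Qed.

Lemma integral_shift (c : R) (f : R -> \bar R) : measurable_fun setT f ->
  \int[leb]_x f (x + c)%R = \int[leb]_x f x.
Proof.
move=> mf; apply: (@integral_preserving _ _ leb (fun x => x + c)%R) => // [|A mA].
  exact: measurable_funD.
exact: lebesgue_measure_shift.
Qed.

Lemma lebesgue_measure_dilate (c : R) (A : set R) : (0 < c)%R -> measurable A ->
  c%:E * pushforward leb ((fun x => c * x)%R : _ -> measurableTypeR R) A = leb A.
Proof.
move=> c0 mA; apply/esym.
pose phi : measurableTypeR R -> measurableTypeR R := (fun x => c * x)%R.
have mphi : measurable_fun setT phi by exact: mulrl_measurable.
suff H : forall X : set R, ocitv X -> leb X = mscale (NngNum (ltW c0)) (pushforward leb phi) X.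
  exact: (lebesgue_measure_unique (H mphi) mA).
move=> m _ [[a b]] _ <- /=; rewrite /mscale/= /pushforward/phi.
have -> : ((fun x : measurableTypeR R => c * x)%R @^-1` `]a, b]) = `](a / c)%R, (b / c)%R]%classic.
  by apply/seteqP; split => x /=; rewrite !in_itv/= ltr_pdivrMr// ler_pdivlMr// mulrC.
rewrite !lebesgue_measure_itv/= !lte_fin ltr_pM2r ?invr_gt0//; case: ifP => _.
  by rewrite -!EFinB -EFinM; congr EFin; field; rewrite gt_eqF.
by rewrite mule0.
Qed.

Lemma ge0_integral_dilate (c : R) (f : R -> \bar R) : (0 < c)%R -> measurable_fun setT f ->
  (forall x, 0 <= f x) -> c%:E * \int[leb]_x f (c * x)%R = \int[leb]_x f x.
Proof.
move=> c0 mf f0.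
pose phi := (fun x => c * x)%R : measurableTypeR R -> measurableTypeR R.
have mphi : measurable_fun setT phi by exact: mulrl_measurable.
have := ge0_integral_pushforward mphi leb (D := setT) (f := f) measurableT mf (fun x _ => f0 x).
rewrite preimage_setT /= /comp => <-.
rewrite -(ge0_integral_mscale (pushforward leb phi) measurableT (NngNum (ltW c0)))//.
apply: eq_measure_integral => A mA _.
exact: lebesgue_measure_dilate.
Qed.

End PreservingMaps.

(** * Product integrands and the volume of cubes *)

Section Products.
Variable R : realType.
Variable d : nat.
Local Notation V := (d.-tuple R).
Local Notation leb := (@lebesgue_measure R).
Local Notation mu := (@mud R d).
Local Open Scope ereal_scope.

Lemma tnth_setc (x : V) k r (i : 'I_d) : tnth (setc x k r) i = if (i : nat) == k then r else tnth x i.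
Proof. exact: tnth_mktuple. Qed.

(** The intermediate form is what induction on [k] needs: coordinates below [k] are already
    integrated, the remaining ones are still evaluated at [x]. *)
Lemma iintE_prod k (f : 'I_d -> R -> R) (c : 'I_d -> R) (x : V) : (k <= d)%N ->
  (forall i, measurable_fun setT (f i)) -> (forall i t, 0 <= f i t)%R ->
  (forall i, \int[leb]_t (f i t)%:E = (c i)%:E) ->
  iintE k (fun y => (\prod_(i < d) f i (tnth y i))%:E) x =
  (\prod_(i < d) (if (i < k)%N then c i else f i (tnth x i)))%:E.
Proof.
move=> kd mf f0 fc.
have c0 i : (0 <= c i)%R by rewrite -lee_fin -fc; apply: integral_ge0 => t _; rewrite lee_fin.
elim: k kd x => [|k IH] kd x; first by [].
rewrite [LHS]/=.
pose j := Ordinal kd.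
pose P := (\prod_(i < d | i != j) (if (i < k.+1)%N then c i else f i (tnth x i)))%R.
transitivity (\int[leb]_t (P%:E * (f j t)%:E)).
  apply: eq_integral => t _; rewrite IH ?(ltnW kd)// -EFinM; congr EFin.
  rewrite (bigD1 j)//= ltnn tnth_setc eqxx mulrC; congr (_ * _)%R.
  apply: eq_bigr => i ij; rewrite tnth_setc.
  have ik : (i : nat) != k by apply: contraNneq ij => ik; apply/eqP/val_inj.
  by rewrite ltnS [(i <= k)%N]leq_eqVlt (negbTE ik).
rewrite ge0_integralZl//.
- by rewrite fc -EFinM (bigD1 j)//= ltnSn mulrC.
- by apply/measurable_EFinP; exact: mf.
- by move=> t _; rewrite lee_fin.
- by rewrite lee_fin; apply: prodr_ge0 => i _; case: ifP.
Qed.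

Lemma measurable_fun_prod_tnth (f : 'I_d -> R -> R) : (forall i, measurable_fun setT (f i)) ->
  measurable_fun setT (fun y : V => \prod_(i < d) f i (tnth y i))%R.
Proof.
move=> mf; apply: measurable_prod => i _.
exact: measurableT_comp (measurable_tnth i).
Qed.

Lemma integral_mud_prod (f : 'I_d -> R -> R) (c : 'I_d -> R) :
  (forall i, measurable_fun setT (f i)) -> (forall i t, 0 <= f i t)%R ->
  (forall i, \int[leb]_t (f i t)%:E = (c i)%:E) ->
  \int[mu]_y (\prod_(i < d) f i (tnth y i))%:E = (\prod_(i < d) c i)%:E.
Proof.
move=> mf f0 fc; rewrite integral_mud.
- by rewrite /intE (iintE_prod _ (leqnn d) mf f0 fc); congr EFin; apply: eq_bigr => i _; rewrite ltn_ord.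
- by apply/measurable_EFinP; exact: measurable_fun_prod_tnth.
- by move=> y; rewrite lee_fin; apply: prodr_ge0.
Qed.

Lemma integrable_mud_prod (f : 'I_d -> R -> R) :
  (forall i, leb.-integrable setT (EFin \o f i)) ->
  mu.-integrable setT (EFin \o (fun y : V => \prod_(i < d) f i (tnth y i))%R).
Proof.
move=> If.
have mf i : measurable_fun setT (f i) by apply/measurable_EFinP; case/integrableP: (If i).
apply/integrableP; split; first by apply/measurable_EFinP; exact: measurable_fun_prod_tnth.
under eq_integral do rewrite /= normr_prod.
rewrite (@integral_mud_prod (fun i t => `|f i t|)%R (fun i => fine (\int[leb]_t (`|f i t|%R)%:E))) ?ltry//.
- by move=> i; exact: measurableT_comp.
- move=> i; rewrite fineK// ge0_fin_numE; last by apply: integral_ge0.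
  by case/integrableP: (If i).
Qed.

Definition cube (a : V) (r : R) : set V := [set x | forall i, `|tnth x i - tnth a i| <= r]%R.

Lemma indic_cube a r (x : V) :
  (\1_(cube a r) x = \prod_(i < d) \1_(`[tnth a i - r, tnth a i + r]%classic) (tnth x i) :> R)%R.
Proof.
rewrite indicE; case: (asboolP (cube a r x)) => H.
  rewrite (mem_set H) big1// => i _; rewrite indicE mem_set//= in_itv/=.
  by rewrite -ler_distl; exact: H.
rewrite memNset//; apply/esym/eqP/prodf_eq0.
have [i Hi] : exists i, ~ (`|tnth x i - tnth a i| <= r)%R by apply/existsNP.
exists i => //; rewrite indicE memNset//= in_itv/= -ler_distl; exact: Hi.
Qed.

Lemma measurable_cube a r : measurable (cube a r).
Proof.
rewrite (_ : cube a r = \big[setI/setT]_(i < d) ((@tnth d R)^~ i @^-1` `[tnth a i - r, tnth a i + r]%classic)%R).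
  apply: bigsetI_measurable => i _; rewrite -[X in measurable X]setTI.
  exact: measurable_tnth.
rewrite -bigcap_seq; apply/seteqP; split => x /= H.
  by move=> i _; rewrite /= in_itv/= -ler_distl.
by move=> i; have := H i (mem_index_enum i); rewrite /= in_itv/= -ler_distl.
Qed.

Lemma mud_cube a r : (0 <= r)%R -> mu (cube a r) = ((2 * r) ^+ d)%:E.
Proof.
move=> r0; rewrite -[LHS]mul1e -integral_cst; last exact: measurable_cube.
rewrite integral_mkcond.
transitivity (\int[mu]_y (\prod_(i < d) \1_(`[tnth a i - r, tnth a i + r]%classic) (tnth y i))%:E).
  by apply: eq_integral => y _; rewrite -indic_cube patchE indicE; case: ifP.
rewrite (@integral_mud_prod (fun i => \1_(`[tnth a i - r, tnth a i + r]%classic))%R (fun=> (2 * r)%R)).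
- by rewrite prodr_const card_ord.
- by move=> i; exact: measurable_indic.
- by move=> i t.
- move=> i; rewrite integral_indic// setIT.
  rewrite /= lebesgue_measure_itv/= lte_fin.
  case: ifPn => [_|]; first by rewrite -EFinB; congr EFin; ring.
  rewrite -leNgt => h; congr EFin; have -> : r = 0%R by lra.
  by rewrite mulr0.
Qed.

End Products.

Section SigmaFinite.
Variable R : realType.
Variable d : nat.
Local Notation V := (d.-tuple R).
Local Notation leb := (@lebesgue_measure R).
Local Open Scope ereal_scope.

Let mud_sigma_finite : sigma_finite setT (@mud R d).
Proof.
exists (fun n => cube (vzero R d) n%:R).
  apply/esym/seteqP; split => // x _.
  exists (Num.bound (\sum_(i < d) `|tnth x i|)%R) => // i.
  rewrite /vzero tnth_mktuple subr0.
  have h : (`|tnth x i| <= \sum_(i < d) `|tnth x i|)%R.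
    by rewrite (bigD1 i)//= lerDl sumr_ge0.
  apply: (le_trans h); apply: ltW; apply: le_lt_trans (archi_boundP _); last exact: sumr_ge0.
  by [].
move=> n; split; first exact: measurable_cube.
by rewrite mud_cube// ltry.
Qed.

HB.instance Definition _ := Measure_isSigmaFinite.Build _ _ _ (@mud R d) mud_sigma_finite.

End SigmaFinite.

Section MeasurableOps.
Variable R : realType.
Variable d : nat.
Local Notation V := (d.-tuple R).
Variables (dT : measure_display) (T : measurableType dT).
Implicit Types f g : T -> V.

Lemma measurable_fun_tnth f i : measurable_fun setT f -> measurable_fun setT (fun x => tnth (f x) i).
Proof. by move=> mf; exact: measurableT_comp (measurable_tnth i) mf. Qed.

Lemma measurable_vopp f : measurable_fun setT f -> measurable_fun setT (fun x => vopp (f x)).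
Proof.
move=> mf; apply/measurable_fun_tnthP => i.
rewrite (_ : _ \o _ = fun x => - tnth (f x) i); last by apply/funext => x /=; rewrite tnth_mktuple.
by apply: measurableT_comp => //; exact: measurable_fun_tnth.
Qed.

Lemma measurable_vsub f g : measurable_fun setT f -> measurable_fun setT g ->
  measurable_fun setT (fun x => vsub (f x) (g x)).
Proof.
move=> mf mg; apply/measurable_fun_tnthP => i.
rewrite (_ : _ \o _ = fun x => tnth (f x) i - tnth (g x) i); last by apply/funext => x /=; rewrite tnth_mktuple.
by apply: measurable_funB; exact: measurable_fun_tnth.
Qed.

Lemma measurable_dot f g : measurable_fun setT f -> measurable_fun setT g ->
  measurable_fun setT (fun x => dot (f x) (g x)).
Proof.
move=> mf mg; apply: measurable_sum => i.
by apply: measurable_funM; exact: measurable_fun_tnth.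
Qed.

Lemma measurable_enorm f : measurable_fun setT f -> measurable_fun setT (fun x => enorm (f x)).
Proof.
move=> mf; apply: (measurableT_comp (f := @Num.sqrt R)); last exact: measurable_dot.
by apply: continuous_measurable_fun; exact: sqrt_continuous.
Qed.

End MeasurableOps.

Section Reflection.
Variable R : realType.
Variable d : nat.
Local Notation V := (d.-tuple R).
Local Notation leb := (@lebesgue_measure R).
Local Open Scope ereal_scope.

Lemma vopp_setc (x : V) k t : vopp (setc x k t) = setc (vopp x) k (- t)%R.
Proof. by apply: eq_from_tnth => i; rewrite !tnth_mktuple; case: ifP. Qed.

Lemma vopp0 : vopp (vzero R d) = vzero R d.
Proof. by apply: eq_from_tnth => i; rewrite !tnth_mktuple oppr0. Qed.

Lemma iintE_vopp k (F : V -> \bar R) x : measurable_fun setT F -> (forall y, 0 <= F y) ->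
  iintE k (fun y => F (vopp y)) x = iintE k F (vopp x).
Proof.
move=> mF F0; elim: k x => //= k IH x.
rewrite -(integral_lebesgueN (f := fun t => iintE k F (setc (vopp x) k t))); last exact: measurable_iintE_setc.
by apply: eq_integral => t _; rewrite IH vopp_setc.
Qed.

Lemma integral_mud_vopp (F : V -> \bar R) : measurable_fun setT F ->
  \int[@mud R d]_x F (vopp x) = \int[@mud R d]_x F x.
Proof.
move=> mF; apply: integral_preserving => //; first exact: measurable_vopp.
move=> A mA; rewrite -[LHS]mul1e -integral_cst; last first.
  by rewrite -[X in measurable X]setTI; exact: (measurable_vopp (@measurable_id _ _ setT)).
rewrite -[RHS]mul1e -integral_cst// integral_mkcond [RHS]integral_mkcond.
have mI : measurable_fun setT ((cst 1 : V -> \bar R) \_ A).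
  by apply/(measurable_restrictT _ mA).
have I0 x : 0 <= ((cst 1 : V -> \bar R) \_ A) x by rewrite patchE; case: ifP.
rewrite (integral_mud mI I0) integral_mud.
- by rewrite /intE -{2}vopp0 -iintE_vopp.
- exact: (measurableT_comp mI (measurable_vopp (@measurable_id _ _ setT))).
- by move=> x; rewrite patchE; case: ifP.
Qed.

End Reflection.

(** * Test functions *)

Section Smooth.
Variable R : realType.
Implicit Types (f g : R -> R) (x : R).

Fixpoint Cn (n : nat) f : Prop :=
  if n is m.+1 then (forall x, derivable f x 1) /\ Cn m (derive1 f) else True.

Definition smooth1 f := forall n, Cn n f.

Lemma CnS n f : Cn n.+1 f -> Cn n f.
Proof. by elim: n f => // n IH f [df H]; split => //; exact: IH. Qed.

Lemma smooth1_derivable f x : smooth1 f -> derivable f x 1.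
Proof. by move=> /(_ 1%N)[]. Qed.

Lemma smooth1_derive f : smooth1 f -> smooth1 (derive1 f).
Proof. by move=> sf n; have [] := sf n.+1. Qed.

Lemma smooth1_continuous f : smooth1 f -> continuous f.
Proof. by move=> sf x; apply/differentiable_continuous/derivable1_diffP/smooth1_derivable. Qed.

Lemma smooth1_is_derive f x : smooth1 f -> is_derive x 1 f ((derive1 f) x).
Proof. by move=> sf; apply: DeriveDef; [exact: smooth1_derivable|rewrite derive1E]. Qed.

Lemma is_derive_derive1 f f' : (forall x, is_derive x 1 f (f' x)) -> (derive1 f) = f'.
Proof. by move=> H; apply/funext => x; rewrite derive1E; have [_ ->] := H x. Qed.

(** A coinduction principle: a class of differentiable functions closed under [derive1] consists of
    smooth functions. It replaces explicit formulas for higher derivatives. *)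
Lemma smooth1_ind (P : (R -> R) -> Prop) :
  (forall f, P f -> (forall x, derivable f x 1) /\ P (derive1 f)) -> forall f, P f -> smooth1 f.
Proof. by move=> H f Pf n; elim: n f Pf => //= n IH f /H[? ?]; split => //; exact: IH. Qed.

Lemma smooth1_cst (c : R) : smooth1 (fun=> c).
Proof.
apply: (@smooth1_ind (fun f => exists c, f = fun=> c)); last by exists c.
move=> _ [e ->]; split; first by move=> x; exact: derivable_cst.
by exists 0; apply/funext => x; rewrite (derive1_cst e x).
Qed.

Lemma CnD n f g : Cn n f -> Cn n g -> Cn n (fun x => f x + g x).
Proof.
elim: n f g => //= n IH f g [df Cf] [dg Cg]; split; first by move=> x; exact: derivableD.
have -> : derive1 (fun x => f x + g x) = (fun x => (derive1 f) x + (derive1 g) x); last exact: IH.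
apply: is_derive_derive1 => x; rewrite !derive1E; apply: is_deriveD; exact: derivableP.
Qed.

Lemma CnM n f g : Cn n f -> Cn n g -> Cn n (fun x => f x * g x).
Proof.
elim: n f g => //= n IH f g [df Cf] [dg Cg]; split; first by move=> x; exact: derivableM.
have -> : derive1 (fun x => f x * g x) = (fun x => f x * (derive1 g) x + g x * (derive1 f) x); last first.
  by apply: CnD; apply: IH => //; apply: CnS.
apply: is_derive_derive1 => x; rewrite !derive1E; apply: is_deriveM; exact: derivableP.
Qed.

Lemma smooth1M f g : smooth1 f -> smooth1 g -> smooth1 (fun x => f x * g x).
Proof. by move=> sf sg n; exact: CnM. Qed.

Lemma is_derive_affine f a b x df : is_derive (a * x + b) 1 f df ->
  is_derive x 1 (fun x => f (a * x + b)) (df * a).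
Proof.
move=> H; apply: (@is_derive1_comp _ f (fun x => a * x + b)) => //.
rewrite -[X in is_derive _ _ _ X]addr0 -[X in X + 0]mulr1 .
by apply: is_deriveD.
Qed.

Lemma smooth1_affine f a b : smooth1 f -> smooth1 (fun x => f (a * x + b)).
Proof.
move=> sf n; have {sf} := sf n; elim: n f => //= n IH f [df Cf]; split.
  by move=> x; have [] := is_derive_affine (derivableP (df (a * x + b))).
have -> : derive1 (fun x => f (a * x + b)) = (fun x => (derive1 f) (a * x + b) * a); last first.
  by apply: CnM; [exact: (IH (derive1 f))|exact: smooth1_cst].
apply: is_derive_derive1 => x; rewrite derive1E; apply: is_derive_affine; exact: derivableP.
Qed.

(** Half of the exponent pays for the new factor [y], the other half goes to the induction
    hypothesis; this is why [e] is arbitrary. *)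
Lemma poly_expR_bound (P : {poly R}) (e : R) : 0 < e ->
  exists2 C, 0 <= C & forall y, 0 <= y -> `|P.[y]| <= C * expR (e * y).
Proof.
elim/poly_ind: P e => [|P c IH] e e0; first by exists 0 => // y _; rewrite horner0 normr0 mul0r.
have e20 : 0 < e / 2 by lra.
have [C C0 HC] := IH _ e20.
exists (C * (2 / e) + `|c|).
  by apply: addr_ge0 => //; apply: mulr_ge0 => //; apply: divr_ge0 => //; exact: ltW.
move=> y y0; rewrite hornerMXaddC; apply: le_trans (ler_normD _ _) _.
have h1 : y <= 2 / e * expR (e / 2 * y).
  have := expR_ge1Dx (e / 2 * y) => h.
  rewrite -ler_pdivrMl ?divr_gt0//; apply: le_trans h.
  rewrite invf_div; lra.
have h2 : 1 <= expR (e * y).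
  by apply: le_trans (expR_ge1Dx _); rewrite lerDl mulr_ge0 // ltW.
have h3 : expR (e * y) = expR (e / 2 * y) * expR (e / 2 * y) by rewrite -expRD; congr expR; lra.
rewrite mulrDl; apply: lerD; last by rewrite ler_peMr.
rewrite normrM (ger0_norm y0) h3.
have := HC _ y0; have := expR_gt0 (e / 2 * y); set E := expR _ => E0 h4.
have -> : C * (2 / e) * (E * E) = C * E * (2 / e * E) by ring.
by apply: ler_pM.
Qed.

(* The derivative of [flat P] is [flat Q] with [Q (y) = y ^ 2 (P (y) - P' (y))]. *)
Definition flat (P : {poly R}) x : R := if 0 < x then P.[x^-1] * expR (- x^-1) else 0.

Lemma flat_le0 P x : x <= 0 -> flat P x = 0.
Proof. by rewrite /flat leNgt => /negbTE ->. Qed.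

(** The exponential also dominates ['X * P], and the extra factor [x^-1] becomes linear decay at the
    origin. *)
Lemma flat_bound P : exists2 C, 0 <= C & forall x, `|flat P x| <= C * `|x|.
Proof.
have [C C0 HC] := poly_expR_bound ('X * P) ltr01.
exists C => // x; rewrite /flat; case: ifPn => x0; last by rewrite normr0 mulr_ge0.
have x10 : 0 < x^-1 by rewrite invr_gt0.
have := HC _ (ltW x10); rewrite hornerM hornerX mul1r normrM (gtr0_norm x10) (gtr0_norm x0) => h.
rewrite normrM (gtr0_norm (expR_gt0 _)) expRN.
rewrite ler_pdivrMr ?expR_gt0//.
move: h; rewrite ler_pdivrMl// => h; apply: (le_trans h); lra.
Qed.

Lemma flatMX P x : flat ('X * P) x * x = flat P x.
Proof.
rewrite /flat; case: ifPn => [x0|_]; last by rewrite mul0r.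
rewrite hornerM hornerX; field; exact: lt0r_neq0.
Qed.

Lemma is_derive_flat P x : is_derive x 1 (flat P) (flat ('X * ('X * (P - P^`()))) x).
Proof.
have [x0|x0|->] := ltgtP x 0.
- rewrite flat_le0 ?ltW//.
  apply: (@near_eq_is_derive _ _ _ (fun=> 0)) => //.
  near=> y; rewrite flat_le0//; apply: ltW; near: y; exact: lt_nbhsl.
- rewrite {2}/flat x0.
  suff H : is_derive x 1 (fun y : R => P.[y^-1] * expR (- y^-1))
      (('X * ('X * (P - P^`()))).[x^-1] * expR (- x^-1)).
    apply: near_eq_is_derive H.
    by near=> y; rewrite /flat ifT//; near: y; exact: lt_nbhsr.
  have xn0 : x != 0 by rewrite gt_eqF.
  have dV : is_derive x 1 (fun y : R => y^-1) (- x ^- 2).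
    by apply: is_derive_eq; [exact: (@is_deriveV _ id)|rewrite scaler1].
  have dP := is_derive1_comp (is_derive_poly P x^-1) dV.
  have dE : is_derive x 1 (fun y => expR (- y^-1)) (expR (- x^-1) * x ^- 2).
    apply: (is_derive1_comp (is_derive_expR _)).
    by rewrite -[X in is_derive _ _ _ X]opprK; apply: is_deriveN.
  have H := is_deriveM dP dE; rewrite /GRing.scale /= in H.
  rewrite (_ : _ * expR (- x^-1) = P.[x^-1] * (expR (- x^-1) / x ^+ 2) + expR (- x^-1) * (P^`().[x^-1] * - x ^- 2)) //.
  by rewrite !hornerE /=; field.
- rewrite [X in is_derive _ _ _ X]flat_le0//.
  have H : h^-1 *: (flat P (h *: 1 + 0) - flat P 0) @[h --> 0^'] --> 0.
    apply/cvgr0Pnorm_le => e e0.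
    (* By [flatMX] the difference quotient at the origin is [flat ('X * P) h], which the linear
       bound sends to 0. *)
    have [C C0 HC] := flat_bound ('X * P).
    near=> h.
    have h0 : h != 0 by near: h; exact: nbhs_dnbhs_neq.
    rewrite (flat_le0 P (lexx 0)) subr0 addr0 scaler1 /GRing.scale /= -flatMX mulrC mulfK//.
    apply: le_trans (HC h) _.
    apply: (@le_trans _ _ ((C + 1) * `|h|)); first by rewrite ler_wpM2r// lerDl.
    rewrite -ler_pdivlMl ?ltr_wpDl// mulrC.
    near: h; apply: dnbhs0_le; by rewrite divr_gt0 // ltr_wpDl.
  apply: DeriveDef; first by apply/cvg_ex; exists 0.
  exact: cvg_lim.
Unshelve. all: by end_near. Qed.

Lemma smooth1_flat P : smooth1 (flat P).
Proof.
apply: (@smooth1_ind (fun f => exists P, f = flat P)); last by exists P.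
move=> _ [Q ->]; split; first by move=> x; have [] := is_derive_flat Q x.
exists ('X * ('X * (Q - Q^`()))); apply: is_derive_derive1; exact: is_derive_flat.
Qed.

(** The symmetric product makes the bump even, so that its Fourier transform is a real cosine
    integral. Both edges are smooth because [flat 1] is smooth and vanishes on the negative
    half-line. *)
Definition bumpf r x : R := flat 1 (r + x) * flat 1 (r - x).

Lemma flat1_ge0 x : 0 <= flat 1 x.
Proof. by rewrite /flat; case: ifP => // _; rewrite hornerC mul1r expR_ge0. Qed.

Lemma flat1_gt0 x : 0 < x -> 0 < flat 1 x.
Proof. by rewrite /flat => ->; rewrite hornerC mul1r expR_gt0. Qed.

Lemma bump_ge0 r x : 0 <= bumpf r x.
Proof. by apply: mulr_ge0; exact: flat1_ge0. Qed.

Lemma bump_even r x : bumpf r (- x) = bumpf r x.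
Proof. by rewrite /bumpf opprK mulrC. Qed.

Lemma bump_supp r x : r < `|x| -> bumpf r x = 0.
Proof.
move=> h; rewrite /bumpf; have [x0|x0] := leP 0 x.
  by rewrite [X in _ * X]flat_le0 ?mulr0//; move: h; rewrite ger0_norm//; lra.
by rewrite flat_le0 ?mul0r//; move: h; rewrite ltr0_norm//; lra.
Qed.

Lemma smooth1_bump r : smooth1 (bumpf r).
Proof.
rewrite /bumpf; apply: smooth1M.
  have -> : (fun x => flat 1 (r + x)) = (fun x => flat 1 (1 * x + r)).
    by apply/funext => x; rewrite mul1r addrC.
  exact/smooth1_affine/smooth1_flat.
have -> : (fun x => flat 1 (r - x)) = (fun x => flat 1 (-1 * x + r)).
  by apply/funext => x; rewrite mulN1r addrC.
exact/smooth1_affine/smooth1_flat.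
Qed.

End Smooth.

Section TestFunctions.
Variable R : realType.
Variable d : nat.
Local Notation V := (d.-tuple R).

Definition tensor (a : R -> R) (b : 'I_d -> R -> R) (t : R) (x : V) : R :=
  a t * \prod_(j < d) b j (tnth x j).

Lemma tnth_le_enorm (x : V) i : `|tnth x i| <= enorm x.
Proof.
rewrite /enorm -sqrtr_sqr ler_sqrt.
  rewrite /dot (bigD1 i)//= -expr2 lerDl; apply: sumr_ge0 => j _.
  by rewrite -expr2 sqr_ge0.
by rewrite /dot; apply: sumr_ge0 => j _; rewrite -expr2 sqr_ge0.
Qed.

Lemma tnth_vsub (x y : V) i : tnth (vsub x y) i = tnth x i - tnth y i.
Proof. exact: tnth_mktuple. Qed.

Lemma jcontM (F G : R -> V -> R) : jcont F -> jcont G -> jcont (fun t x => F t x * G t x).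
Proof.
move=> cF cG t x e e0.
pose M := `|F t x| + `|G t x| + 1.
have M0 : 0 < M by rewrite ltr_wpDl// addr_ge0.
pose e1 := Num.min 1 (e / (3 * M)).
have e10 : 0 < e1 by rewrite lt_min ltr01 divr_gt0 ?mulr_gt0.
have [r r0 Hr] := cF t x e1 e10.
have [s s0 Hs] := cG t x e1 e10.
exists (Num.min r s); first by rewrite lt_min r0 s0.
move=> t' x'; rewrite !lt_min => /andP[a1 a2] /andP[b1 b2].
have h1 := Hr t' x' a1 b1; have h2 := Hs t' x' a2 b2.
have -> : F t' x' * G t' x' - F t x * G t x =
  (F t' x' - F t x) * (G t' x' - G t x) + F t x * (G t' x' - G t x) + (F t' x' - F t x) * G t x by ring.
have e11 : e1 <= 1 by rewrite ge_min lexx.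
have e1M : e1 * M <= e / 3.
  have : e1 <= e / (3 * M) by rewrite ge_min lexx orbT.
  by rewrite invfM mulrA ler_pdivlMr.
apply: le_lt_trans (ler_normD _ _) _; apply: le_lt_trans (lerD (ler_normD _ _) (lexx _)) _.
rewrite !normrM.
have k1 : `|F t' x' - F t x| * `|G t' x' - G t x| <= e1 * 1.
  by apply: ler_pM => //; [exact: ltW|exact: ltW (lt_le_trans h2 e11)].
have k2 : `|F t x| * `|G t' x' - G t x| <= `|F t x| * e1 by rewrite ler_wpM2l// ltW.
have k3 : `|F t' x' - F t x| * `|G t x| <= e1 * `|G t x| by rewrite ler_wpM2r// ltW.
apply: (@le_lt_trans _ _ (e1 * M)); last by lra.
by rewrite /M; lra.
Qed.

Lemma jcont_cst (c : R) : jcont (fun t (x : V) => c).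
Proof. by move=> t x e e0; exists 1 => // t' x' _ _; rewrite subrr normr0. Qed.

Lemma jcont_prod (I : Type) (s : seq I) (F : I -> R -> V -> R) : (forall i, jcont (F i)) ->
  jcont (fun t x => \prod_(i <- s) F i t x).
Proof.
move=> cF; elim: s => [|i s IH].
  rewrite (_ : (fun t x => _) = fun t (x : V) => 1); first exact: jcont_cst.
  by apply/funext => t; apply/funext => x; rewrite big_nil.
rewrite (_ : (fun t x => _) = fun t (x : V) => F i t x * \prod_(j <- s) F j t x); first exact: jcontM.
by apply/funext => t; apply/funext => x; rewrite big_cons.
Qed.

Lemma continuous_dist (f : R -> R) x e : continuous f -> 0 < e ->
  exists2 r, 0 < r & forall y, `|y - x| < r -> `|f y - f x| < e.
Proof.
move=> /(_ x) /cvgrPdist_lt /(_ e) cf e0.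
have [r /= r0 H] := cf e0.
exists r => // y h; rewrite distrC; apply: H => /=; rewrite distrC; exact: h.
Qed.

Lemma jcont_tensor a b : continuous a -> (forall j, continuous (b j)) -> jcont (tensor a b).
Proof.
move=> ca cb; apply: jcontM.
  move=> t x e e0; have [r r0 H] := continuous_dist t ca e0.
  by exists r => // t' x' h _; exact: H.
apply: jcont_prod => j t x e e0.
have [r r0 H] := continuous_dist (tnth x j) (cb j) e0.
exists r => // t' x' _ h; apply: H.
by rewrite -tnth_vsub; apply: le_lt_trans (tnth_le_enorm _ _) h.
Qed.

Lemma tensor_setc a b t (x : V) (i : 'I_d) r :
  tensor a b t (setc x i r) = (a t * \prod_(j < d | j != i) b j (tnth x j)) * b i r.
Proof.
rewrite /tensor (bigD1 i)//= tnth_setc eqxx mulrCA mulrC; congr (_ * _ * _).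
by apply: eq_bigr => j ji; rewrite tnth_setc; case: eqP => // /val_inj e; rewrite e eqxx in ji.
Qed.

(** Every partial derivative of a tensor product is again one, so the class [P] is stable under [pd]
    and only the joint continuity of tensor products remains to be checked. *)
Lemma smooth_tensor a b : smooth1 a -> (forall j, smooth1 (b j)) -> smooth (tensor a b).
Proof.
move=> sa sb.
pose P (G : R -> V -> R) := exists a' b', [/\ smooth1 a', forall j, smooth1 (b' j) & G = tensor a' b'].
have P_exists G k t x : P G -> pd_exists k G t x.
  move=> [a' [b' [sa' sb' ->]]]; case: k => [i|] /=.
    under eq_fun do rewrite tensor_setc.
    by apply: derivableM; [exact: derivable_cst|exact: smooth1_derivable].
  rewrite /tensor; apply: derivableM; [exact: smooth1_derivable|exact: derivable_cst].
have P_pd G k : P G -> P (pd k G).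
  move=> [a' [b' [sa' sb' ->]]]; case: k => [i|].
    exists a', (fun j => if j == i then derive1 (b' i) else b' j); split => //.
      by move=> j; case: eqP => // _; exact: smooth1_derive.
    apply/funext => t; apply/funext => x /=.
    under eq_fun do rewrite tensor_setc.
    rewrite derive1Ml; last exact: smooth1_derivable.
    rewrite /tensor [in RHS](bigD1 i)//= eqxx.
    rewrite [in RHS](eq_bigr (fun j => b' j (tnth x j))); first by ring.
    by move=> j /negbTE ->.
  exists (derive1 a'), b'; split => //; first exact: smooth1_derive.
  apply/funext => t; apply/funext => x /=; rewrite /tensor derive1Mr//.
  exact: smooth1_derivable.
have P_it ks : P (iterpd ks (tensor a b)).
  by elim: ks => [|k ks IH]; [exists a, b|exact: P_pd].
move=> ks; split; first by move=> k t x; apply: P_exists.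
have [a' [b' [sa' sb' ->]]] := P_it ks.
by apply: jcont_tensor => [|j]; exact: smooth1_continuous.
Qed.

(** [dtt] and [Kdelta] act on each component separately, so fields with a single nonzero component
    suffice and the system decouples. *)
Definition vtest (i : 'I_d) (a : R -> R) (b : 'I_d -> R -> R) (t : R) (x : V) : V :=
  [tuple if j == i then tensor a b t x else 0 | j < d].

Lemma test_fun_vtest i a b (M : R) : smooth1 a -> (forall j, smooth1 (b j)) ->
  (forall t, M < `|t| -> a t = 0) -> (forall j r, M < `|r| -> b j r = 0) ->
  test_fun (vtest i a b).
Proof.
move=> sa sb a0 b0; split.
  move=> j; have -> : (fun t x => tnth (vtest i a b t x) j) =
      tensor (if j == i then a else fun=> 0) b.
    apply/funext => t; apply/funext => x; rewrite tnth_mktuple.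
    by case: ifP => // _; rewrite /tensor mul0r.
  by apply: smooth_tensor => //; case: ifP => // _; exact: smooth1_cst.
pose M1 := Num.max M 0.
(* This exceeds [sqrt d * M1], the largest Euclidean norm on the cube of half-side [M1], and also
   [M], so that one number bounds the support in space and in time. *)
exists (d%:R * M1 + M1) => t x h; apply: eq_from_tnth => j.
have M10 : 0 <= M1 by rewrite le_max lexx orbT.
have MM1 : M <= M1 by rewrite le_max lexx.
rewrite !tnth_mktuple; case: ifP => // _; rewrite /tensor.
case: h => [h|h].
  rewrite a0 ?mul0r//; apply: le_lt_trans h; apply: le_trans MM1 _.
  by rewrite lerDr mulr_ge0.
suff [k Hk] : exists k : 'I_d, M < `|tnth x k|.
  by rewrite (bigD1 k)//= b0// mul0r mulr0.
apply: contrapT => /forallNP H.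
have {}H k : `|tnth x k| <= M1.
  by have /negP := H k; rewrite -leNgt => /le_trans; exact.
move: h; apply/negP; rewrite -leNgt /enorm.
have B : dot x x <= (d%:R * M1 + M1) ^+ 2.
  apply: (@le_trans _ _ (d%:R * M1 ^+ 2)).
    rewrite /dot; apply: (@le_trans _ _ (\sum_(k < d) M1 ^+ 2)).
      apply: ler_sum => k _; rewrite -expr2 -real_normK ?num_real//.
      by rewrite lerXn2r// nnegrE.
    by rewrite sumr_const card_ord mulr_natl.
  have d1 : d%:R <= (d%:R + 1) ^+ 2 :> R.
    rewrite sqrrD expr1n mulr1; have : 0 <= d%:R ^+ 2 :> R by exact: sqr_ge0.
    by have : 0 <= d%:R :> R by []; rewrite mulr2n; lra.
  have -> : (d%:R * M1 + M1) ^+ 2 = (d%:R + 1) ^+ 2 * M1 ^+ 2 by ring.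
  by rewrite ler_wpM2r// sqr_ge0.
apply: (le_trans (ler_wsqrtr B)); rewrite sqrtr_sqr ger0_norm//.
by rewrite addr_ge0// mulr_ge0.
Qed.

Lemma tnth_dtt i a b t x j : smooth1 a ->
  tnth (dtt (vtest i a b) t x) j = if j == i then tensor (derive1 (derive1 a)) b t x else 0.
Proof.
move=> sa; rewrite tnth_mktuple.
have [->|ji] := eqVneq j i; last first.
  have -> : (fun r => tnth (vtest i a b r x) j) = fun=> 0.
    by apply/funext => r'; rewrite tnth_mktuple (negbTE ji).
  have -> : derive1 (fun=> 0 : R) = fun=> 0 by apply/funext => r; rewrite derive1_cst.
  exact: derive1_cst.
have -> : (fun r => tnth (vtest i a b r x) i) = fun r => a r * \prod_(j < d) b j (tnth x j).
  by apply/funext => r; rewrite tnth_mktuple eqxx.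
have -> : derive1 (fun r => a r * \prod_(j < d) b j (tnth x j)) =
    fun r => derive1 a r * \prod_(j < d) b j (tnth x j).
  by apply/funext => r; rewrite derive1Mr//; exact: smooth1_derivable.
by rewrite derive1Mr//; apply: smooth1_derivable; exact: smooth1_derive.
Qed.

End TestFunctions.

Notation intg mu f := (integrable mu setT (EFin \o f)).

(** * Real-valued integrals *)

Section RealIntegrable.
Context dT (T : measurableType dT) (R : realType).
Variable mu : {measure set T -> \bar R}.
Implicit Types f g h : T -> R.

Lemma intg_measurable f : intg mu f -> measurable_fun setT f.
Proof. by move=> /integrableP[/measurable_EFinP]. Qed.

Lemma intg_le f g : measurable_fun setT f -> (forall x, `|f x| <= g x) -> intg mu g -> intg mu f.
Proof.
move=> mf fg ig; apply: (@le_integrable _ _ _ mu setT measurableT _ (EFin \o g)) => //; first exact/measurable_EFinP.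
by move=> x _; rewrite /= lee_fin; apply: le_trans (fg x) (ler_norm _).
Qed.

Lemma intg_norm f : intg mu f -> intg mu (fun x => `|f x|).
Proof. by move=> H; exact: (integrable_abse H). Qed.

Lemma intgD f g : intg mu f -> intg mu g -> intg mu (fun x => f x + g x).
Proof. by move=> If Ig; exact: (integrableD measurableT If Ig). Qed.

Lemma intgZl c f : intg mu f -> intg mu (fun x => c * f x).
Proof. by move=> If; exact: (integrableZl measurableT c If). Qed.

Lemma intgB f g : intg mu f -> intg mu g -> intg mu (fun x => f x - g x).
Proof. by move=> If Ig; exact: (integrableB measurableT If Ig). Qed.

Lemma intg0 : intg mu (fun _ : T => 0).
Proof. exact: integrable0. Qed.

Lemma intgMb C f h : measurable_fun setT h -> (forall x, `|h x| <= C) -> intg mu f ->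
  intg mu (fun x => f x * h x).
Proof.
move=> mh hC If; apply: (@intg_le _ (fun x => C * `|f x|)).
- by apply: measurable_funM => //; exact: intg_measurable.
- by move=> x; rewrite normrM mulrC ler_wpM2r.
- by apply: intgZl; exact: intg_norm.
Qed.

(** Valid without integrability: when a part has an infinite integral, both sides are [fine] of an
    infinite value, hence 0. *)
Lemma RintegralN f : Rintegral mu setT (fun x => - f x) = - Rintegral mu setT f.
Proof.
rewrite /Rintegral integralE [in RHS]integralE.
rewrite (_ : (fun x : T => (- f x)%:E)^\+%E = (fun x : T => (f x)%:E)^\-%E); last by rewrite -funeposN.
rewrite (_ : (fun x : T => (- f x)%:E)^\-%E = (fun x : T => (f x)%:E)^\+%E); last by rewrite -funenegN.
by case: (integral _ _ _) => [x||]; case: (integral _ _ _) => [y||] //=; rewrite ?oppr0// opprB.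
Qed.

Lemma measurable_param_integral d' (T' : measurableType d') (nu : {sigma_finite_measure set T -> \bar R})
    (F : T' * T -> \bar R) :
  measurable_fun setT F -> measurable_fun setT (fun x => \int[nu]_y F (x, y))%E.
Proof.
move=> mF.
rewrite (_ : (fun x => _) = fun x => (\int[nu]_y F^\+ (x, y) - \int[nu]_y F^\- (x, y))%E); last first.
  apply/funext => x; rewrite [LHS]integralE.
  by congr (_ - _)%E; apply: eq_integral => t _; rewrite ?funeposE ?funenegE.
apply: emeasurable_funB.
  by apply: (measurable_fun_fubini_tonelli_F (m2 := nu) F^\+%E) => //; exact: measurable_funepos.
by apply: (measurable_fun_fubini_tonelli_F (m2 := nu) F^\-%E) => //; exact: measurable_funeneg.
Qed.

Lemma measurable_param_Rintegral d' (T' : measurableType d') (nu : {sigma_finite_measure set T -> \bar R})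
    (F : T' * T -> R) :
  measurable_fun setT F -> measurable_fun setT (fun x => Rintegral nu setT (fun y => F (x, y))).
Proof.
move=> mF; apply: (measurableT_comp (f := fine)) => //.
by apply: (@measurable_param_integral _ _ nu (EFin \o F)); exact/measurable_EFinP.
Qed.

Lemma ae_eq_Rintegral f g : measurable_fun setT f -> measurable_fun setT g ->
  {ae mu, forall x, f x = g x} -> Rintegral mu setT f = Rintegral mu setT g.
Proof.
move=> mf mg H; congr fine; apply: ae_eq_integral => //; try exact/measurable_EFinP.
by apply: filterS H => x /= -> _.
Qed.

Lemma le_norm_Rintegral f g : intg mu g -> measurable_fun setT f -> (forall x, `|f x| <= g x) ->
  `|Rintegral mu setT f| <= Rintegral mu setT g.
Proof.
move=> Ig mf fg; have If := intg_le mf fg Ig.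
apply: (le_trans (le_normr_Rintegral measurableT If)).
apply: le_Rintegral => //; exact: intg_norm.
Qed.

End RealIntegrable.

Section RealFubini.
Context d1 d2 (T1 : measurableType d1) (T2 : measurableType d2) (R : realType).
Variable m1 : {sigma_finite_measure set T1 -> \bar R}.
Variable m2 : {sigma_finite_measure set T2 -> \bar R}.
Implicit Type F : T1 * T2 -> R.

Lemma intg_prodP F : measurable_fun setT F ->
  intg (m1 \x m2)%E F <-> (\int[m1]_x \int[m2]_y (`|F (x, y)|)%:E < +oo)%E.
Proof. by move=> /measurable_EFinP mF; exact: (integrable12ltyP m1 m2 mF). Qed.

Lemma intg_prodP2 F : measurable_fun setT F ->
  intg (m1 \x m2)%E F <-> (\int[m2]_y \int[m1]_x (`|F (x, y)|)%:E < +oo)%E.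
Proof. by move=> /measurable_EFinP mF; exact: (integrable21ltyP m1 m2 mF). Qed.

Lemma intg_prod_ae1 F : intg (m1 \x m2)%E F -> {ae m1, forall x, intg m2 (fun y => F (x, y))}.
Proof. by move=> H; exact: (ae_integrable1 H). Qed.

Lemma intg_prod_ae2 F : intg (m1 \x m2)%E F -> {ae m2, forall y, intg m1 (fun x => F (x, y))}.
Proof. by move=> H; exact: (ae_integrable2 H). Qed.

Lemma Rintegral_fineE1 F : intg (m1 \x m2)%E F ->
  {ae m1, forall x, (\int[m2]_y (F (x, y))%:E = (Rintegral m2 setT (fun y => F (x, y)))%:E)%E}.
Proof.
move=> H; have := intg_prod_ae1 H; apply: filterS => x If; rewrite /Rintegral fineK//.
exact: integrable_fin_num.
Qed.

Lemma Rintegral_fineE2 F : intg (m1 \x m2)%E F ->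
  {ae m2, forall y, (\int[m1]_x (F (x, y))%:E = (Rintegral m1 setT (fun x => F (x, y)))%:E)%E}.
Proof.
move=> H; have := intg_prod_ae2 H; apply: filterS => x If; rewrite /Rintegral fineK//.
exact: integrable_fin_num.
Qed.

Lemma norm_Rintegral_le (f : T2 -> R) : measurable_fun setT f ->
  ((`|Rintegral m2 setT f|)%:E <= \int[m2]_y (`|f y|)%:E)%E.
Proof.
move=> /measurable_EFinP mf; apply: le_trans (le_abse_integral m2 measurableT mf).
by rewrite /Rintegral; case: (integral _ _ _) => //= *; exact: leey.
Qed.

Lemma intg_fubini1 F : intg (m1 \x m2)%E F -> intg m1 (fun x => Rintegral m2 setT (fun y => F (x, y))).
Proof.
move=> H; have mF := intg_measurable H.
have mA : measurable_fun setT (fun x => \int[m2]_y (`|F (x, y)|)%:E)%E.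
  apply: (@measurable_param_integral _ _ _ _ _ m2 (fun p => (`|F p|)%:E)).
  by apply/measurable_EFinP; exact: measurableT_comp.
apply: (@le_integrable _ _ _ m1 setT measurableT _ (fun x => \int[m2]_y (`|F (x, y)|)%:E)%E).
- by apply/measurable_EFinP; exact: measurable_param_Rintegral.
- move=> x _; rewrite [leRHS]gee0_abs; last exact: integral_ge0.
  apply: norm_Rintegral_le.
  by apply: (measurableT_comp mF); exact: measurable_fun_pair.
- apply/integrableP; split => //.
  under eq_integral do rewrite gee0_abs ?integral_ge0//.
  exact/intg_prodP.
Qed.

Lemma RFubini F : intg (m1 \x m2)%E F ->
  Rintegral m1 setT (fun x => Rintegral m2 setT (fun y => F (x, y))) =
  Rintegral m2 setT (fun y => Rintegral m1 setT (fun x => F (x, y))).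
Proof.
move=> H; have mF := intg_measurable H.
have mFE : measurable_fun setT (EFin \o F) by exact/measurable_EFinP.
rewrite {1}/Rintegral [RHS]/Rintegral; congr fine.
transitivity (\int[m1]_x \int[m2]_y (F (x, y))%:E)%E.
  apply: ae_eq_integral => //.
  - by apply/measurable_EFinP; exact: measurable_param_Rintegral.
  - exact: (@measurable_param_integral _ _ _ _ _ m2 (EFin \o F)).
  - by have := Rintegral_fineE1 H; apply: filterS => x -> _.
rewrite (Fubini H).
apply: ae_eq_integral => //.
- apply: (@measurable_param_integral _ _ _ _ _ m1 (fun p => (EFin \o F) (p.2, p.1))).
  by apply: measurableT_comp => //; exact: measurable_fun_pair.
- apply/measurable_EFinP; apply: (@measurable_param_Rintegral _ _ _ _ _ m1 (fun p => F (p.2, p.1))).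
  by apply: measurableT_comp => //; exact: measurable_fun_pair.
- by have := Rintegral_fineE2 H; apply: filterS => x -> _.
Qed.

End RealFubini.

(** * Fourier transforms of bumps *)

Section OneDimFourier.
Variable R : realType.
Local Notation leb := (@lebesgue_measure R).
Implicit Types b : R -> R.

Definition even_bump (M : R) b :=
  [/\ smooth1 b, forall x, b (- x) = b x & forall x, M < `|x| -> b x = 0].

Lemma continuous_supp_intg M (f : R -> R) : continuous f -> (forall x, M < `|x| -> f x = 0) ->
  intg leb f.
Proof.
move=> cf f0.
have -> : EFin \o f = (EFin \o f) \_ (`[- M, M]%classic).
  apply/funext => x; rewrite patchE; case: ifPn => // /negP H /=.
  rewrite f0// ltNge; apply/negP => h; apply: H; rewrite inE /= in_itv /=.
  by rewrite -ler_norml.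
apply: (proj1 (@integrable_mkcond _ _ _ leb (`[- M, M]%classic) (EFin \o f) _)) => //.
apply: continuous_compact_integrable; first exact: segment_compact.
exact: continuous_subspaceT.
Qed.

Lemma even_bump_intg M b : even_bump M b -> intg leb b.
Proof. by move=> [sb _ b0]; apply: continuous_supp_intg b0; exact: smooth1_continuous. Qed.

Lemma derive1_even_odd b x : smooth1 b -> (forall x, b (- x) = b x) -> derive1 b (- x) = - derive1 b x.
Proof.
move=> sb eb.
have H : is_derive x 1 (fun y => b (-1 * y + 0)) (derive1 b (-1 * x + 0) * -1).
  by apply: is_derive_affine; exact: smooth1_is_derive.
have E : (fun y => b (-1 * y + 0)) = b by apply/funext => y; rewrite addr0 mulN1r eb.
rewrite E in H; have [_ H2] := H.
by rewrite [in RHS]derive1E H2 addr0 mulN1r mulrN1 opprK.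
Qed.

Lemma derive1_odd_even b x : smooth1 b -> (forall x, b (- x) = - b x) -> derive1 b (- x) = derive1 b x.
Proof.
move=> sb ob.
have H : is_derive x 1 (fun y => b (-1 * y + 0)) (derive1 b (-1 * x + 0) * -1).
  by apply: is_derive_affine; exact: smooth1_is_derive.
have E : (fun y => b (-1 * y + 0)) = - b by apply/funext => y; rewrite addr0 mulN1r ob.
rewrite E in H; have [_ H2] := H.
have H3 : 'D_1 (- b) x = - derive1 b x.
  by rewrite deriveN ?derive1E//; exact: smooth1_derivable.
by move: H2; rewrite H3 addr0 mulN1r mulrN1 => /oppr_inj.
Qed.

Lemma derive1_supp M b x : (forall x, M < `|x| -> b x = 0) -> M < `|x| -> derive1 b x = 0.
Proof.
move=> b0 Mx; rewrite derive1E.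
rewrite (near_eq_derive (g := fun=> 0)) ?derive_cst//.
near=> y; apply: b0; near: y.
by apply: (cvgr_gt `|x|) => //; apply: continuous_comp => //; exact: norm_continuous.
Unshelve. all: by end_near. Qed.

Lemma even_bump_lap M b : even_bump M b -> even_bump M (fun x => b x - derive1 (derive1 b) x).
Proof.
move=> [sb eb b0]; split.
- move=> n; have -> : (fun x => b x - derive1 (derive1 b) x) = fun x => b x + (-1) * derive1 (derive1 b) x.
    by apply/funext => x; rewrite mulN1r.
  apply: CnD; first exact: sb.
  apply: CnM; first exact: smooth1_cst.
  by apply: smooth1_derive; exact: smooth1_derive.
- move=> x; rewrite eb derive1_odd_even//; first exact: smooth1_derive.
  by move=> y; exact: derive1_even_odd.
- move=> x h; rewrite b0// (derive1_supp (M := M)) ?subr0//.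
  by move=> y hy; rewrite (derive1_supp (M := M)).
Qed.

Definition fcos b (xi : R) : R := Rintegral leb setT (fun x => b x * cos (x * xi)).

Lemma norm_cos_le1 (x : R) : `|cos x| <= 1.
Proof. by rewrite ler_norml cos_geN1 cos_le1. Qed.

Lemma norm_sin_le1 (x : R) : `|sin x| <= 1.
Proof. by rewrite ler_norml sin_geN1 sin_le1. Qed.

Lemma measurable_cos : measurable_fun setT (@cos R).
Proof. by apply: continuous_measurable_fun; exact: continuous_cos. Qed.

Lemma measurable_sin : measurable_fun setT (@sin R).
Proof. by apply: continuous_measurable_fun; exact: continuous_sin. Qed.

Lemma measurable_cos_affine (a c : R) : measurable_fun setT (fun x : R => cos (x * a + c)).
Proof.
apply: (measurableT_comp measurable_cos); apply: measurable_funD => //.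
exact: measurable_funM.
Qed.

Lemma measurable_sin_affine (a c : R) : measurable_fun setT (fun x : R => sin (x * a + c)).
Proof.
apply: (measurableT_comp measurable_sin); apply: measurable_funD => //.
exact: measurable_funM.
Qed.

Lemma intg_mul_cos b a c : intg leb b -> intg leb (fun x => b x * cos (x * a + c)).
Proof.
move=> Ib; apply: (intgMb (C := 1)) => //; first exact: measurable_cos_affine.
by move=> x; exact: norm_cos_le1.
Qed.

Lemma intg_mul_sin b a c : intg leb b -> intg leb (fun x => b x * sin (x * a + c)).
Proof.
move=> Ib; apply: (intgMb (C := 1)) => //; first exact: measurable_sin_affine.
by move=> x; exact: norm_sin_le1.
Qed.

Lemma Rintegral_shift (c : R) (f : R -> R) : measurable_fun setT f ->
  Rintegral leb setT (fun x => f (x + c)) = Rintegral leb setT f.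
Proof.
move=> mf; rewrite /Rintegral; congr fine.
by apply: (integral_shift c (f := EFin \o f)); exact/measurable_EFinP.
Qed.

Lemma Rintegral_odd (f : R -> R) : intg leb f -> (forall x, f (- x) = - f x) ->
  Rintegral leb setT f = 0.
Proof.
move=> If fodd.
have H : Rintegral leb setT (fun x => f (- x)) = Rintegral leb setT f.
  rewrite /Rintegral; congr fine.
  by apply: (integral_lebesgueN (f := EFin \o f)); apply/measurable_EFinP; exact: intg_measurable If.
have : Rintegral leb setT (fun x => f (- x)) = - Rintegral leb setT f.
  by rewrite -RintegralN//; apply: eq_Rintegral => x _; rewrite fodd.
rewrite H; move: (Rintegral _ _ _) => I E; lra.
Qed.

(** The phase [th] handles cosine and sine transforms together, [th = - pi / 2] giving the sine.
    Evenness of [b] removes the sine term of the addition formula. *)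
Lemma fcos_shift M b z a th : even_bump M b ->
  Rintegral leb setT (fun x => b (x - z) * cos (x * a + th)) = fcos b a * cos (z * a + th).
Proof.
move=> eb; have Ib := even_bump_intg eb; have [sb evb _] := eb.
have mb := intg_measurable Ib.
pose f x := b (x - z) * cos (x * a + th).
rewrite -(Rintegral_shift z (f := f)).
  transitivity (Rintegral leb setT (fun x => b x * cos (x * a + 0) * cos (z * a + th) - b x * sin (x * a + 0) * sin (z * a + th))).
    apply: eq_Rintegral => x _; rewrite /f addrK.
    have -> : (x + z) * a + th = (x * a + 0) + (z * a + th) by ring.
    by rewrite cosD; ring.
  rewrite RintegralB//.
  - rewrite RintegralZr//; last exact: intg_mul_cos.
    rewrite RintegralZr//; last exact: intg_mul_sin.
    rewrite (@Rintegral_odd (fun x => b x * sin (x * a + 0))) ?mul0r ?subr0.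
    + by congr (_ * _); apply: eq_Rintegral => x _; rewrite addr0.
    + exact: intg_mul_sin.
    + by move=> x; rewrite evb !addr0 mulNr sinN mulrN.
  - apply: (@intgMb _ _ _ _ `|cos (z * a + th)| _ (fun=> cos (z * a + th))) => //.
    exact: intg_mul_cos.
  - apply: (@intgMb _ _ _ _ `|sin (z * a + th)| _ (fun=> sin (z * a + th))) => //.
    exact: intg_mul_sin.
rewrite /f; apply: measurable_funM; last exact: measurable_cos_affine.
by apply: measurableT_comp => //; exact: measurable_funB.
Qed.

Lemma is_derive_trig (p q x : R) :
  is_derive x 1 (fun x : R => p * cos x + q * sin x) (q * cos x + (- p) * sin x).
Proof.
rewrite (_ : q * cos x + (- p) * sin x = p * (- sin x) + q * cos x); last by ring.
by apply: is_deriveD; apply: is_deriveZ.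
Qed.

Lemma smooth1_trig (p q : R) : smooth1 (fun x => p * cos x + q * sin x).
Proof.
apply: (@smooth1_ind _ (fun f => exists p q : R, f = fun x => p * cos x + q * sin x)); last by exists p, q.
move=> _ [p' [q' ->]].
split; first by move=> x; have [] := is_derive_trig p' q' x.
by exists q', (- p'); apply: is_derive_derive1 => x; exact: is_derive_trig.
Qed.

Lemma Rintegral_derive1_supp M (f : R -> R) : smooth1 f -> (forall x, M < `|x| -> f x = 0) ->
  Rintegral leb setT (derive1 f) = 0.
Proof.
move=> sf f0.
pose N := `|M| + 1.
have MN : M < N by rewrite /N; have := ler_norm M; lra.
have N0 : 0 < N by rewrite /N; have := normr_ge0 M; lra.
have d0 x : N < `|x| -> derive1 f x = 0.
  by move=> h; apply: (derive1_supp f0); exact: lt_trans MN h.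
rewrite /Rintegral.
have -> : (\int[leb]_x (derive1 f x)%:E = \int[leb]_(x in `[(- N)%R, N]) (derive1 f x)%:E)%E.
  rewrite [RHS]integral_mkcond; apply: eq_integral => x _; rewrite patchE.
  case: ifPn => // /negP H; rewrite d0// ltNge; apply/negP => h; apply: H.
  by rewrite inE/= in_itv/= -ler_norml.
rewrite (continuous_FTC2 (F := f)).
- by rewrite -EFinB /= !f0 ?subrr// ?normrN gtr0_norm.
- by lra.
- by apply: continuous_subspaceT; apply: smooth1_continuous; exact: smooth1_derive.
- split.
  + by move=> x _; exact: smooth1_derivable.
  + by apply: cvg_at_right_filter; exact: smooth1_continuous.
  + by apply: cvg_at_left_filter; exact: smooth1_continuous.
- by [].
Qed.

Lemma fcos_lap M b xi : even_bump M b ->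
  fcos (fun x => b x - derive1 (derive1 b) x) xi = (1 + xi ^+ 2) * fcos b xi.
Proof.
move=> eb; have [sb evb b0] := eb; have Ib := even_bump_intg eb.
have Ib2 : intg leb (derive1 (derive1 b)).
  apply: (@continuous_supp_intg M); first by apply: smooth1_continuous; do 2 apply: smooth1_derive.
  by move=> x h; rewrite (derive1_supp (M := M))// => y hy; rewrite (derive1_supp (M := M)).
pose c x := 1 * cos (xi * x + 0) + 0 * sin (xi * x + 0).
pose s x := 0 * cos (xi * x + 0) + 1 * sin (xi * x + 0).
have sc : smooth1 c by apply: (smooth1_affine (f := fun x => 1 * cos x + 0 * sin x)); exact: smooth1_trig.
have ss : smooth1 s by apply: (smooth1_affine (f := fun x => 0 * cos x + 1 * sin x)); exact: smooth1_trig.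
have dc : derive1 c = fun x => - xi * s x.
  apply: is_derive_derive1 => x.
  rewrite (_ : - xi * s x = (0 * cos (xi * x + 0) + (- 1) * sin (xi * x + 0)) * xi); last by rewrite /s; ring.
  by apply: (is_derive_affine (f := fun x => 1 * cos x + 0 * sin x)); exact: is_derive_trig.
have ds : derive1 s = fun x => xi * c x.
  apply: is_derive_derive1 => x.
  rewrite (_ : xi * c x = (1 * cos (xi * x + 0) + (- 0) * sin (xi * x + 0)) * xi); last by rewrite /c; ring.
  by apply: (is_derive_affine (f := fun x => 0 * cos x + 1 * sin x)); exact: is_derive_trig.
(* [G] is a compactly supported primitive of [(b'' + xi ^ 2 * b) * cos], so its derivative
   integrates to 0: two integrations by parts done at once. *)
pose G x := derive1 b x * c x + xi * (b x * s x).
have sG : smooth1 G.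
  move=> n; apply: CnD; first by apply: CnM; [exact: smooth1_derive|exact: sc].
  by apply: CnM; [exact: smooth1_cst|apply: CnM; [exact: sb|exact: ss]].
have dG : derive1 G = fun x => derive1 (derive1 b) x * c x + xi ^+ 2 * (b x * c x).
  apply: is_derive_derive1 => x.
  have dbx := smooth1_is_derive x (smooth1_derive sb).
  have bx := smooth1_is_derive x sb.
  have cx := smooth1_is_derive x sc; rewrite dc in cx.
  have sx := smooth1_is_derive x ss; rewrite ds in sx.
  have H := is_deriveD (is_deriveM dbx cx) (is_deriveZ xi (is_deriveM bx sx)).
  rewrite /GRing.scale /= in H.
  rewrite (_ : _ + _ = derive1 b x * (- xi * s x) + c x * derive1 (derive1 b) x +
     xi * (b x * (xi * c x) + s x * derive1 b x)); last by ring.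
  exact: H.
have G0 x : M < `|x| -> G x = 0.
  by move=> h; rewrite /G b0// (derive1_supp b0 h) !mul0r mulr0 addr0.
have := Rintegral_derive1_supp sG G0; rewrite dG.
have cE x : c x = cos (x * xi + 0) by rewrite /c; rewrite mul1r mul0r addr0 mulrC.
have I1 : intg leb (fun x => derive1 (derive1 b) x * c x).
  by under eq_fun do rewrite cE; exact: intg_mul_cos.
have I2 : intg leb (fun x => b x * c x).
  by under eq_fun do rewrite cE; exact: intg_mul_cos.
rewrite RintegralD//; last exact: intgZl.
rewrite RintegralZl// => H.
transitivity (Rintegral leb setT (fun x => b x * c x - derive1 (derive1 b) x * c x)).
  by apply: eq_Rintegral => x _; rewrite cE addr0 mulrBl.
rewrite RintegralB//.
have <- : Rintegral leb setT (fun x => b x * c x) = fcos b xi.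
  by apply: eq_Rintegral => x _; rewrite cE addr0.
by move: H; lra.
Qed.

Lemma fcos_bound b xi : intg leb b -> `|fcos b xi| <= Rintegral leb setT (fun x => `|b x|).
Proof.
move=> Ib; apply: le_norm_Rintegral; first exact: intg_norm.
  apply: measurable_funM; first exact: intg_measurable Ib.
  by apply: (measurableT_comp measurable_cos); exact: measurable_funM.
by move=> x; rewrite normrM ler_piMr// norm_cos_le1.
Qed.

(** Replacing [b] by [b - b''] multiplies the transform by [1 + xi ^ 2] and yields another even
    bump, whose transform is bounded; iterating gives decay of any order. *)
Lemma fcos_decay M b N : even_bump M b ->
  exists2 C, 0 <= C & forall xi, (1 + xi ^+ 2) ^+ N * `|fcos b xi| <= C.
Proof.
elim: N b => [|N IH] b eb.
  exists (Rintegral leb setT (fun x => `|b x|)); first exact: Rintegral_ge0.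
  by move=> xi; rewrite expr0 mul1r; apply: fcos_bound; exact: even_bump_intg eb.
have [C C0 H] := IH _ (even_bump_lap eb).
exists C => // xi; have := H xi; rewrite (fcos_lap xi eb) normrM.
have h : 0 <= 1 + xi ^+ 2 by rewrite addr_ge0// sqr_ge0.
by rewrite (ger0_norm h) mulrA -exprSr.
Qed.

Lemma measurable_fcos b : measurable_fun setT b -> measurable_fun setT (fcos b).
Proof.
move=> mb; rewrite /fcos.
apply: (@measurable_param_Rintegral _ _ R _ _ leb (fun p : R * R => b p.2 * cos (p.2 * p.1))).
apply: measurable_funM; first exact: measurableT_comp.
by apply: (measurableT_comp measurable_cos); exact: measurable_funM.
Qed.

Lemma fcos_even b xi : fcos b (- xi) = fcos b xi.
Proof. by apply: eq_Rintegral => x _; rewrite mulrN cosN. Qed.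

Lemma even_bump_bump r : even_bump r (bumpf r).
Proof.
by split; [exact: smooth1_bump|exact: bump_even|exact: bump_supp].
Qed.

Lemma flat1_homo (x y : R) : 0 < x -> x <= y -> flat 1 x <= flat 1 y.
Proof.
move=> x0 xy; have y0 := lt_le_trans x0 xy.
by rewrite /flat x0 y0 !hornerC !mul1r ler_expR lerN2 lef_pV2.
Qed.

Lemma norm_sin_le (x : R) : `|sin x| <= `|x|.
Proof.
have H (y : R) : 0 <= y -> `|sin y| <= y.
  rewrite le_eqVlt => /orP[/eqP <-|y0]; first by rewrite sin0 normr0.
  have [] := @MVT R sin cos 0 y y0.
  - by apply: continuous_subspaceT; exact: continuous_sin.
  move=> c _; rewrite sin0 !subr0 => ->; rewrite normrM (gtr0_norm y0).
  by rewrite ler_piMl ?norm_cos_le1// ltW.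
have [x0|x0] := leP 0 x; first by rewrite (ger0_norm x0); exact: H.
by rewrite (ltr0_norm x0) -normrN -sinN; apply: H; rewrite oppr_ge0 ltW.
Qed.

Lemma cos_ge (x : R) : 1 - cos x <= x ^+ 2 / 2.
Proof.
have -> : cos x = 1 - 2 * sin (x / 2) ^+ 2.
  have E : x = x / 2 + x / 2 by lra.
  rewrite [in LHS]E cosD -!expr2; have := cos2Dsin2 (x / 2); lra.
have : sin (x / 2) ^+ 2 <= (x / 2) ^+ 2.
  rewrite -[X in X <= _]real_normK ?num_real// -[X in _ <= X]real_normK ?num_real//.
  by rewrite lerXn2r ?nnegrE// norm_sin_le.
have -> : (x / 2) ^+ 2 = x ^+ 2 / 4 by field.
lra.
Qed.

(** When [r * |xi| <= 1] the cosine is at least 1/2 on the whole support. At any given frequency a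
    narrow enough bump thus has a nonzero transform, by which the equation can be divided. *)
Lemma fcos_bump_gt0 r xi : 0 < r -> r * `|xi| <= 1 -> 0 < fcos (bumpf r) xi.
Proof.
move=> r0 rxi.
have eb := even_bump_bump r; have Ib := even_bump_intg eb.
have cE x : bumpf r x / 2 <= bumpf r x * cos (x * xi).
  have [h|h] := ltP r `|x|; first by rewrite bump_supp// !mul0r.
  apply: ler_wpM2l; first exact: bump_ge0.
  have := cos_ge (x * xi); have : (x * xi) ^+ 2 <= 1.
    rewrite -real_normK ?num_real// exprn_ile1// normrM.
    by apply: le_trans rxi; rewrite ler_wpM2r.
  lra.
have r20 : 0 < r / 2 by lra.
(* On [|x| <= r / 2] both factors of the bump have an argument of at least [r / 2]; the final
   division by 2 accounts for the cosine. *)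
pose c := flat 1 (r / 2) * flat 1 (r / 2) / 2.
have c0 : 0 < c by rewrite /c divr_gt0// mulr_gt0// flat1_gt0.
pose A : set R := `[- (r / 2), r / 2]%classic.
have mA : measurable A by exact: measurable_itv.
have lA : leb A = r%:E.
  by rewrite /A lebesgue_measure_itv/= lte_fin ifT; [rewrite -EFinB; congr EFin; lra|lra].
have IA : intg leb (fun x => \1_A x).
  apply/integrableP; split; first by apply/measurable_EFinP; exact: measurable_indic.
  under eq_integral do rewrite /= ger0_norm//.
  by rewrite integral_indic// setIT [X in (X < _)%E]lA ltry.
have Ibc : intg leb (fun x => bumpf r x * cos (x * xi)).
  by under eq_fun do rewrite -[X in cos X]addr0; exact: intg_mul_cos.
apply: (@lt_le_trans _ _ (Rintegral leb setT (fun x => c * \1_A x))).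
  rewrite RintegralZl// mulr_gt0// /Rintegral integral_indic// setIT.
  by rewrite -[X in fine X]/(leb A) lA.
apply: le_Rintegral => //; first exact: intgZl.
move=> x _; apply: le_trans (cE x).
rewrite indicE; case: (boolP (x \in A)) => h /=; last first.
  by rewrite mulr0 divr_ge0// bump_ge0.
move: h; rewrite inE /A /= in_itv/= => /andP[h1 h2].
rewrite mulr1 /c ler_pM2r ?invr_gt0// /bumpf.
by apply: ler_pM; rewrite ?flat1_ge0//; apply: flat1_homo => //; lra.
Qed.

End OneDimFourier.

Section MultiDimFourier.
Variable R : realType.
Variable d : nat.
Local Notation V := (d.-tuple R).
Local Notation leb := (@lebesgue_measure R).
Local Notation mu := (@mud R d).

Definition bumpv (b : R -> R) (z : V) (x : V) : R := \prod_(j < d) b (tnth x j - tnth z j).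

Definition fcosv (b : R -> R) (xi : V) : R := \prod_(j < d) fcos b (tnth xi j).

Lemma intg_bumpv M b z : even_bump M b -> intg mu (bumpv b z).
Proof.
move=> eb; apply: (@integrable_mud_prod R d (fun j r => b (r - tnth z j))) => j.
have [sb _ b0] := eb.
apply: (@continuous_supp_intg _ (`|M| + `|tnth z j|)).
  apply: smooth1_continuous.
  have -> : (fun r => b (r - tnth z j)) = fun r => b (1 * r + (- tnth z j)).
    by apply/funext => r; rewrite mul1r.
  exact: smooth1_affine.
move=> r h; apply: b0.
have := ler_normB r (tnth z j); have := lerB_dist r (tnth z j); have := ler_norm M.
move: h; lra.
Qed.

Lemma measurable_cos_dot (xi : V) th : measurable_fun setT (fun x : V => cos (dot x xi + th)).
Proof.
apply: (measurableT_comp (@measurable_cos R)); apply: measurable_funD => //.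
by apply: measurable_dot.
Qed.

Lemma intg_bumpv_cos M b z xi th : even_bump M b -> intg mu (fun x => bumpv b z x * cos (dot x xi + th)).
Proof.
move=> eb; apply: (intgMb (C := 1)); first exact: measurable_cos_dot.
  by move=> x; exact: norm_cos_le1.
exact: intg_bumpv eb.
Qed.

(** After [k] integrations, each integrated coordinate has left a factor [fcos b] and has had [x_j]
    replaced by [z_j] in the phase. *)
Lemma iintR_bumpv M b k (z xi x : V) th : (k <= d)%N -> even_bump M b ->
  iintR k (fun x => bumpv b z x * cos (dot x xi + th)) x =
  (\prod_(j < d) (if (j < k)%N then fcos b (tnth xi j) else b (tnth x j - tnth z j))) *
  cos (\sum_(j < d) (if (j < k)%N then tnth z j else tnth x j) * tnth xi j + th).
Proof.
move=> kd eb; elim: k kd x => [|k IH] kd x; first by [].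
rewrite [LHS]/=; pose j := Ordinal kd.
pose P := \prod_(i < d | i != j) (if (i < k.+1)%N then fcos b (tnth xi i) else b (tnth x i - tnth z i)).
pose S := \sum_(i < d | i != j) (if (i < k.+1)%N then tnth z i else tnth x i) * tnth xi i.
have neq (i : 'I_d) : i != j -> ((i : nat) == k) = false.
  by move=> ij; apply/negbTE; apply: contraNneq ij => ik; apply/eqP/val_inj.
transitivity (Rintegral leb setT (fun t => P * (b (t - tnth z j) * cos (t * tnth xi j + (S + th))))).
  apply: eq_Rintegral => t _; rewrite IH ?(ltnW kd)//.
  rewrite (bigD1 j)//= ltnn tnth_setc eqxx.
  rewrite [\sum_(i < d) _](bigD1 j)//= ltnn tnth_setc eqxx.
  have -> : \prod_(i < d | i != j) (if (i < k)%N then fcos b (tnth xi i) else b (tnth (setc x k t) i - tnth z i)) = P.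
    by apply: eq_bigr => i /neq ik; rewrite tnth_setc ltnS [(i <= k)%N]leq_eqVlt ik.
  have -> : \sum_(i < d | i != j) (if (i < k)%N then tnth z i else tnth (setc x k t) i) * tnth xi i = S.
    by apply: eq_bigr => i /neq ik; rewrite tnth_setc ltnS [(i <= k)%N]leq_eqVlt ik.
  by rewrite addrA; ring.
rewrite RintegralZl//; last first.
  have [sb _ b0] := eb.
  apply: (intgMb (C := 1)); first exact: measurable_cos_affine.
    by move=> t; exact: norm_cos_le1.
  apply: (@continuous_supp_intg _ (`|M| + `|tnth z j|)).
    apply: smooth1_continuous.
    have -> : (fun r => b (r - tnth z j)) = fun r => b (1 * r + (- tnth z j)).
      by apply/funext => r; rewrite mul1r.
    exact: smooth1_affine.
  move=> r h; apply: b0.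
  have := ler_normB r (tnth z j); have := lerB_dist r (tnth z j); have := ler_norm M.
  move: h; lra.
rewrite (fcos_shift _ _ _ eb) [in RHS](bigD1 j)//= ltnSn.
rewrite [\sum_(i < d) _ in RHS](bigD1 j)//= ltnSn -/P -/S addrA; ring.
Qed.

Lemma intR_bumpv M b (z xi : V) th : even_bump M b ->
  intR (fun x => bumpv b z x * cos (dot x xi + th)) = fcosv b xi * cos (dot z xi + th).
Proof.
move=> eb; rewrite /intR (iintR_bumpv _ _ _ _ (leqnn d) eb); congr (_ * cos (_ + _)).
  by apply: eq_bigr => j _; rewrite ltn_ord.
by apply: eq_bigr => j _; rewrite ltn_ord.
Qed.

Lemma measurable_fcosv b : measurable_fun setT b -> measurable_fun setT (fcosv b).
Proof.
move=> mb; apply: (@measurable_fun_prod_tnth R d (fun _ => fcos b)) => j.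
exact: measurable_fcos.
Qed.

End MultiDimFourier.

Section DominatedConvergence.
Context dT (T : measurableType dT) (R : realType).
Variable nu : {measure set T -> \bar R}.

Lemma dominated_Rintegral (f_ : nat -> T -> R) (f h : T -> R) :
  (forall n, measurable_fun setT (f_ n)) -> (forall x, f_ n x @[n --> \oo] --> f x) ->
  intg nu h -> (forall n x, `|f_ n x| <= h x) ->
  intg nu f /\ Rintegral nu setT (f_ n) @[n --> \oo] --> Rintegral nu setT f.
Proof.
move=> mf cf Ih fh.
have mlim : measurable_fun setT f by exact: (measurable_fun_cvg mf (fun x _ => cf x)).
have [If _ H] : [/\ nu.-integrable setT (EFin \o f),
    [sequence (\int[nu]_(x in setT) `|(f_ n x)%:E - (f x)%:E|)%E]_n @ \oo --> 0%E &
    [sequence (\int[nu]_(x in setT) (f_ n x)%:E)%E]_n @ \oo --> (\int[nu]_(x in setT) (f x)%:E)%E].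
  apply: (@dominated_convergence _ _ _ nu setT measurableT (fun n x => (f_ n x)%:E) (EFin \o f) (EFin \o h)) => //.
  - by move=> n; exact/measurable_EFinP.
  - exact/measurable_EFinP.
  - apply: aeW => x _; apply: cvg_EFin; first exact: nearW.
    exact: cf.
  - by apply: aeW => x n _; rewrite /= lee_fin.
split => //; apply: fine_cvg.
rewrite /Rintegral fineK; first exact: H.
exact: integrable_fin_num.
Qed.

End DominatedConvergence.

(** * The symbol of the operator *)

Section Kernel.
Variable R : realType.
Variable d : nat.
Local Notation V := (d.-tuple R).
Local Notation mu := (@mud R d).
Variables (alpha delta : R) (chi : R -> R).
Hypothesis alpha01 : 0 < alpha < 1.
Hypothesis delta0 : 0 < delta.
Hypothesis mchi : measurable_fun setT chi.
Hypothesis chi01 : forall r, 0 <= chi r <= 1.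
Hypothesis chi_supp : forall r, 1 < `|r| -> chi r = 0.

(** At the origin the denominator is [powR 0 _ = 0] when the exponent is positive, and division by 0
    gives 0, so the singular point needs no separate treatment. *)
Definition ker (y : V) : R := chi (enorm y / delta) / powR (enorm y) (d%:R + 2 * alpha).

Lemma enorm_ge0 (y : V) : 0 <= enorm y.
Proof. exact: sqrtr_ge0. Qed.

Lemma ker_ge0 y : 0 <= ker y.
Proof. by rewrite divr_ge0 ?powR_ge0//; have /andP[] := chi01 (enorm y / delta). Qed.

Lemma ker_supp y : delta < enorm y -> ker y = 0.
Proof.
move=> h; rewrite /ker chi_supp ?mul0r//.
by rewrite normrM normfV (gtr0_norm delta0) ger0_norm ?enorm_ge0// ltr_pdivlMr// mul1r.
Qed.

Lemma measurable_ker : measurable_fun setT ker.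
Proof.
have me : measurable_fun setT (@enorm R d) by exact: (measurable_enorm (@measurable_id _ _ setT)).
apply: measurable_funM.
  apply: (measurableT_comp mchi); apply: measurable_funM => //.
rewrite (_ : (fun x => _) = fun x : V => powR (enorm x) (- (d%:R + 2 * alpha))).
  by apply: (measurableT_comp (measurable_powR _)).
by apply/funext => x; rewrite powRN.
Qed.

Lemma dyadic_shell (r : R) : 0 < r -> r <= delta ->
  exists n, (2^-1) ^+ n.+1 * delta < r /\ r <= (2^-1) ^+ n * delta.
Proof.
move=> r0 rd.
have [N HN] : exists n, (2^-1) ^+ n.+1 * delta < r.
  exists (Num.bound (delta / r)).
  have h : delta / r < (Num.bound (delta / r))%:R by apply: archi_boundP; rewrite divr_ge0// ltW.
  set m := Num.bound _ in h *.
  have h2 : m%:R <= 2 ^+ m.+1 :> R.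
    by rewrite -natrX ler_nat; apply: leq_trans (ltnW (ltn_expl m (ltnSn 1))) _; rewrite leq_exp2l.
  rewrite exprVn mulrC ltr_pdivrMr ?exprn_gt0//.
  rewrite mulrC -ltr_pdivrMr//; exact: lt_le_trans h h2.
have exP : exists n, (2^-1) ^+ n.+1 * delta < r by exists N.
case: (ex_minnP exP) => n Hn minn; exists n; split => //.
case: n Hn minn => [|n] Hn minn; first by rewrite expr0 mul1r.
rewrite leNgt; apply/negP => h; have := minn n h; rewrite ltnn//.
Qed.

Let a : R := 2^-1.
Let c_ (n : nat) : R := (a ^+ n * delta) ^+ 2 / powR (a ^+ n.+1 * delta) (d%:R + 2 * alpha).
Let q : R := a ^+ (d + 2) / powR a (d%:R + 2 * alpha).

Let a0 : 0 < a. Proof. by rewrite /a; lra. Qed.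
Let c_ge0 n : 0 <= c_ n. Proof. by rewrite /c_ divr_ge0 ?powR_ge0// sqr_ge0. Qed.
Let P0 : 0 < d%:R + 2 * alpha.
Proof. by move/andP: alpha01 => [h _]; rewrite ltr_wpDl// mulr_gt0. Qed.

(** Here [q = 2 ^ (- (2 - 2 * alpha))]: the volume and [|y| ^ 2] scale as the power [d + 2], the
    kernel as [d + 2 * alpha], and [alpha < 1] makes the series converge. *)
Let q_lt1 : 0 < q /\ q < 1.
Proof.
have pa : 0 < powR a (d%:R + 2 * alpha) by exact: powR_gt0.
split; first by rewrite /q divr_gt0// exprn_gt0.
rewrite /q ltr_pdivrMr// mul1r -powR_mulrn ?ltW// natrD.
move/andP: alpha01 => [h0 h1].
rewrite (_ : d%:R + 2%:R = (d%:R + 2 * alpha) + (2 - 2 * alpha)); last by ring.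
rewrite powRD; last by apply/implyP => _; rewrite gt_eqF.
rewrite -[X in _ < X]mulr1 ltr_pM2l//.
have E1 : powR 1 (2 - 2 * alpha) = 1 :> R by rewrite powR1.
rewrite -[X in _ < X]E1; apply: gt0_ltr_powR; rewrite ?nnegrE//.
- lra.
- exact: ltW.
- by rewrite /a; lra.
Qed.

(* Dyadic decomposition: on the shell [2^-(n+1) delta < |y| <= 2^-n delta] the function is at
   most [c_ n], and [c_ n] times the volume of the ball is geometric in [n] of ratio [q]. *)
Lemma ker_sq_bound y : ((ker y * enorm y ^+ 2)%:E <= \sum_(0 <= n <oo) (c_ n * \1_(cube (vzero R d) (a ^+ n * delta)) y)%:E)%E.
Proof.
have t0 n : (0 <= (c_ n * \1_(cube (vzero R d) (a ^+ n * delta)) y)%:E)%E by rewrite lee_fin mulr_ge0.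
have [e0|e0] := eqVneq (enorm y) 0.
  by rewrite e0 expr0n mulr0; apply: nneseries_ge0 => n _ _.
have {}e0 : 0 < enorm y by rewrite lt_def e0 enorm_ge0.
have [ed|ed] := leP (enorm y) delta; last first.
  by rewrite ker_supp// mul0r; apply: nneseries_ge0 => n _ _.
have [n [h1 h2]] := dyadic_shell e0 ed.
have an0 m : 0 < a ^+ m * delta by rewrite mulr_gt0// exprn_gt0.
apply: (@le_trans _ _ (c_ n * \1_(cube (vzero R d) (a ^+ n * delta)) y)%:E); last first.
  apply: (@le_trans _ _ (\sum_(0 <= m < n.+1) (c_ m * \1_(cube (vzero R d) (a ^+ m * delta)) y)%:E)%E).
    by rewrite big_nat_recr//= leeDr//; apply: sume_ge0 => m _.
  by apply: nneseries_lim_ge => m _ _.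
rewrite lee_fin indicE mem_set ?mulr1; last first.
  by move=> i; rewrite tnth_mktuple subr0; apply: le_trans (tnth_le_enorm _ _) h2.
rewrite /ker /c_ mulrAC.
apply: ler_pM.
- by rewrite mulr_ge0 ?sqr_ge0//; have /andP[] := chi01 (enorm y / delta).
- by rewrite invr_ge0 powR_ge0.
- apply: (@le_trans _ _ (1 * enorm y ^+ 2)).
    by rewrite ler_wpM2r ?sqr_ge0//; have /andP[] := chi01 (enorm y / delta).
  by rewrite mul1r lerXn2r// nnegrE ltW.
- rewrite lef_pV2 ?posrE ?powR_gt0//; apply: ge0_ler_powR; rewrite ?nnegrE ?(ltW e0)//; last exact: ltW.
    exact: ltW.
  exact: ltW.
Qed.

Let powRX (x P : R) n : 0 <= x -> powR (x ^+ n) P = powR x P ^+ n.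
Proof.
move=> x0; elim: n => [|n IH]; first by rewrite !expr0 powR1.
by rewrite !exprS powRM ?exprn_ge0// IH.
Qed.

(** [ker] itself may fail to be integrable at the origin; the estimates below rest on this second
    moment instead. *)
Lemma intg_ker_sq : intg mu (fun y => ker y * enorm y ^+ 2).
Proof.
have [q0 q1] := q_lt1.
have me : measurable_fun setT (@enorm R d) by exact: (measurable_enorm (@measurable_id _ _ setT)).
have mks : measurable_fun setT (fun y => ker y * enorm y ^+ 2).
  by apply: measurable_funM; [exact: measurable_ker|exact: measurable_funX].
apply/integrableP; split; first exact/measurable_EFinP.
have pos y : 0 <= ker y * enorm y ^+ 2 by rewrite mulr_ge0 ?ker_ge0 ?sqr_ge0.
have mI n : measurable_fun setT (fun y : V => (c_ n * \1_(cube (vzero R d) (a ^+ n * delta)) y)%:E).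
  apply/measurable_EFinP; apply: measurable_funM => //.
  by apply: measurable_indic; exact: measurable_cube.
have I0 n (y : V) : (0 <= (c_ n * \1_(cube (vzero R d) (a ^+ n * delta)) y)%:E)%E by rewrite lee_fin mulr_ge0.
apply: (@le_lt_trans _ _ (\int[mu]_y \sum_(0 <= n <oo) (c_ n * \1_(cube (vzero R d) (a ^+ n * delta)) y)%:E)%E).
  apply: ge0_le_integral => //.
  - by apply/measurable_EFinP; exact: measurableT_comp.
  - by apply: ge0_emeasurable_sum => // n _; exact: mI.
  - by move=> y _; rewrite /= ger0_norm//; exact: ker_sq_bound.
rewrite integral_nneseries//.
(* [C] is the term [n = 0] of the series: [c_ 0] times the volume of the cube of half-side
   [delta]. *)
pose C := delta ^+ 2 * (2 * delta) ^+ d / powR a (d%:R + 2 * alpha) / powR delta (d%:R + 2 * alpha).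
have pa : 0 < powR a (d%:R + 2 * alpha) by exact: powR_gt0.
have pd : 0 < powR delta (d%:R + 2 * alpha) by exact: powR_gt0.
have C0 : 0 <= C.
  rewrite /C; do 2 (apply: divr_ge0; last exact: powR_ge0).
  by rewrite mulr_ge0 ?sqr_ge0// exprn_ge0// mulr_ge0// ltW.
have an0 m : 0 <= a ^+ m by rewrite exprn_ge0// ltW.
have E n : (\int[mu]_y (c_ n * \1_(cube (vzero R d) (a ^+ n * delta)) y)%:E = (C * q ^+ n)%:E)%E.
  under eq_integral do rewrite EFinM.
  rewrite ge0_integralZl//; first last.
  - by rewrite lee_fin.
  - by apply/measurable_EFinP; apply: measurable_indic; exact: measurable_cube.
  rewrite integral_indic//; last exact: measurable_cube.
  have r0 : 0 <= a ^+ n * delta by rewrite mulr_ge0// ltW.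
  rewrite setIT [X in (_ * X)%E](mud_cube (vzero R d) r0) -EFinM; congr EFin.
  rewrite /c_ powRM ?(ltW delta0)// powRX ?(ltW a0)// /C /q.
  rewrite expr_div_n (exprAC a (d + 2) n) (exprD (a ^+ n) d 2) (exprSr (powR a _) n) !exprMn.
  have pn0 : powR a (d%:R + 2 * alpha) ^+ n != 0 by rewrite gt_eqF// exprn_gt0.
  move: (a ^+ n) (powR a (d%:R + 2 * alpha)) pa pn0 => A p p0.
  move: (p ^+ n) => pn pn0.
  by field; rewrite pn0 !gt_eqF.
under eq_eseriesr do rewrite E.
apply: (@le_lt_trans _ _ (C / (1 - q))%:E); last by rewrite ltry.
apply: lime_le.
  by apply: is_cvg_nneseries => n _ _; rewrite lee_fin mulr_ge0// exprn_ge0// ltW.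
near=> n; rewrite sumEFin lee_fin.
have := geometric_seriesE C (negbT (lt_eqF q1)) => /(congr1 (fun f => f n)).
rewrite /series/geometric/= => ->.
rewrite ler_pM2r ?invr_gt0 ?subr_gt0//.
by rewrite ler_piMr// gerBl exprn_ge0// ltW.
Unshelve. all: by end_near. Qed.

Lemma smooth_supp_bounded M (f : R -> R) : continuous f -> (forall x, M < `|x| -> f x = 0) ->
  exists2 C, 0 <= C & forall x, `|f x| <= C.
Proof.
move=> cf f0; pose N := `|M|.
have N0 : - N <= N by have := normr_ge0 M; rewrite /N; lra.
have cn : {within `[- N, N], continuous (fun x => `|f x|)}.
  apply: continuous_subspaceT => x; apply: continuous_comp; first exact: cf.
  exact: norm_continuous.
have [c _ Hc] := EVT_max N0 cn.
exists `|f c| => // x.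
have [h|h] := leP `|x| N; first by apply: Hc; rewrite in_itv/= -ler_norml.
by rewrite f0 ?normr0//; apply: le_lt_trans h; exact: ler_norm.
Qed.

Lemma lipschitz_deriv (f : R -> R) B x y : smooth1 f -> (forall z, `|derive1 f z| <= B) ->
  `|f y - f x| <= B * `|y - x|.
Proof.
move=> sf fB.
have H u v : u <= v -> `|f v - f u| <= B * `|v - u|.
  move=> uv.
  have [c _ ->] : exists2 c, c \in `[u, v] & f v - f u = derive1 f c * (v - u).
    apply: MVT_segment => //; first by move=> z _; exact: smooth1_is_derive.
    by apply: continuous_subspaceT; exact: smooth1_continuous.
  by rewrite normrM ler_wpM2r.
have [xy|yx] := leP x y; first exact: H.
by rewrite distrC (distrC y); apply: H; exact: ltW.
Qed.

(** The mean value theorem is applied to [f] minus its linear part at [r]; the derivative of the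
    difference at a point [c] is at most [B * |c - r| <= B * |h|]. *)
Lemma taylor1 (f : R -> R) B r h : smooth1 f -> (forall z, `|derive1 (derive1 f) z| <= B) ->
  `|f (r - h) - f r + derive1 f r * h| <= B * h ^+ 2.
Proof.
move=> sf fB.
have B0 : 0 <= B by apply: le_trans (fB 0).
pose g x := f x - derive1 f r * x.
have dg (x : R) : is_derive x 1 g (derive1 f x - derive1 f r).
  have dx := smooth1_is_derive x sf.
  rewrite -[X in _ - X]mulr1.
  by apply: is_deriveB; apply: is_deriveZ.
have -> : f (r - h) - f r + derive1 f r * h = g (r - h) - g r by rewrite /g; ring.
have H u v : u <= v -> (forall z, z \in `[u, v] -> `|z - r| <= `|h|) -> `|v - u| = `|h| -> `|g v - g u| <= B * h ^+ 2.
  move=> uv zr vu.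
  have [c cuv ->] : exists2 c, c \in `[u, v] & g v - g u = (derive1 f c - derive1 f r) * (v - u).
    apply: MVT_segment => //.
    apply: continuous_subspaceT => z.
    by apply/differentiable_continuous/derivable1_diffP; have [] := dg z.
  rewrite normrM vu -real_normK ?num_real// expr2 mulrA ler_wpM2r//.
  apply: le_trans (lipschitz_deriv _ _ (smooth1_derive sf) fB) _.
  by rewrite ler_wpM2l// zr.
have [h0|h0] := leP 0 h.
  rewrite distrC; apply: H; first by lra.
    by move=> z; rewrite in_itv/= => /andP[z1 z2]; rewrite (ger0_norm h0) ler_norml; apply/andP; split; lra.
  by congr (`| _ |); ring.
apply: H; first by lra.
  by move=> z; rewrite in_itv/= => /andP[z1 z2]; rewrite (ltr0_norm h0) ler_norml; apply/andP; split; lra.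
by rewrite -normrN; congr (`| _ |); ring.
Qed.

Lemma enorm_sq_ge (y : V) i : (tnth y i) ^+ 2 <= enorm y ^+ 2.
Proof.
rewrite -real_normK ?num_real//.
by apply: lerXn2r; rewrite ?nnegrE ?enorm_ge0// tnth_le_enorm.
Qed.

(** [L] is the gradient of the product at [x], while [C] is uniform in [x]. The four bounds are
    proved together because the remainder for one more factor involves the size of the old product
    and of its linear part. The range [enorm y <= delta] contains every point where [ker] is
    nonzero. *)
Lemma taylor_prod (s : seq 'I_d) M b : smooth1 b -> (forall x, M < `|x| -> b x = 0) ->
  exists2 C, 0 <= C & forall x : V, exists L : 'I_d -> R, forall y : V, enorm y <= delta ->
    [/\ `|\prod_(j <- s) b (tnth x j - tnth y j) - \prod_(j <- s) b (tnth x j) + \sum_j L j * tnth y j| <= C * enorm y ^+ 2,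
     `|\prod_(j <- s) b (tnth x j)| <= C, `|\prod_(j <- s) b (tnth x j - tnth y j)| <= C & `|\sum_j L j * tnth y j| <= C * enorm y].
Proof.
move=> sb b0.
have [B0 B00 HB0] := smooth_supp_bounded (smooth1_continuous sb) b0.
have b1 x : M < `|x| -> derive1 b x = 0 by exact: derive1_supp.
have [B1 B10 HB1] := smooth_supp_bounded (smooth1_continuous (smooth1_derive sb)) b1.
have b2 x : M < `|x| -> derive1 (derive1 b) x = 0 by exact: derive1_supp.
have [B2 B20 HB2] := smooth_supp_bounded (smooth1_continuous (smooth1_derive (smooth1_derive sb))) b2.
elim: s => [|i s [C C0 IH]].
  exists 1 => // x; exists (fun=> 0) => y _; rewrite !big_nil big1 ?normr0; last by move=> j _; rewrite mul0r.
  by rewrite subrr addr0 normr0 normr1; split; rewrite ?mul1r ?sqr_ge0 ?enorm_ge0.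
have D0 : 0 <= delta by exact: ltW.
pose C' := B1 * C + (B0 + B1 * delta) * C + B2 * C + B0 * C + B1 * C.
have C'0 : 0 <= C' by rewrite /C' !addr_ge0// ?mulr_ge0// ?addr_ge0// ?mulr_ge0.
exists C' => // x; have [L HL] := IH x.
pose Q0 := \prod_(j <- s) b (tnth x j).
exists (fun j => b (tnth x i) * L j + (if j == i then derive1 b (tnth x i) * Q0 else 0)) => y yd.
have [h1 h2 h3 h4] := HL y yd.
rewrite !big_cons -/Q0.
set Q := \prod_(j <- s) b (tnth x j - tnth y j) in h1 h3 *.
set S := \sum_j L j * tnth y j in h1 h4.
set A0 := b (tnth x i); set A1 := derive1 b (tnth x i); set t := tnth y i.
set A := b (tnth x i - t).
have -> : \sum_j (A0 * L j + (if j == i then A1 * Q0 else 0)) * tnth y j = A0 * S + A1 * Q0 * t.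
  rewrite /S mulr_sumr; under eq_bigr do rewrite mulrDl -mulrA.
  rewrite big_split/=; congr (_ + _).
  rewrite (bigD1 i)//= eqxx big1 ?addr0// => j /negbTE ->; exact: mul0r.
have hA := taylor1 (tnth x i) t sb HB2; rewrite -/A -/A0 -/A1 in hA.
have ht : `|t| <= enorm y by exact: tnth_le_enorm.
have ht2 : t ^+ 2 <= enorm y ^+ 2 by exact: enorm_sq_ge.
have e0 := enorm_ge0 y.
have bA0 : `|A0| <= B0 by exact: HB0.
have bA : `|A| <= B0 by exact: HB0.
have bA1 : `|A1| <= B1 by exact: HB1.
have e2 : 0 <= enorm y ^+ 2 by exact: sqr_ge0.
split.
(* The product rule for remainders: one product of two first-order terms, and two terms that each
   contain a second-order remainder. *)
- have -> : A * Q - A0 * Q0 + (A0 * S + A1 * Q0 * t) =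
     (A1 * t) * S + (A0 - A1 * t) * (Q - Q0 + S) + (A - A0 + A1 * t) * Q by ring.
  apply: le_trans (ler_normD _ _) _; apply: le_trans (lerD (ler_normD _ _) (lexx _)) _.
  rewrite !normrM.
  have k1 : `|A1| * `|t| * `|S| <= B1 * C * enorm y ^+ 2.
    rewrite (_ : B1 * C * enorm y ^+ 2 = B1 * enorm y * (C * enorm y)); last by ring.
    by apply: ler_pM => //; apply: ler_pM.
  have k2 : `|A0 - A1 * t| * `|Q - Q0 + S| <= (B0 + B1 * delta) * C * enorm y ^+ 2.
    rewrite -mulrA; apply: ler_pM => //.
    apply: le_trans (ler_normB _ _) _; apply: lerD => //; rewrite normrM.
    by apply: ler_pM => //; exact: le_trans ht yd.
  have k3 : `|A - A0 + A1 * t| * `|Q| <= B2 * C * enorm y ^+ 2.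
    rewrite mulrAC; apply: ler_pM => //.
    by apply: le_trans hA _; rewrite ler_wpM2l.
  apply: (@le_trans _ _ ((B1 * C + (B0 + B1 * delta) * C + B2 * C) * enorm y ^+ 2)).
    by rewrite !mulrDl in k1 k2 k3 *; lra.
  rewrite ler_wpM2r// /C'; have : 0 <= B0 * C by rewrite mulr_ge0.
  have : 0 <= B1 * C by rewrite mulr_ge0.
  lra.
- rewrite normrM; apply: (@le_trans _ _ (B0 * C)); first exact: ler_pM.
  rewrite /C'; have : 0 <= B1 * C by rewrite mulr_ge0.
  have : 0 <= (B0 + B1 * delta) * C by rewrite mulr_ge0// addr_ge0// mulr_ge0.
  have : 0 <= B2 * C by rewrite mulr_ge0.
  lra.
- rewrite normrM; apply: (@le_trans _ _ (B0 * C)); first exact: ler_pM.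
  rewrite /C'; have : 0 <= B1 * C by rewrite mulr_ge0.
  have : 0 <= (B0 + B1 * delta) * C by rewrite mulr_ge0// addr_ge0// mulr_ge0.
  have : 0 <= B2 * C by rewrite mulr_ge0.
  lra.
- apply: le_trans (ler_normD _ _) _; rewrite !normrM.
  apply: (@le_trans _ _ ((B0 * C + B1 * C) * enorm y)).
    rewrite mulrDl; apply: lerD; first by rewrite -mulrA; apply: ler_pM.
    by apply: ler_pM => //; apply: ler_pM.
  rewrite ler_wpM2r// /C'; have : 0 <= B1 * C by rewrite mulr_ge0.
  have : 0 <= (B0 + B1 * delta) * C by rewrite mulr_ge0// addr_ge0// mulr_ge0.
  have : 0 <= B2 * C by rewrite mulr_ge0.
  lra.
Qed.

Lemma tnth_vopp (y : V) i : tnth (vopp y) i = - tnth y i.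
Proof. exact: tnth_mktuple. Qed.

Lemma enorm_vopp (y : V) : enorm (vopp y) = enorm y.
Proof. by congr Num.sqrt; apply: eq_bigr => i _; rewrite !tnth_vopp mulrNN. Qed.

Lemma ker_vopp y : ker (vopp y) = ker y.
Proof. by rewrite /ker enorm_vopp. Qed.

Lemma Rintegral_mud_odd (f : V -> R) : intg mu f -> (forall x, f (vopp x) = - f x) ->
  Rintegral mu setT f = 0.
Proof.
move=> If fodd.
have H : Rintegral mu setT (fun x => f (vopp x)) = Rintegral mu setT f.
  rewrite /Rintegral; congr fine.
  by apply: (integral_mud_vopp (F := EFin \o f)); apply/measurable_EFinP; exact: intg_measurable If.
have : Rintegral mu setT (fun x => f (vopp x)) = - Rintegral mu setT f.
  by rewrite -RintegralN//; apply: eq_Rintegral => x _; rewrite fodd.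
rewrite H; move: (Rintegral _ _ _) => I E; lra.
Qed.

Lemma measurable_gt_enorm e : measurable_fun setT (fun y : V => e < enorm y).
Proof.
apply: measurable_fun_ltr => //.
exact: (measurable_enorm (@measurable_id _ _ setT)).
Qed.

Definition kere (e : R) (y : V) : R := if e < enorm y then ker y else 0.

Lemma measurable_kere e : measurable_fun setT (kere e).
Proof.
apply: measurable_fun_ifT => //; first exact: measurable_gt_enorm.
exact: measurable_ker.
Qed.

Lemma kere_ge0 e y : 0 <= kere e y.
Proof. by rewrite /kere; case: ifP => // _; exact: ker_ge0. Qed.

Lemma kere_le e y : kere e y <= ker y.
Proof. by rewrite /kere; case: ifP => // _; exact: ker_ge0. Qed.

Lemma intg_kere e : 0 < e -> intg mu (kere e).
Proof.
move=> e0; apply: (@intg_le _ _ _ _ _ (fun y => (e ^+ 2)^-1 * (ker y * enorm y ^+ 2))).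
- exact: measurable_kere.
- move=> y; rewrite ger0_norm ?kere_ge0// /kere; case: ifPn => [h|_]; last first.
    by rewrite mulr_ge0 ?invr_ge0 ?sqr_ge0// mulr_ge0 ?ker_ge0 ?sqr_ge0.
  rewrite mulrC mulrAC -[leLHS]mulr1 -mulrA ler_wpM2l ?ker_ge0//.
  by rewrite ler_pdivlMl ?exprn_gt0// mulr1 lerXn2r ?nnegrE ?enorm_ge0// ltW.
- apply: intgZl; exact: intg_ker_sq.
Qed.

Lemma kere_vopp e y : kere e (vopp y) = kere e y.
Proof. by rewrite /kere enorm_vopp ker_vopp. Qed.

Section Symbol.
Variables (M : R) (b : R -> R) (z : V).
Hypothesis eb : even_bump M b.

Lemma taylor_bumpv : exists2 C, 0 <= C & forall x : V, exists L : 'I_d -> R, forall y : V, enorm y <= delta ->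
    `|bumpv b z (vsub x y) - bumpv b z x + \sum_j L j * tnth y j| <= C * enorm y ^+ 2.
Proof.
have [sb _ b0] := eb.
have [C C0 H] := taylor_prod (index_enum 'I_d) sb b0.
exists C => // x; have [L HL] := H (vsub x z); exists L => y yd.
have [h _ _ _] := HL y yd.
have -> : bumpv b z (vsub x y) = \prod_(j < d) b (tnth (vsub x z) j - tnth y j).
  by apply: eq_bigr => j _; rewrite !tnth_vsub; congr b; ring.
have -> : bumpv b z x = \prod_(j < d) b (tnth (vsub x z) j).
  by apply: eq_bigr => j _; rewrite !tnth_vsub.
exact: h.
Qed.

Let g := bumpv b z.

Definition Keps (e : R) (x : V) : R := Rintegral mu setT (fun y => kere e y * (g x - g (vsub x y))).

(** Defined along a sequence, as dominated convergence requires; [Keps_cvg] identifies it with the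
    one-sided limit occurring in [Kdelta], whose constant and sign are left out here. *)
Definition K0 (x : V) : R := lim (Keps n.+1%:R^-1 x @[n --> \oo]).

Lemma bumpv_bounded : exists2 C, 0 <= C & forall x, `|g x| <= C.
Proof.
have [sb _ b0] := eb.
have [C C0 H] := smooth_supp_bounded (smooth1_continuous sb) b0.
exists (C ^+ d); first exact: exprn_ge0.
move=> x; rewrite /g /bumpv normr_prod.
apply: (@le_trans _ _ (\prod_(j < d) C)); last by rewrite prodr_const card_ord.
by apply: ler_prod => j _; rewrite normr_ge0 H.
Qed.

Lemma measurable_bumpv : measurable_fun setT g.
Proof. exact: intg_measurable (intg_bumpv z eb). Qed.

(** The truncated kernel is even and the linear Taylor term is odd, so that term integrates to 0 and
    can be added freely. What remains is bounded by a multiple of [ker y * enorm y ^+ 2], integrable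
    without truncation. The resulting bound is uniform in [e] and [x], which prepares the passage to
    the limit under an integral in [x]. *)
Lemma Keps_cvg_seq : exists2 C : R, 0 <= C & (forall x, exists l : R, forall u : nat -> R, (forall n, 0 < u n) ->
  u n @[n --> \oo] --> 0 -> Keps (u n) x @[n --> \oo] --> l) /\
  (forall (e : R) (x : V), 0 < e -> `|Keps e x| <= C).
Proof.
have [C C0 HC] := taylor_bumpv.
have Iks := intg_ker_sq.
exists (C * Rintegral mu setT (fun y => ker y * enorm y ^+ 2)).
  by rewrite mulr_ge0// Rintegral_ge0// => y _; rewrite mulr_ge0 ?ker_ge0 ?sqr_ge0.
have key x : exists H : V -> R, [/\ measurable_fun setT H, (forall y, `|H y| <= C * (ker y * enorm y ^+ 2)) &
   forall e, 0 < e -> Keps e x = Rintegral mu setT (fun y => if e < enorm y then H y else 0)].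
  have [L HL] := HC x.
  have mlin : measurable_fun setT (fun y : V => \sum_j L j * tnth y j).
    by apply: measurable_sum => j; apply: measurable_funM => //; exact: measurable_tnth.
  have mgx : measurable_fun setT (fun y => g (vsub x y)).
    apply: (measurableT_comp measurable_bumpv).
    by apply: measurable_vsub => //; exact: measurable_id.
  pose D y := g (vsub x y) - g x + \sum_j L j * tnth y j.
  have mD : measurable_fun setT D.
    by apply: measurable_funD => //; apply: measurable_funB.
  exists (fun y => ker y * (- D y)); split.
  - apply: measurable_funM; first exact: measurable_ker.
    exact: measurableT_comp.
  - move=> y; rewrite normrM (ger0_norm (ker_ge0 y)) normrN.
    have [yd|yd] := leP (enorm y) delta; last by rewrite ker_supp// !mul0r mulr0.
    rewrite mulrCA ler_wpM2l ?ker_ge0//; exact: HL.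
  - move=> e e0.
    have Ik := intg_kere e0.
    have Ilin : intg mu (fun y => kere e y * \sum_j L j * tnth y j).
      apply: (@intg_le _ _ _ _ _ (fun y => (\sum_j `|L j| * delta) * kere e y)).
      + by apply: measurable_funM => //; exact: measurable_kere.
      + move=> y; rewrite normrM (ger0_norm (kere_ge0 e y)) mulrC.
        have [yd|yd] := leP (enorm y) delta; last first.
          have -> : kere e y = 0 by rewrite /kere ker_supp// if_same.
          by rewrite !mulr0.
        rewrite ler_wpM2r ?kere_ge0//.
        apply: le_trans (ler_norm_sum _ _ _) _; apply: ler_sum => j _; rewrite normrM ler_wpM2l//.
        exact: le_trans (tnth_le_enorm _ _) yd.
      + exact: intgZl.
    have Ig : intg mu (fun y => kere e y * (g x - g (vsub x y))).
      have [B B0 HB] := bumpv_bounded.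
      apply: (intgMb (C := B + B)) => //; first exact: measurable_funB.
      by move=> y; apply: le_trans (ler_normB _ _) _; exact: lerD.
    have Ho : Rintegral mu setT (fun y => kere e y * \sum_j L j * tnth y j) = 0.
      apply: (Rintegral_mud_odd Ilin) => y; rewrite kere_vopp -mulrN; congr (_ * _).
      by rewrite -sumrN; apply: eq_bigr => j _; rewrite tnth_vopp mulrN.
    transitivity (Keps e x - Rintegral mu setT (fun y => kere e y * \sum_j L j * tnth y j)).
      by rewrite Ho subr0.
    rewrite /Keps -RintegralB//; apply: eq_Rintegral => y _.
    rewrite /kere /D; case: ifP => _; last by rewrite !mul0r subr0.
    by ring.
split.
- move=> x; have [H [mH HH KE]] := key x.
  exists (Rintegral mu setT H) => u u0 cu.
  have -> : (fun n => Keps (u n) x) = fun n => Rintegral mu setT (fun y => if u n < enorm y then H y else 0).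
    by apply/funext => n; exact: KE.
  apply: (proj2 (@dominated_Rintegral _ _ _ mu (fun n y => if u n < enorm y then H y else 0) H (fun y => C * (ker y * enorm y ^+ 2)) _ _ _ _)).
  + move=> n; apply: measurable_fun_ifT => //; exact: measurable_gt_enorm.
  + move=> y; have [y0|y0] := eqVneq (enorm y) 0.
      have -> : H y = 0 by apply/eqP; rewrite -normr_le0; apply: le_trans (HH y) _; rewrite y0 expr0n !mulr0.
      under eq_fun do rewrite if_same; exact: cvg_cst.
    have {}y0 : 0 < enorm y by rewrite lt_def y0 enorm_ge0.
    apply: (@cvg_trans _ (H y @[n --> \oo])); last exact: cvg_cst.
    apply: near_eq_cvg; near=> n; rewrite ifT//.
    by near: n; exact: (cvgr_lt 0 cu).
  + exact: intgZl.
  + move=> n y; case: ifP => _ //; rewrite normr0.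
    by rewrite mulr_ge0// mulr_ge0 ?ker_ge0 ?sqr_ge0.
- move=> e x e0; have [H [mH HH KE]] := key x.
  rewrite KE// -RintegralZl//; apply: le_norm_Rintegral.
  + exact: intgZl.
  + by apply: measurable_fun_ifT => //; exact: measurable_gt_enorm.
  + move=> y; case: ifP => _ //; rewrite normr0.
    by rewrite mulr_ge0// mulr_ge0 ?ker_ge0 ?sqr_ge0.
Unshelve. all: by end_near. Qed.

Lemma invn_cvg0 : (n.+1%:R^-1 : R) @[n --> \oo] --> 0.
Proof. exact: cvg_harmonic. Qed.

Lemma K0_cvg_seq x : Keps n.+1%:R^-1 x @[n --> \oo] --> K0 x.
Proof.
have [C _ [H _]] := Keps_cvg_seq; have [l Hl] := H x.
by apply/cvg_ex; exists l; apply: Hl => //; exact: invn_cvg0.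
Qed.

Lemma Keps_cvg x : Keps e x @[e --> 0^'+] --> K0 x.
Proof.
have [C _ [H _]] := Keps_cvg_seq; have [l Hl] := H x.
have -> : K0 x = l.
  by apply: cvg_lim => //; apply: Hl => //; exact: invn_cvg0.
by apply/cvg_at_rightP => u [u0 cu]; exact: Hl.
Qed.

Lemma integral_norm_bumpv (w : V) :
  (\int[mu]_x (`|bumpv b w x|)%:E = (\prod_(j < d) Rintegral (@lebesgue_measure R) setT (fun t => `|b t|))%:E)%E.
Proof.
have Ib := even_bump_intg eb.
have mb := intg_measurable Ib.
have mj (j : 'I_d) : measurable_fun setT (fun t : R => b (t - tnth w j)).
  by apply: measurableT_comp => //; exact: measurable_funB.
under eq_integral do rewrite /bumpv normr_prod.
apply: (@integral_mud_prod R d (fun j t => `|b (t - tnth w j)|)) => //.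
- by move=> j; exact: measurableT_comp.
- move=> j.
  rewrite (integral_shift (- tnth w j) (f := fun t => (`|b t|)%:E)); last first.
    by apply/measurable_EFinP; exact: measurableT_comp.
  rewrite /Rintegral fineK//; apply: integrable_fin_num => //; exact: intg_norm Ib.
Qed.

Lemma bumpv_vsub (x y : V) : g (vsub x y) = bumpv b (vsub z (vopp y)) x.
Proof.
apply: eq_bigr => j _; rewrite !tnth_vsub tnth_vopp; congr b; ring.
Qed.

Lemma Rintegral_bumpv_cos (w xi : V) th :
  Rintegral mu setT (fun x => bumpv b w x * cos (dot x xi + th)) = fcosv b xi * cos (dot w xi + th).
Proof.
rewrite -intR_mud; first exact: intR_bumpv eb.
exact: intg_bumpv_cos eb.
Qed.

Lemma dot_vsub (x y xi : V) : dot (vsub x y) xi = dot x xi - dot y xi.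
Proof. by rewrite /dot -sumrB; apply: eq_bigr => j _; rewrite tnth_vsub mulrBl. Qed.

Lemma dot_vopp (y xi : V) : dot (vopp y) xi = - dot y xi.
Proof. by rewrite /dot -sumrN; apply: eq_bigr => j _; rewrite tnth_vopp mulNr. Qed.

Lemma measurable_dotl (xi : V) : measurable_fun setT (fun x : V => dot x xi).
Proof. by apply: measurable_dot. Qed.

(** For [e > 0] the truncated kernel is integrable and Fubini applies. Translating the bump by [y]
    adds [dot y xi] to the phase; the cosine part of the addition formula gives the multiplier and
    the sine part is odd in [y]. *)
Lemma fourier_Keps e (xi : V) th : 0 < e ->
  Rintegral mu setT (fun x => Keps e x * cos (dot x xi + th)) =
  fcosv b xi * cos (dot z xi + th) * Rintegral mu setT (fun y => kere e y * (1 - cos (dot y xi))).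
Proof.
move=> e0; have Ik := intg_kere e0.
pose F (p : V * V) := kere e p.2 * (g p.1 - g (vsub p.1 p.2)) * cos (dot p.1 xi + th).
have mg1 : measurable_fun setT (fun p : V * V => g p.1) by exact: measurableT_comp measurable_bumpv _.
have mF : measurable_fun setT F.
  apply: measurable_funM.
    apply: measurable_funM; first exact: measurableT_comp (measurable_kere e) _.
    apply: measurable_funB => //.
    by apply: (measurableT_comp measurable_bumpv); exact: measurable_vsub.
  exact: measurableT_comp (measurable_cos_dot xi th) _.
pose N := (\prod_(j < d) Rintegral (@lebesgue_measure R) setT (fun t => `|b t|)).
have N0 : 0 <= N by apply: prodr_ge0 => j _; exact: Rintegral_ge0.
have IF : intg (mu \x mu)%E F.
  apply: (proj2 (intg_prodP2 _ _ mF)).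
  apply: (@le_lt_trans _ _ (\int[mu]_y (`|kere e y| * (N + N))%:E)%E).
    apply: ge0_le_integral => //.
    - by move=> y _; exact: integral_ge0.
    - apply: (@measurable_param_integral _ _ _ _ _ mu (fun p : V * V => (`|F (p.2, p.1)|)%:E)).
      apply/measurable_EFinP; apply: measurableT_comp => //; apply: (measurableT_comp mF).
      exact: measurable_fun_pair.
    - apply/measurable_EFinP; apply: measurable_funM => //.
      by apply: measurableT_comp => //; exact: measurable_kere.
    - move=> y _.
      apply: (@le_trans _ _ (\int[mu]_x ((`|kere e y|)%:E * ((`|g x|)%:E + (`|bumpv b (vsub z (vopp y)) x|)%:E)))%E).
        have mgn (w : V) : measurable_fun setT (fun x : V => (`|bumpv b w x|)%:E).
          apply/measurable_EFinP; apply: measurableT_comp => //.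
          exact: intg_measurable (intg_bumpv w eb).
        apply: ge0_le_integral => //.
        + by apply/measurable_EFinP; apply: measurableT_comp => //; apply: (measurableT_comp mF); exact: measurable_fun_pair.
        + by apply: emeasurable_funM => //; apply: emeasurable_funD => //; exact: mgn.
        + move=> x _; rewrite -EFinD -EFinM lee_fin /F /= !normrM.
          rewrite -[X in _ <= X]mulr1; apply: ler_pM => //; last exact: norm_cos_le1.
          by rewrite ler_wpM2l// bumpv_vsub; exact: ler_normB.
      have mgn (w : V) : measurable_fun setT (fun x : V => (`|bumpv b w x|)%:E).
        apply/measurable_EFinP; apply: measurableT_comp => //.
        exact: intg_measurable (intg_bumpv w eb).
      have msum := emeasurable_funD (mgn z) (mgn (vsub z (vopp y))).
      rewrite (ge0_integralZl _ measurableT msum)//; last by move=> x _; rewrite /= -EFinD lee_fin addr_ge0.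
      rewrite ge0_integralD//; try exact: mgn.
      by rewrite !integral_norm_bumpv -EFinD -EFinM.
  have := intgZl (N + N) (intg_norm Ik) => /integrableP[_].
  apply: le_lt_trans; apply: ge0_le_integral => //.
  - by move=> y _; rewrite lee_fin mulr_ge0// addr_ge0.
  - apply/measurable_EFinP; apply: measurable_funM => //.
    by apply: measurableT_comp => //; exact: measurable_kere.
  - apply/measurable_EFinP; apply: measurableT_comp => //; apply: measurable_funM => //.
    by apply: measurableT_comp => //; exact: measurable_kere.
  - by move=> y _; rewrite /= lee_fin mulrC ler_norm.
transitivity (Rintegral mu setT (fun x => Rintegral mu setT (fun y => F (x, y)))).
  apply: eq_Rintegral => x _; rewrite /Keps -RintegralZr//.
  have [B B0 HB] := bumpv_bounded.
  apply: (intgMb (C := B + B)) => //.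
    apply: measurable_funB => //; apply: (measurableT_comp measurable_bumpv).
    by apply: measurable_vsub => //; exact: measurable_id.
  by move=> y; apply: le_trans (ler_normB _ _) _; exact: lerD.
rewrite (RFubini IF).
transitivity (Rintegral mu setT (fun y => fcosv b xi * cos (dot z xi + th) * (kere e y * (1 - cos (dot y xi))) +
   fcosv b xi * sin (dot z xi + th) * (kere e y * sin (dot y xi)))).
  apply: eq_Rintegral => y _; rewrite /F /=.
  transitivity (Rintegral mu setT (fun x => kere e y * (g x * cos (dot x xi + th) - bumpv b (vsub z (vopp y)) x * cos (dot x xi + th)))).
    by apply: eq_Rintegral => x _; rewrite bumpv_vsub; ring.
  rewrite RintegralZl//; last by apply: intgB; exact: intg_bumpv_cos eb.
  rewrite RintegralB//; try exact: intg_bumpv_cos eb.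
  rewrite !Rintegral_bumpv_cos dot_vsub dot_vopp opprK.
  have -> : dot z xi + dot y xi + th = (dot z xi + th) + dot y xi by ring.
  by rewrite (cosD (dot z xi + th) (dot y xi)); ring.
have I1 : intg mu (fun y => kere e y * (1 - cos (dot y xi))).
  apply: (intgMb (C := 2)) => //.
    apply: measurable_funB => //; apply: (measurableT_comp (@measurable_cos R)).
    exact: measurable_dotl.
  move=> y; rewrite ger0_norm; last by rewrite subr_ge0 cos_le1.
  by have := cos_geN1 (dot y xi); lra.
have I2 : intg mu (fun y => kere e y * sin (dot y xi)).
  apply: (intgMb (C := 1)) => //.
    by apply: (measurableT_comp (@measurable_sin R)); exact: measurable_dotl.
  by move=> y; exact: norm_sin_le1.
rewrite RintegralD//; try exact: intgZl.
rewrite !RintegralZl//.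
rewrite (@Rintegral_mud_odd (fun y => kere e y * sin (dot y xi)))//; first by rewrite mulr0 addr0.
by move=> y; rewrite kere_vopp dot_vopp sinN mulrN.
Qed.

(** The support is controlled independently of [e]. Together with the uniform bound of
    [Keps_cvg_seq] this provides an integrable majorant as [e] tends to 0. *)
Lemma Keps_out e x : ~ cube z (`|M| + delta) x -> Keps e x = 0.
Proof.
move=> /existsNP[j /negP]; rewrite -ltNge => h.
have [_ _ b0] := eb.
rewrite /Keps /Rintegral integral0_eq// => y _; congr EFin.
have [yd|yd] := leP (enorm y) delta; last by rewrite /kere ker_supp// if_same mul0r.
have hM := ler_norm M.
have -> : g x = 0.
  have hb : M < `|tnth x j - tnth z j|.
    by apply: le_lt_trans h; apply: le_trans hM _; rewrite lerDl ltW.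
  by rewrite /g /bumpv (bigD1 j)//= b0// mul0r.
have -> : g (vsub x y) = 0.
  suff hb : M < `|tnth (vsub x y) j - tnth z j| by rewrite /g /bumpv (bigD1 j)//= b0// mul0r.
  rewrite tnth_vsub; have := le_trans (tnth_le_enorm y j) yd.
  have -> : tnth x j - tnth y j - tnth z j = (tnth x j - tnth z j) - tnth y j by ring.
  have := lerB_dist (tnth x j - tnth z j) (tnth y j).
  move: h; lra.
by rewrite subrr mulr0.
Qed.

(** The multiplier in Lévy-Khintchine form, up to the constant depending on [kappa] and [delta]. *)
Definition Omega (xi : V) : R := Rintegral mu setT (fun y => ker y * (1 - cos (dot y xi))).

(** With the l1 norm of [xi] the bound on [dot y xi] holds term by term, without the Cauchy-Schwarz
    inequality. *)
Definition norm1 (xi : V) : R := \sum_j `|tnth xi j|.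

Lemma norm_dot_le (y xi : V) : `|dot y xi| <= enorm y * norm1 xi.
Proof.
rewrite /dot /norm1 mulr_sumr; apply: le_trans (ler_norm_sum _ _ _) _.
by apply: ler_sum => j _; rewrite normrM ler_wpM2r// tnth_le_enorm.
Qed.

Lemma ker_cos_le (y xi : V) : ker y * (1 - cos (dot y xi)) <= norm1 xi ^+ 2 / 2 * (ker y * enorm y ^+ 2).
Proof.
rewrite mulrCA ler_wpM2l ?ker_ge0//; apply: le_trans (cos_ge _) _.
have : dot y xi ^+ 2 <= (enorm y * norm1 xi) ^+ 2.
  rewrite -real_normK ?num_real//; apply: lerXn2r; rewrite ?nnegrE ?norm_dot_le//.
  by rewrite mulr_ge0 ?enorm_ge0// /norm1 sumr_ge0.
rewrite exprMn; lra.
Qed.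

Lemma ker_cos_ge0 (y xi : V) : 0 <= ker y * (1 - cos (dot y xi)).
Proof. by rewrite mulr_ge0 ?ker_ge0// subr_ge0 cos_le1. Qed.

Lemma measurable_cos_dotl (xi : V) : measurable_fun setT (fun y : V => 1 - cos (dot y xi)).
Proof.
apply: measurable_funB => //; apply: (measurableT_comp (@measurable_cos R)).
exact: measurable_dotl.
Qed.

Lemma Omega_ge0 xi : 0 <= Omega xi.
Proof. by apply: Rintegral_ge0 => y _; exact: ker_cos_ge0. Qed.

Lemma intg_ker_cos xi : intg mu (fun y => ker y * (1 - cos (dot y xi))).
Proof.
apply: (@intg_le _ _ _ _ _ (fun y => norm1 xi ^+ 2 / 2 * (ker y * enorm y ^+ 2))).
- by apply: measurable_funM; [exact: measurable_ker|exact: measurable_cos_dotl].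
- by move=> y; rewrite ger0_norm ?ker_cos_ge0// ker_cos_le.
- by apply: intgZl; exact: intg_ker_sq.
Qed.

Lemma Omega_le xi : Omega xi <= norm1 xi ^+ 2 / 2 * Rintegral mu setT (fun y => ker y * enorm y ^+ 2).
Proof.
rewrite -RintegralZl//; last exact: intg_ker_sq.
apply: le_Rintegral => //; first exact: intg_ker_cos.
  by apply: intgZl; exact: intg_ker_sq.
by move=> y _; exact: ker_cos_le.
Qed.

Lemma Omega_vopp xi : Omega (vopp xi) = Omega xi.
Proof.
apply: eq_Rintegral => y _; congr (_ * (_ - _)).
have -> : dot y (vopp xi) = - dot y xi.
  by rewrite /dot -sumrN; apply: eq_bigr => j _; rewrite tnth_vopp mulrN.
by rewrite cosN.
Qed.

Lemma measurable_Omega : measurable_fun setT Omega.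
Proof.
rewrite /Omega.
apply: (@measurable_param_Rintegral _ _ _ _ _ mu (fun p : V * V => ker p.2 * (1 - cos (dot p.2 p.1)))).
apply: measurable_funM; first exact: measurableT_comp measurable_ker _.
apply: measurable_funB => //; apply: (measurableT_comp (@measurable_cos R)).
exact: measurable_dot.
Qed.

(** Both sides of [fourier_Keps] pass to the limit by dominated convergence: the left one with a
    constant on a fixed cube as majorant, the right one with [ker y * (1 - cos (dot y xi))]. *)
Lemma fourier_K0 (xi : V) th :
  intg mu (fun x => K0 x * cos (dot x xi + th)) /\
  Rintegral mu setT (fun x => K0 x * cos (dot x xi + th)) = fcosv b xi * cos (dot z xi + th) * Omega xi.
Proof.
have [C C0 [_ HC]] := Keps_cvg_seq.
have r0 : 0 <= `|M| + delta by rewrite addr_ge0// ltW.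
have IC : intg mu (fun x => C * \1_(cube z (`|M| + delta)) x).
  apply: intgZl; apply/integrableP; split.
    by apply/measurable_EFinP; apply: measurable_indic; exact: measurable_cube.
  under eq_integral do rewrite /= ger0_norm//.
  rewrite integral_indic//; last exact: measurable_cube.
  by rewrite setIT [X in (X < _)%E](mud_cube z r0) ltry.
have [I1 c1] : intg mu (fun x => K0 x * cos (dot x xi + th)) /\
  Rintegral mu setT (fun x => Keps n.+1%:R^-1 x * cos (dot x xi + th)) @[n --> \oo] -->
  Rintegral mu setT (fun x => K0 x * cos (dot x xi + th)).
  apply: (dominated_Rintegral (h := fun x => C * \1_(cube z (`|M| + delta)) x)) => //.
  - move=> n; apply: measurable_funM; last exact: measurable_cos_dot.
    rewrite /Keps; apply: (@measurable_param_Rintegral _ _ _ _ _ mu (fun p : V * V => kere n.+1%:R^-1 p.2 * (g p.1 - g (vsub p.1 p.2)))).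
    apply: measurable_funM; first exact: measurableT_comp (measurable_kere _) _.
    apply: measurable_funB; first exact: measurableT_comp measurable_bumpv _.
    by apply: (measurableT_comp measurable_bumpv); exact: measurable_vsub.
  - move=> x; apply: cvgMl; exact: K0_cvg_seq.
  - move=> n x; rewrite normrM; apply: (@le_trans _ _ (`|Keps n.+1%:R^-1 x|)).
      by rewrite ler_piMr// norm_cos_le1.
    rewrite indicE; case: (boolP (x \in _)) => [h|/negP h]; first by rewrite mulr1; exact: HC.
    by rewrite Keps_out ?normr0 ?mulr0//; move=> h'; apply: h; rewrite inE.
split => //.
have [_ c2] : intg mu (fun y => ker y * (1 - cos (dot y xi))) /\
  Rintegral mu setT (fun y => kere n.+1%:R^-1 y * (1 - cos (dot y xi))) @[n --> \oo] --> Omega xi.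
  apply: (dominated_Rintegral (h := fun y => ker y * (1 - cos (dot y xi)))).
  - move=> n; apply: measurable_funM; [exact: measurable_kere|exact: measurable_cos_dotl].
  - move=> y; apply: cvgMl.
    have [y0|y0] := eqVneq (enorm y) 0.
      have k0 : ker y = 0 by rewrite /ker y0 powR0 ?invr0 ?mulr0// gt_eqF.
      have -> : (fun n => kere n.+1%:R^-1 y) = fun=> 0 by apply/funext => n; rewrite /kere k0 if_same.
      by rewrite k0; exact: cvg_cst.
    have {}y0 : 0 < enorm y by rewrite lt_def y0 enorm_ge0.
    apply: (@cvg_trans _ (ker y @[n --> \oo])); last exact: cvg_cst.
    apply: near_eq_cvg; near=> n; rewrite /kere ifT//.
    by near: n; exact: (cvgr_lt 0 invn_cvg0).
  - exact: intg_ker_cos.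
  - move=> n y; have h : 0 <= 1 - cos (dot y xi) by rewrite subr_ge0 cos_le1.
    by rewrite ger0_norm ?mulr_ge0 ?kere_ge0// ler_wpM2r// kere_le.
have c3 : Rintegral mu setT (fun x => Keps n.+1%:R^-1 x * cos (dot x xi + th)) @[n --> \oo] -->
    fcosv b xi * cos (dot z xi + th) * Omega xi.
  under eq_fun do rewrite fourier_Keps//.
  exact: cvgMl_tmp.
by rewrite -(cvg_lim _ c1)// (cvg_lim _ c3).
Unshelve. all: by end_near. Qed.

End Symbol.

End Kernel.

(** * The equation tested against translated bumps *)

Section Pairing.
Variable R : realType.
Variable d : nat.
Local Notation V := (d.-tuple R).
Local Notation mu := (@mud R d).
Variables (kappa alpha delta : R) (chi : R -> R).
Hypothesis alpha01 : 0 < alpha < 1.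
Hypothesis delta0 : 0 < delta.
Hypothesis mchi : measurable_fun setT chi.
Hypothesis chi01 : forall r, 0 <= chi r <= 1.
Hypothesis chi_supp : forall r, 1 < `|r| -> chi r = 0.
Variables (M : R) (b : R -> R).
Hypothesis eb : even_bump M b.

Definition wave (a : R -> R) (i : 'I_d) (z : V) : R -> V -> V :=
  vtest i a (fun j r => b (r - tnth z j)).

Definition symbol (xi : V) : R := kappa / powR delta (2 * (1 - alpha)) * Omega alpha delta chi xi.

Lemma tnth_wave a i z t x j : tnth (wave a i z t x) j = if j == i then a t * bumpv b z x else 0.
Proof. exact: tnth_mktuple. Qed.

Lemma tnth_Kdelta_wave a i z t x j :
  tnth (Kdelta kappa alpha chi delta (wave a i z t) x) j =
  if j == i then - (kappa / powR delta (2 * (1 - alpha)) * (a t * K0 alpha delta chi b z x)) else 0.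
Proof.
rewrite tnth_mktuple; case: (eqVneq j i) => [->|ji]; last first.
  have E e : intR (fun y => if e < enorm y then chi (enorm y / delta) *
     (tnth (wave a i z t x) j - tnth (wave a i z t (vsub x y)) j) / powR (enorm y) (d%:R + 2 * alpha) else 0) = 0.
    rewrite (_ : (fun y => _) = fun=> 0).
      rewrite intR_mud; last exact: intg0.
      by rewrite /Rintegral integral0_eq.
    by apply/funext => y; rewrite !tnth_wave (negbTE ji) subrr mulr0 mul0r if_same.
  under eq_fun do rewrite E.
  by rewrite lim_cst// mulr0.
rewrite mulNr; congr (- (_ * _)).
apply: cvg_lim => //.
have c1 : a t * Keps alpha delta chi b z e x @[e --> 0^'+] --> a t * K0 alpha delta chi b z x.
  by apply: cvgMl_tmp; apply: Keps_cvg => //; exact: eb.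
apply: cvg_trans c1; apply: near_eq_cvg; near=> e.
(* Near [0^'+] only positive [e] matter; for these the integrand is integrable and [intR] is an
   integral against [mud]. *)
have e0 : 0 < e by near: e; exact: nbhs_right_gt.
have Ik := intg_kere d alpha01 delta0 mchi chi01 chi_supp e0.
have [B B0 HB] := bumpv_bounded z eb.
have I1 : intg mu (fun y => kere alpha delta chi e y * (bumpv b z x - bumpv b z (vsub x y))).
  apply: (intgMb (C := B + B)) => //.
    apply: measurable_funB => //; apply: (measurableT_comp (measurable_bumpv z eb)).
    by apply: measurable_vsub => //; exact: measurable_id.
  by move=> y; apply: le_trans (ler_normB _ _) _; exact: lerD.
rewrite /Keps -RintegralZl// -intR_mud; last exact: intgZl.
congr intR; apply/funext => y; rewrite !tnth_wave eqxx /kere /ker.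
case: ifP => _; last by rewrite mul0r mulr0.
by ring.
Unshelve. all: by end_near. Qed.

(** The phase [th = 0] computes [fourC] and [th = - pi / 2] computes [fourS]. *)
Lemma four_wave (psi : V -> V) (i : 'I_d) a z t (xi : V) (th : R) j :
  smooth1 a ->
  (psi = fun x => vsub (dtt (wave a i z) t x) (Kdelta kappa alpha chi delta (wave a i z t) x)) ->
  intR (fun x => tnth (psi x) j * cos (dot x xi + th)) =
  if j == i then fcosv b xi * cos (dot z xi + th) * (derive1 (derive1 a) t + symbol xi * a t) else 0.
Proof.
move=> sa ->.
set c := kappa / powR delta (2 * (1 - alpha)).
rewrite (_ : (fun x => _) = if j == i then (fun x => derive1 (derive1 a) t * (bumpv b z x * cos (dot x xi + th)) +
    (c * a t) * (K0 alpha delta chi b z x * cos (dot x xi + th))) else fun=> 0); last first.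
  apply/funext => x; rewrite tnth_vsub tnth_Kdelta_wave tnth_dtt// -/c.
  case: (j == i); last by rewrite subr0 mul0r.
  by rewrite /tensor -/(bumpv b z x); ring.
case: (j == i); last first.
  rewrite intR_mud; last exact: intg0.
  by rewrite /Rintegral integral0_eq.
have I1 := intg_bumpv_cos z xi th eb.
have [I2 E2] := fourier_K0 alpha01 delta0 mchi chi01 chi_supp z eb xi th.
rewrite intR_mud; last by apply: intgD; exact: intgZl.
rewrite RintegralD//; try exact: intgZl.
rewrite !RintegralZl// E2 (Rintegral_bumpv_cos eb) /symbol -/c; ring.
Qed.

(** The translation [z] appears only in the two trigonometric factors, the transform of an even bump
    being real. Varying [z] therefore produces a full Fourier transform in [xi] of one fixed
    function. *)
Definition pairint (Ure Uim : R -> V -> V) (a : R -> R) (i : 'I_d) (z : V) (t : R) (xi : V) : R :=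
  fnorm R d * fcosv b xi * (derive1 (derive1 a) t + symbol xi * a t) *
    (tnth (Ure t xi) i * cos (dot z xi) - tnth (Uim t xi) i * sin (dot z xi)).

Lemma pairing_wave (Ure Uim : R -> V -> V) a i z t : smooth1 a ->
  pairing (Ure t) (Uim t)
    (fun x => vsub (dtt (wave a i z) t x) (Kdelta kappa alpha chi delta (wave a i z t) x)) =
  intR (pairint Ure Uim a i z t).
Proof.
move=> sa; congr intR; apply/funext => xi.
have FC j : fourC (fun x => vsub (dtt (wave a i z) t x) (Kdelta kappa alpha chi delta (wave a i z t) x)) j xi =
   if j == i then fnorm R d * (fcosv b xi * cos (dot z xi) * (derive1 (derive1 a) t + symbol xi * a t)) else 0.
  rewrite /fourC.
  have -> : (fun x => tnth (vsub (dtt (wave a i z) t x) (Kdelta kappa alpha chi delta (wave a i z t) x)) j * cos (dot x xi)) =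
      (fun x => tnth (vsub (dtt (wave a i z) t x) (Kdelta kappa alpha chi delta (wave a i z t) x)) j * cos (dot x xi + 0)).
    by apply/funext => x; rewrite addr0.
  rewrite (@four_wave (fun x => vsub (dtt (wave a i z) t x) (Kdelta kappa alpha chi delta (wave a i z t) x)) i a z t)// addr0.
  by case: ifP => // _; rewrite mulr0.
have FS j : fourS (fun x => vsub (dtt (wave a i z) t x) (Kdelta kappa alpha chi delta (wave a i z t) x)) j xi =
   if j == i then fnorm R d * (fcosv b xi * sin (dot z xi) * (derive1 (derive1 a) t + symbol xi * a t)) else 0.
  rewrite /fourS.
  have -> : (fun x => tnth (vsub (dtt (wave a i z) t x) (Kdelta kappa alpha chi delta (wave a i z t) x)) j * sin (dot x xi)) =
      (fun x => tnth (vsub (dtt (wave a i z) t x) (Kdelta kappa alpha chi delta (wave a i z t) x)) j * cos (dot x xi + - (pi / 2))).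
    by apply/funext => x; rewrite cosBpihalf.
  rewrite (@four_wave (fun x => vsub (dtt (wave a i z) t x) (Kdelta kappa alpha chi delta (wave a i z t) x)) i a z t)// cosBpihalf.
  by case: ifP => // _; rewrite mulr0.
rewrite (bigD1 i)//= big1 ?addr0.
  rewrite FC FS eqxx /pairint; ring.
by move=> j /negbTE ji; rewrite FC FS ji !mulr0 subrr.
Qed.

Lemma test_fun_wave a i z N : smooth1 a -> (forall t, N < `|t| -> a t = 0) -> test_fun (wave a i z).
Proof.
move=> sa a0; have [sb _ b0] := eb.
pose Z := \sum_(j < d) `|tnth z j|.
apply: (@test_fun_vtest _ _ _ _ _ (Num.max N (`|M| + Z))) => //.
- move=> j.
  have -> : (fun r => b (r - tnth z j)) = fun r => b (1 * r + (- tnth z j)).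
    by apply/funext => r; rewrite mul1r.
  exact: smooth1_affine.
- by move=> t; rewrite gt_max => /andP[h _]; exact: a0.
- move=> j r; rewrite gt_max => /andP[_ h]; apply: b0.
  have zj : `|tnth z j| <= Z by rewrite /Z (bigD1 j)//= lerDl sumr_ge0.
  have := lerB_dist r (tnth z j); have := ler_norm M.
  move: h zj; lra.
Qed.

End Pairing.

(** * Uniqueness for the Fourier transform *)

Section Fejer.
Variable R : realType.
Local Notation leb := (@lebesgue_measure R).

Lemma intg_oneDsqrV : intg leb (fun t : R => (oneDsqr t)^-1).
Proof.
have mo : measurable_fun setT (fun t : R => ((oneDsqr t)^-1)%:E).
  apply/measurable_EFinP; apply: continuous_measurable_fun; exact: continuous_oneDsqrV.
have o0 (t : R) : (0 <= ((oneDsqr t)^-1)%:E)%E by rewrite lee_fin invr_ge0 (le_trans _ (oneDsqr_ge1 t)).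
apply/integrableP; split => //.
have h0 : (\int[leb]_(t in `[0%R, +oo[) ((oneDsqr t)^-1)%:E < +oo)%E.
  by rewrite integral0y_oneDsqr ltry.
have -> : (\int[leb]_t `|(EFin \o (fun t : R => (oneDsqr t)^-1%R)) t| = \int[leb]_t ((oneDsqr t)^-1)%:E)%E.
  by apply: eq_integral => t _; rewrite gee0_abs//; exact: o0.
have -> : [set: R] = `]-oo, 0] `|` `]0, +oo[.
  by apply/seteqP; split => // x _ /=; rewrite !in_itv/= andbT; case: (leP x 0); [left|right].
rewrite ge0_integral_setU//=.
- apply: lte_add_pinfty.
    move: h0; rewrite ge0_integration_by_substitution0//.
    by under eq_integral do rewrite /oneDsqr sqrrN.
  apply: le_lt_trans h0; apply: ge0_subset_integral => //=.
    exact: measurable_funS mo.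
  by move=> x /=; rewrite !in_itv/= !andbT; exact: ltW.
- exact: measurable_funS mo.
- rewrite disj_set2E; apply/eqP; rewrite -subset0 => x []/=.
  by rewrite !in_itv/= andbT => h; rewrite ltNge h.
Qed.

(** The Fejér kernel up to normalisation. Its value at [t = 0] is 0 by the convention on division,
    which integrals do not see. *)
Definition fej (a t : R) : R := (1 - cos (a * t)) / t ^+ 2.

Lemma fej_ge0 a t : 0 <= fej a t.
Proof. by rewrite /fej divr_ge0 ?sqr_ge0// subr_ge0 cos_le1. Qed.

Lemma measurable_fej a : measurable_fun setT (fej a).
Proof.
apply: measurable_funM.
  apply: measurable_funB => //; apply: (measurableT_comp (@measurable_cos R)).
  exact: measurable_funM.
rewrite (_ : (fun x => _) = fun x : R => powR (x ^+ 2) (-1)).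
  by apply: (measurableT_comp (measurable_powR (-1))); exact: measurable_funX.
by apply/funext => x; rewrite powR_inv1 // sqr_ge0.
Qed.

Lemma intg_fej a : intg leb (fej a).
Proof.
apply: (@intg_le _ _ _ leb _ (fun t : R => (a ^+ 2 / 2 + 2) * (oneDsqr t)^-1)).
- exact: measurable_fej.
- move=> t; rewrite (ger0_norm (fej_ge0 _ _)) /fej.
  have o0 : 0 < oneDsqr t by rewrite (lt_le_trans _ (oneDsqr_ge1 t)).
  rewrite ler_pdivlMr//.
  have c1 : 1 - cos (a * t) <= 2 by have := cos_geN1 (a * t); lra.
  have c0 : 0 <= 1 - cos (a * t) by rewrite subr_ge0 cos_le1.
  have [->|t0] := eqVneq t 0.
    by rewrite expr0n invr0 mulr0 mul0r; have := sqr_ge0 a; lra.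
  have t2 : 0 < t ^+ 2 by rewrite exprn_even_gt0.
  have -> : (1 - cos (a * t)) / t ^+ 2 * oneDsqr t = (1 - cos (a * t)) / t ^+ 2 + (1 - cos (a * t)).
    by rewrite /oneDsqr; field.
  apply: lerD => //; rewrite ler_pdivrMr//; apply: le_trans (cos_ge _) _.
  by rewrite exprMn; lra.
- by apply: intgZl; exact: intg_oneDsqrV.
Qed.

(** This number is [pi]; the argument divides by it, for which [fejI_gt0] suffices. *)
Definition fejI : R := Rintegral leb setT (fej 1).

(** Dilation invariance gives homogeneity of degree 1, and evenness of the cosine gives the absolute
    value. The kink of [|a|] is what piecewise linear functions such as [trap] are assembled
    from. *)
Lemma Rintegral_fej a : Rintegral leb setT (fej a) = `|a| * fejI.
Proof.
have pos c : 0 < c -> Rintegral leb setT (fej c) = c * fejI.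
  move=> c0.
  have H := ge0_integral_dilate (f := fun t => (fej 1 t)%:E) c0 (proj2 (measurable_EFinP _ _) (measurable_fej 1)) (fun t => fej_ge0 1 t).
  have E : (\int[leb]_t (fej c t)%:E = (c ^+ 2)%:E * \int[leb]_t (fej 1 (c * t))%:E)%E.
    rewrite -ge0_integralZl//.
    - apply: eq_integral => t _; rewrite -EFinM; congr EFin; rewrite /fej mul1r.
      have [->|t0] := eqVneq t 0; first by rewrite !mulr0 cos0 subrr !mul0r mulr0.
      by field; rewrite t0 gt_eqF.
    - apply/measurable_EFinP; apply: (measurableT_comp (measurable_fej 1)).
      exact: measurable_funM.
    - by move=> t _; rewrite lee_fin fej_ge0.
    - by rewrite lee_fin sqr_ge0.
  rewrite /Rintegral E expr2 EFinM -muleA H -/(Rintegral _ _ _).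
  by rewrite fineM//; exact: integrable_fin_num (intg_fej 1).
have [a0|a0|->] := ltgtP a 0.
- rewrite ltr0_norm// -pos ?oppr_gt0//; apply: eq_Rintegral => t _.
  by rewrite /fej mulNr cosN.
- by rewrite gtr0_norm// pos.
- rewrite normr0 mul0r /Rintegral integral0_eq// => t _.
  by rewrite /fej mul0r cos0 subrr mul0r.
Qed.

Lemma fejI_gt0 : 0 < fejI.
Proof.
(* On this interval the cosine is nonpositive, since [pi / 2 < 2] and [3 <= 3 * pi / 2], and
   [t ^ 2 <= 9]; hence the kernel is at least 1/9 there. *)
pose A : set R := `[2, 3]%classic.
have mA : measurable A by exact: measurable_itv.
have lA : leb A = 1%:E.
  by rewrite /A lebesgue_measure_itv/= lte_fin ifT; [rewrite -EFinB; congr EFin; lra|lra].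
have IA : intg leb (fun x => \1_A x).
  apply/integrableP; split; first by apply/measurable_EFinP; exact: measurable_indic.
  under eq_integral do rewrite /= ger0_norm//.
  by rewrite integral_indic// setIT [X in (X < _)%E]lA ltry.
apply: (@lt_le_trans _ _ (Rintegral leb setT (fun x => 9^-1 * \1_A x))).
  rewrite RintegralZl// mulr_gt0// /Rintegral integral_indic// setIT.
  by rewrite [X in fine X]lA.
apply: le_Rintegral => //; [exact: intgZl|exact: intg_fej|].
move=> x _; rewrite indicE; case: (boolP (x \in A)) => h /=; last by rewrite mulr0 fej_ge0.
move: h; rewrite inE /A /= in_itv/= => /andP[h1 h2].
have c0 : cos x <= 0.
  have -> : cos x = - cos (x - pi) by rewrite cosB cospi sinpi mulrN1 mulr0 addr0 opprK.
  rewrite oppr_le0; apply: cos_ge0_pihalf.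
  have := pihalf_lt2 R; have := pihalf_ge1 R.
  move=> k1 k2; apply/andP; split; lra.
rewrite mulr1 /fej mul1r.
have x2 : 0 < x ^+ 2 by rewrite exprn_gt0//; lra.
rewrite ler_pdivlMr//.
have : x ^+ 2 <= 9 by rewrite expr2 (_ : 9 = 3 * 3); [apply: ler_pM; lra|ring].
lra.
Qed.

(* For [0 <= q < p] this is a trapezoid in [e], equal to [2 (p - q)] on [[-q, q]] and to [0]
   outside [[-p, p]]; by [\int fej a = `|a| fejI] its Fourier transform is [trapk p q] up to [fejI]. *)
Definition trap (p q e : R) : R := `|e + p| + `|e - p| - `|e + q| - `|e - q|.

Definition trapk (p q t : R) : R := 2 * (fej p t - fej q t).

Lemma intg_trapk p q : intg leb (trapk p q).
Proof. by apply: intgZl; apply: intgB; exact: intg_fej. Qed.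

Lemma trapk_even p q t : trapk p q (- t) = trapk p q t.
Proof. by rewrite /trapk /fej !mulrN !cosN sqrrN. Qed.

Lemma Rintegral_trapk p q e th :
  Rintegral leb setT (fun t => trapk p q t * cos (t * e + th)) = fejI * trap p q e * cos th.
Proof.
have Ik := intg_trapk p q.
transitivity (Rintegral leb setT (fun t => trapk p q t * cos (t * e + 0) * cos th - trapk p q t * sin (t * e + 0) * sin th)).
  by apply: eq_Rintegral => t _; rewrite addr0 cosD; ring.
have I1 := intg_mul_cos e 0 Ik.
have I2 := intg_mul_sin e 0 Ik.
rewrite RintegralB//; last 2 first.
- by apply: (@intgMb _ _ _ leb `|cos th| _ (fun=> cos th)).
- by apply: (@intgMb _ _ _ leb `|sin th| _ (fun=> sin th)).
rewrite !RintegralZr// (@Rintegral_odd _ (fun t => trapk p q t * sin (t * e + 0)))//; last first.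
  by move=> t; rewrite trapk_even !addr0 mulNr sinN mulrN.
rewrite mul0r subr0; congr (_ * _).
transitivity (Rintegral leb setT (fun t => (fej (e + p) t + fej (e - p) t) - (fej (e + q) t + fej (e - q) t))).
  apply: eq_Rintegral => t _; rewrite addr0 /trapk /fej.
  have cD s : cos ((e + s) * t) = cos (e * t) * cos (s * t) - sin (e * t) * sin (s * t).
    by rewrite mulrDl cosD.
  have cB s : cos ((e - s) * t) = cos (e * t) * cos (s * t) + sin (e * t) * sin (s * t).
    by rewrite mulrDl cosD mulNr cosN sinN mulrN opprK.
  by rewrite !cB !cD (mulrC t e); ring.
have If a := intg_fej a.
rewrite RintegralB//; try exact: intgD.
rewrite !RintegralD// !Rintegral_fej /trap; ring.
Qed.

Lemma trap_in p q e : q <= p -> `|e| <= q -> trap p q e = 2 * (p - q).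
Proof.
move=> qp; rewrite ler_norml => /andP[h1 h2]; rewrite /trap.
have -> : `|e + p| = e + p by rewrite ger0_norm//; lra.
have -> : `|e + q| = e + q by rewrite ger0_norm//; lra.
have -> : `|e - p| = p - e by rewrite ler0_norm; lra.
have -> : `|e - q| = q - e by rewrite ler0_norm; lra.
lra.
Qed.

Lemma trap_out p q e : q <= p -> p <= `|e| -> 0 <= q -> trap p q e = 0.
Proof.
move=> qp; rewrite /trap; have [e0|e0] := leP 0 e => h q0.
  rewrite ger0_norm// in h.
  have -> : `|e + p| = e + p by rewrite ger0_norm//; lra.
  have -> : `|e + q| = e + q by rewrite ger0_norm//; lra.
  have -> : `|e - p| = e - p by rewrite ger0_norm//; lra.
  have -> : `|e - q| = e - q by rewrite ger0_norm//; lra.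
  lra.
rewrite ltr0_norm// in h.
have -> : `|e + p| = - (e + p) by rewrite ler0_norm//; lra.
have -> : `|e + q| = - (e + q) by rewrite ler0_norm//; lra.
have -> : `|e - p| = - (e - p) by rewrite ler0_norm//; lra.
have -> : `|e - q| = - (e - q) by rewrite ler0_norm//; lra.
lra.
Qed.

Lemma norm_trap_le p q e : `|trap p q e| <= 2 * `|p - q|.
Proof.
have h1 := ler_dist_dist (e + p) (e + q).
have h2 := ler_dist_dist (e - p) (e - q).
have E1 : (e + p) - (e + q) = p - q by ring.
have E2 : (e - p) - (e - q) = - (p - q) by ring.
rewrite E1 in h1; rewrite E2 normrN in h2.
have -> : trap p q e = (`|e + p| - `|e + q|) + (`|e - p| - `|e - q|) by rewrite /trap; ring.
by apply: le_trans (ler_normD _ _) _; lra.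
Qed.

Lemma measurable_trap p q c : measurable_fun setT (fun x : R => trap p q (x - c)).
Proof.
have m (s : R) : measurable_fun setT (fun x : R => `|x - c + s|).
  by apply: measurableT_comp => //; apply: measurable_funD => //; exact: measurable_funB.
apply: measurable_funB; last exact: m.
by apply: measurable_funB; [apply: measurable_funD; exact: m|exact: m].
Qed.

End Fejer.

(** * Functions whose integral over every box vanishes *)

Section BoxUniqueness.
Variable R : realType.
Variable d : nat.
Local Notation V := (d.-tuple R).
Local Notation mu := (@mud R d).

Definition box (ab : 'I_d -> R * R) : set V := [set x | forall j, (ab j).1 <= tnth x j <= (ab j).2].

Definition boxes : set (set V) := [set A | exists ab, A = box ab].

Lemma measurable_box ab : measurable (box ab).
Proof.
rewrite (_ : box ab = \big[setI/setT]_(i < d) ((@tnth d R)^~ i @^-1` `[(ab i).1, (ab i).2]%classic)).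
  apply: bigsetI_measurable => i _; rewrite -[X in measurable X]setTI.
  exact: measurable_tnth.
rewrite -bigcap_seq; apply/seteqP; split => x /= H.
  by move=> i _; rewrite /= in_itv/=.
by move=> i; have := H i (mem_index_enum i); rewrite /= in_itv/=.
Qed.

Lemma boxes_setI : setI_closed boxes.
Proof.
move=> _ _ [ab ->] [cd ->].
exists (fun j => (Num.max (ab j).1 (cd j).1, Num.min (ab j).2 (cd j).2)).
apply/seteqP; split => x /=.
  by move=> [h1 h2] j; rewrite /= ge_max le_min; have /andP[-> ->] := h1 j; have /andP[-> ->] := h2 j.
move=> h; split => j; have := h j; rewrite /= ge_max le_min => /andP[/andP[h1 h2] /andP[h3 h4]].
  by rewrite h1 h3.
by rewrite h2 h4.
Qed.

Lemma bigcup_boxes : \bigcup_n box (fun=> (- n%:R, n%:R)) = [set: V].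
Proof.
apply/seteqP; split => // x _.
exists (Num.bound (\sum_(i < d) `|tnth x i|)) => // i /=.
rewrite -ler_norml; apply: (@le_trans _ _ (\sum_(i < d) `|tnth x i|)).
  by rewrite (bigD1 i)//= lerDl sumr_ge0.
by apply: ltW; apply: archi_boundP; exact: sumr_ge0.
Qed.

Lemma measurable_boxes : @measurable _ V = <<s boxes >>.
Proof.
apply/seteqP; split => [A mA|]; last first.
  by apply: smallest_sub; [exact: sigma_algebra_measurable|move=> _ [ab ->]; exact: measurable_box].
have H : measurable_fun setT (id : g_sigma_algebraType boxes -> V).
  apply/measurable_fun_tnthP => i.
  apply: (measurability _ (RGenCInfty.measurableE R)) => _ [_ [a ->] <-].
  rewrite setTI.
  rewrite (_ : _ @^-1` _ = \bigcup_n box (fun j => if j == i then (a, n%:R) else (- n%:R, n%:R))).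
    by apply: bigcupT_measurable => n; apply: sub_sigma_algebra; eexists.
  apply/seteqP; split => x /=; last first.
    by move=> [n _ /(_ i)]; rewrite eqxx/= in_itv/= andbT => /andP[].
  rewrite in_itv/= andbT => ax.
  have : [set: V] x by [].
  rewrite -bigcup_boxes => -[n _ hn]; exists n => // j.
  by have /= := hn j; case: eqP => [->|//] /= /andP[_ ->]; rewrite ax.
by have := H measurableT A mA; rewrite setTI.
Qed.

(** Dynkin's theorem: boxes are stable under intersection and generate the measurable sets. Closure
    under complement needs the integral over the whole space to vanish, which follows by exhausting
    the space with boxes. *)
Lemma box_zero_ae (W : V -> R) : intg mu W ->
  (forall ab, Rintegral mu (box ab) W = 0) -> {ae mu, forall x, W x = 0}.
Proof.
move=> IW H0.
have fin A : measurable A -> (\int[mu]_(x in A) (W x)%:E)%E \is a fin_num.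
  by move=> mA; apply: integrable_fin_num => //; exact: integrableS IW.
have IA A : measurable A -> mu.-integrable A (EFin \o W) by move=> mA; exact: integrableS IW.
have HT : Rintegral mu setT W = 0.
  pose f_ n x := W x * \1_(box (fun=> (- n%:R, n%:R))) x.
  have mf n : measurable_fun setT (f_ n).
    apply: measurable_funM; first exact: intg_measurable IW.
    by apply: measurable_indic; exact: measurable_box.
  have [_ c] : intg mu W /\ Rintegral mu setT (f_ n) @[n --> \oo] --> Rintegral mu setT W.
    apply: (dominated_Rintegral (h := fun x => `|W x|)) => //.
    - move=> x; have : [set: V] x by [].
      rewrite -bigcup_boxes => -[n _ hn].
      apply: (@cvg_trans _ (W x @[n --> \oo])); last exact: cvg_cst.
      apply: near_eq_cvg; near=> m; rewrite /f_ indicE mem_set ?mulr1// => j /=.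
      have nm : n%:R <= m%:R :> R by rewrite ler_nat; near: m; exact: nbhs_infty_ge.
      have /= /andP[h1 h2] := hn j.
      by apply/andP; split; lra.
    - exact: intg_norm.
    - by move=> n x; rewrite /f_ normrM indicE; case: (_ \in _); rewrite /= ?normr1 ?normr0 ?mulr1 ?mulr0.
  rewrite -(cvg_lim _ c)//.
  have E n : Rintegral mu setT (f_ n) = 0.
    rewrite -(H0 (fun=> (- n%:R, n%:R))) [RHS]Rintegral_mkcond; apply: eq_Rintegral => x _.
    by rewrite /f_ patchE indicE; case: ifP => _; rewrite ?mulr1 ?mulr0.
  by under eq_fun do rewrite E; rewrite lim_cst.
have HS S : measurable S -> Rintegral mu S W = 0.
  rewrite measurable_boxes => mS.
  apply: (@dynkin_induction _ _ boxes (fun S => Rintegral mu S W = 0)) mS => //.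
  - exact: measurable_boxes.
  - exact: boxes_setI.
  - by move=> _ [ab ->].
  - move=> A mA HA.
    have := @Rintegral_setU _ _ _ mu A (~` A) W mA (measurableC mA).
    rewrite setUv => /(_ IW); rewrite HT HA add0r => -> //.
    by rewrite disj_set2E setICr.
  - move=> F mF tF HF.
    rewrite /Rintegral integral_bigcup//; last by apply: IA; exact: bigcup_measurable.
    rewrite eseries0// => k _ _.
    by rewrite -[LHS]fineK ?fin//; congr EFin; exact: HF.
have := @integral_ae_eq _ _ _ mu setT measurableT (cst 0%E) (EFin \o W) IW (measurable_cst _).
move=> /(_ _)/wrap[].
  move=> E _ mE; rewrite integral0 -[LHS]fineK ?fin//; congr EFin; exact: HS.
by move=> H; apply: filterS H => x /(_ I) /= [].
Unshelve. all: by end_near. Qed.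

End BoxUniqueness.

(** * An integrable function with zero Fourier transform vanishes almost everywhere *)

Section FourierUniqueness.
Variable R : realType.
Variable d : nat.
Local Notation V := (d.-tuple R).
Local Notation mu := (@mud R d).
Local Notation leb := (@lebesgue_measure R).

Lemma intg_tensor d1 d2 (T1 : measurableType d1) (T2 : measurableType d2)
    (m1 : {sigma_finite_measure set T1 -> \bar R}) (m2 : {sigma_finite_measure set T2 -> \bar R}) f g :
  intg m1 f -> intg m2 g -> intg (m1 \x m2)%E (fun p => f p.1 * g p.2).
Proof.
move=> If Ig.
have mf := intg_measurable If; have mg := intg_measurable Ig.
apply/intg_prodP.
  apply: measurable_funM; first by apply: (measurableT_comp mf); exact: measurable_fst.
  by apply: (measurableT_comp mg); exact: measurable_snd.
have Ng := intg_norm Ig; have Nf := intg_norm If.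
have -> : (\int[m1]_x \int[m2]_y (`|f (x, y).1 * g (x, y).2|)%:E =
  \int[m1]_x ((`|f x|)%:E * \int[m2]_y (`|g y|)%:E))%E.
  apply: eq_integral => x _ /=.
  under eq_integral do rewrite normrM EFinM.
  by rewrite ge0_integralZl//; apply/measurable_EFinP; exact: measurableT_comp.
rewrite ge0_integralZr//; last 2 first.
- by apply/measurable_EFinP; exact: measurableT_comp.
- exact: integral_ge0.
have := integrable_fin_num measurableT Nf; have := integrable_fin_num measurableT Ng.
by move=> h1 h2; apply: lte_mul_pinfty; rewrite ?integral_ge0// ltey_eq h1.
Qed.

Definition trapv (k : nat) (c p q : 'I_d -> R) (xi : V) : R :=
  \prod_(j < d | (j < k)%N) trap (p j) (q j) (tnth xi j - c j).

Definition tail (k : nat) (z : 'I_d -> R) (xi : V) : R := \sum_(j < d | (k <= j)%N) z j * tnth xi j.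

Lemma measurable_trapv k c p q : measurable_fun setT (trapv k c p q).
Proof.
have -> : trapv k c p q = fun xi => \prod_(j <- enum 'I_d | (j < k)%N) trap (p j) (q j) (tnth xi j - c j).
  by apply/funext => xi; rewrite big_enum_cond.
elim: (enum 'I_d) => [|j e IH].
  by under eq_fun do rewrite big_nil; exact: measurable_cst.
under eq_fun do rewrite big_cons.
have [jk|jk] := boolP (j < k)%N; last exact: IH.
apply: measurable_funM => //.
apply: (measurableT_comp (measurable_trap (p j) (q j) (c j))); exact: measurable_tnth.
Qed.

Lemma trapv_bounded k c p q : exists C, forall xi, `|trapv k c p q xi| <= C.
Proof.
exists (\prod_(j < d | (j < k)%N) (2 * `|p j - q j|)) => xi.
by rewrite normr_prod; apply: ler_prod => j _; rewrite normr_ge0 norm_trap_le.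
Qed.

Lemma measurable_tail k z : measurable_fun setT (tail k z).
Proof.
have -> : tail k z = fun xi => \sum_(j <- enum 'I_d) (if (k <= j)%N then z j * tnth xi j else 0).
  by apply/funext => xi; rewrite big_enum -big_mkcond.
apply: measurable_sum => j; have [kj|kj] := boolP (k <= j)%N => //.
by apply: measurable_funM => //; exact: measurable_tnth.
Qed.

Variables Wre Wim : V -> R.
Hypothesis Ire : intg mu Wre.
Hypothesis Iim : intg mu Wim.
Hypothesis Wre_vopp : forall xi, Wre (vopp xi) = Wre xi.
Hypothesis Wim_vopp : forall xi, Wim (vopp xi) = - Wim xi.
Hypothesis W0 : forall z, Rintegral mu setT (fun xi => Wre xi * cos (dot z xi) - Wim xi * sin (dot z xi)) = 0.

(** The real part of [(Wre + i Wim) e^(i A)]. *)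
Definition phase (A : R) (xi : V) : R := Wre xi * cos A - Wim xi * sin A.

Lemma norm_phase_le A xi : `|phase A xi| <= `|Wre xi| + `|Wim xi|.
Proof.
apply: le_trans (ler_normB _ _) _; rewrite !normrM.
by apply: lerD; rewrite ler_piMr ?norm_cos_le1 ?norm_sin_le1.
Qed.

(** [W0] concerns the real part of the transform. The imaginary part vanishes because its integrand
    is odd, by the symmetry of [Wre] and [Wim], so any constant phase may be added. *)
Lemma phase0 z th : Rintegral mu setT (fun xi => phase (dot z xi + th) xi) = 0.
Proof.
have md : measurable_fun setT (fun xi : V => dot z xi).
  by apply: measurable_dot => //; exact: measurable_cst.
have mc : measurable_fun setT (fun xi : V => cos (dot z xi)) by exact: (measurableT_comp (@measurable_cos R)).
have ms : measurable_fun setT (fun xi : V => sin (dot z xi)) by exact: (measurableT_comp (@measurable_sin R)).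
have I1 : intg mu (fun xi => Wre xi * cos (dot z xi)) by apply: (intgMb (C := 1)) => // x; exact: norm_cos_le1.
have I2 : intg mu (fun xi => Wim xi * sin (dot z xi)) by apply: (intgMb (C := 1)) => // x; exact: norm_sin_le1.
have I3 : intg mu (fun xi => Wre xi * sin (dot z xi)) by apply: (intgMb (C := 1)) => // x; exact: norm_sin_le1.
have I4 : intg mu (fun xi => Wim xi * cos (dot z xi)) by apply: (intgMb (C := 1)) => // x; exact: norm_cos_le1.
transitivity (Rintegral mu setT (fun xi =>
   cos th * (Wre xi * cos (dot z xi) - Wim xi * sin (dot z xi)) -
   sin th * (Wre xi * sin (dot z xi) + Wim xi * cos (dot z xi)))).
  by apply: eq_Rintegral => xi _; rewrite /phase cosD sinD; ring.
have I5 : intg mu (fun xi => Wre xi * sin (dot z xi) + Wim xi * cos (dot z xi)) by exact: intgD.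
rewrite RintegralB//; [|by apply: intgZl; exact: intgB|exact: intgZl].
rewrite !RintegralZl//; last exact: intgB.
rewrite W0 (Rintegral_mud_odd I5) ?mulr0 ?subrr// => xi.
have -> : dot z (vopp xi) = - dot z xi.
  by rewrite /dot -sumrN; apply: eq_bigr => j _; rewrite tnth_vopp mulrN.
rewrite Wre_vopp Wim_vopp sinN cosN; ring.
Qed.

(* Induction on the number of frequencies already localised: integrating against [trapk] in
   the [k]-th component of [z] turns the oscillation in [xi_k] into a trapezoid factor. *)
Lemma phase_trapv k : (k <= d)%N -> forall c p q z th,
  Rintegral mu setT (fun xi => trapv k c p q xi * phase (tail k z xi + th) xi) = 0.
Proof.
elim: k => [|k IH] kd c p q z th.
  rewrite -[RHS](phase0 [tuple z j | j < d] th); apply: eq_Rintegral => xi _.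
  rewrite /trapv big_pred0// mul1r; congr (phase (_ + _) _).
  by apply: eq_bigr => j _; rewrite tnth_mktuple.
pose jk : 'I_d := Ordinal kd.
pose K := trapk (p jk) (q jk).
pose e xi := tnth xi jk - c jk.
pose A xi := tail k.+1 z xi + th.
pose T := trapv k c p q.
have [C hC] := trapv_bounded k c p q.
have IK : intg leb K := intg_trapk _ _.
pose F (x : R * V) := K x.1 * (T x.2 * phase (x.1 * e x.2 + A x.2) x.2).
have mA : measurable_fun setT A by apply: measurable_funD => //; exact: measurable_tail.
have me : measurable_fun setT e by apply: measurable_funB => //; exact: measurable_tnth.
have mT : measurable_fun setT T by exact: measurable_trapv.
have mph : measurable_fun setT (fun x : R * V => x.1 * e x.2 + A x.2).
  apply: measurable_funD; last by apply: measurableT_comp => //; exact: measurable_snd.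
  apply: measurable_funM; first exact: measurable_fst.
  by apply: measurableT_comp => //; exact: measurable_snd.
have m2 (f : V -> R) : measurable_fun setT f -> measurable_fun setT (fun x : R * V => f x.2).
  by move=> mf; apply: (measurableT_comp mf); exact: measurable_snd.
have mF : measurable_fun setT F.
  apply: measurable_funM.
    by apply: (measurableT_comp (intg_measurable IK)); exact: measurable_fst.
  apply: measurable_funM; first exact: m2.
  apply: measurable_funB.
    apply: measurable_funM; first by apply: m2; exact: intg_measurable Ire.
    exact: (measurableT_comp (@measurable_cos R)).
  apply: measurable_funM; first by apply: m2; exact: intg_measurable Iim.
  exact: (measurableT_comp (@measurable_sin R)).
have IF : intg (leb \x mu)%E F.
  apply: (@intg_le _ _ _ (leb \x mu)%E F (fun x => `|K x.1| * (C * (`|Wre x.2| + `|Wim x.2|)))) => //.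
    move=> x; rewrite /F !normrM ler_wpM2l// ler_pM// ?norm_phase_le// hC//.
  apply: (intg_tensor (m1 := leb) (m2 := mu) (f := fun t => `|K t|) (g := fun xi => C * (`|Wre xi| + `|Wim xi|))).
    exact: intg_norm.
  by apply: intgZl; apply: intgD; exact: intg_norm.
have := RFubini IF.
have -> : Rintegral leb setT (fun t => Rintegral mu setT (fun xi => F (t, xi))) = 0.
  rewrite -[RHS](_ : Rintegral leb setT (fun=> 0) = 0); last first.
    by rewrite /Rintegral integral0_eq.
  apply: eq_Rintegral => t _.
  (* For fixed [t] the induction hypothesis applies with [t] as the [jk]-th component of [z]; the
     centre [c jk] only changes the constant phase. *)
  transitivity (Rintegral mu setT (fun xi => K t * (T xi * phase (tail k (fun j => if j == jk then t else z j) xi + (th - t * c jk)) xi))).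
    apply: eq_Rintegral => xi _; rewrite /F /=; congr (_ * (_ * phase _ _)).
    rewrite /A /e /tail [in RHS](bigD1 jk)//= eqxx.
    rewrite [X in _ + (X + th) = _](_ : _ = \sum_(i < d | (k <= i)%N && (i != jk)) (if i == jk then t else z i) * tnth xi i).
      by ring.
    apply: eq_big => [i|i ki].
      by rewrite ltn_neqAle andbC (eq_sym k) -(inj_eq val_inj).
    by case: eqP => // ij; rewrite ij ltnn in ki.
  rewrite RintegralZl//; last first.
    apply: (@intg_le _ _ _ _ _ (fun xi => C * (`|Wre xi| + `|Wim xi|))).
    - apply: measurable_funM => //.
      have m3 : measurable_fun setT (fun xi => tail k (fun j => if j == jk then t else z j) xi + (th - t * c jk)).
        by apply: measurable_funD => //; exact: measurable_tail.
      apply: measurable_funB; apply: measurable_funM.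
      + exact: intg_measurable Ire.
      + exact: (measurableT_comp (@measurable_cos R)).
      + exact: intg_measurable Iim.
      + exact: (measurableT_comp (@measurable_sin R)).
    - by move=> xi; rewrite normrM ler_pM// ?norm_phase_le// hC.
    - by apply: intgZl; apply: intgD; exact: intg_norm.
  by rewrite IH ?mulr0//; exact: ltnW.
move=> /esym.
have E xi : Rintegral leb setT (fun t => F (t, xi)) = fejI R * (trapv k.+1 c p q xi * phase (A xi) xi).
  have -> : trapv k.+1 c p q xi = trap (p jk) (q jk) (e xi) * T xi.
    rewrite /trapv (bigD1 jk)//=; congr (_ * _); apply: eq_bigl => i.
    by rewrite ltnS [RHS]ltn_neqAle andbC -(inj_eq val_inj).
  (* Writing the sine as a cosine with phase shifted by [- pi / 2] lets [Rintegral_trapk] treat both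
     components. *)
  transitivity (Rintegral leb setT (fun t => (T xi * Wre xi) * (K t * cos (t * e xi + A xi)) - (T xi * Wim xi) * (K t * cos (t * e xi + (A xi - pi / 2))))).
    by apply: eq_Rintegral => t _; rewrite /F /phase /= (addrA (t * e xi) (A xi) (- (pi / 2))) cosBpihalf; ring.
  have Ic a := intg_mul_cos (e xi) a IK.
  rewrite RintegralB//; try exact: intgZl.
  rewrite !RintegralZl// !Rintegral_trapk cosBpihalf /phase; ring.
under eq_Rintegral do rewrite E.
rewrite RintegralZl//.
  by move=> /eqP; rewrite mulf_eq0 gt_eqF ?fejI_gt0//= => /eqP.
have [C' hC'] := trapv_bounded k.+1 c p q.
apply: (@intg_le _ _ _ _ _ (fun xi => C' * (`|Wre xi| + `|Wim xi|))).
- apply: measurable_funM; first exact: measurable_trapv.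
  apply: measurable_funB; apply: measurable_funM.
  + exact: intg_measurable Ire.
  + exact: (measurableT_comp (@measurable_cos R)).
  + exact: intg_measurable Iim.
  + exact: (measurableT_comp (@measurable_sin R)).
- by move=> xi; rewrite normrM ler_pM// ?norm_phase_le// hC'.
- by apply: intgZl; apply: intgD; exact: intg_norm.
Qed.

(** The indicator of a box is the limit of trapezoids with [q] equal to the half-side and slopes of
    width [1 / (n + 1)]. Their height on the box is [2 / (n + 1)] per coordinate, whence the factor
    [((n + 1) / 2) ^ d] and the majorant [|W|]. *)
Lemma trapv_zero_ae (W : V -> R) : intg mu W ->
  (forall c p q, Rintegral mu setT (fun xi => trapv d c p q xi * W xi) = 0) ->
  {ae mu, forall xi, W xi = 0}.
Proof.
move=> IW H; apply: box_zero_ae => // ab.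
have mW := intg_measurable IW.
have [ok|] := boolP [forall j, (ab j).1 <= (ab j).2]; last first.
  rewrite negb_forall => /existsP[j hj].
  rewrite (_ : box ab = set0) ?Rintegral_set0//.
  rewrite -subset0 => x /(_ j) /andP[h1 h2].
  by move: hj; rewrite (le_trans h1 h2).
have {}ok j : (ab j).1 <= (ab j).2 by move/forallP: ok.
pose r j := ((ab j).2 - (ab j).1) / 2; pose c j := ((ab j).2 + (ab j).1) / 2.
have r0 j : 0 <= r j by rewrite /r divr_ge0// subr_ge0.
have inbox x : box ab x <-> forall j, `|tnth x j - c j| <= r j.
  split=> h j; have := h j; rewrite ler_norml /c /r; first by move=> /andP[h1 h2]; apply/andP; split; lra.
  by move=> /andP[h1 h2]; apply/andP; split; lra.
pose p (n : nat) j := r j + n.+1%:R^-1.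
pose f_ n x := (n.+1%:R / 2) ^+ d * (trapv d c (p n) r x * W x).
have fac n x : (n.+1%:R / 2) ^+ d * trapv d c (p n) r x = \prod_(j < d) ((n.+1%:R / 2) * trap (p n j) (r j) (tnth x j - c j)).
  rewrite big_split/= prodr_const card_ord; congr (_ * _).
  by apply: eq_bigl => j; rewrite ltn_ord.
have n0 n : n.+1%:R != 0 :> R by rewrite pnatr_eq0.
have pr n j : p n j - r j = n.+1%:R^-1 by rewrite /p; ring.
have rp n j : r j <= p n j by rewrite -subr_ge0 pr invr_ge0.
have [_ cv] : intg mu (fun x => \1_(box ab) x * W x) /\
    Rintegral mu setT (f_ n) @[n --> \oo] --> Rintegral mu setT (fun x => \1_(box ab) x * W x).
  apply: (dominated_Rintegral (h := fun x => `|W x|)).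
  - move=> n; apply: measurable_funM => //; apply: measurable_funM => //; exact: measurable_trapv.
  - move=> x; have [hb|hb] := pselect (box ab x).
      apply: (@cvg_trans _ (W x @[n --> \oo])); last by rewrite indicE mem_set// mul1r; exact: cvg_cst.
      apply: near_eq_cvg; near=> n.
      rewrite /f_ mulrA fac big1 ?mul1r// => j _.
      rewrite trap_in//; last by move/inbox: hb.
      by rewrite pr; field; rewrite addrC natr1.
    rewrite indicE memNset// mul0r.
    apply: (@cvg_trans _ ((0 : R) @[n --> \oo])); last exact: cvg_cst.
    have /existsNP[j /negP hj] : ~ forall j, `|tnth x j - c j| <= r j by move/inbox.
    rewrite -ltNge -subr_gt0 in hj.
    apply: near_eq_cvg; near=> n.
    rewrite /f_ mulrA fac (bigD1 j)//= trap_out ?mulr0 ?mul0r//.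
    rewrite /p -lerBrDl; apply: ltW; near: n; exact: near_infty_natSinv_lt (PosNum hj).
  - exact: intg_norm.
  - move=> n x; rewrite /f_ mulrA normrM ler_piMl// fac normr_prod.
    apply: Num.Theory.prodr_ile1 => j _; rewrite normr_ge0/= normrM.
    apply: le_trans (ler_wpM2l _ (norm_trap_le _ _ _)) _ => //.
    rewrite pr !ger0_norm// ?invr_ge0//.
    by rewrite le_eqVlt; apply/orP; left; apply/eqP; field; rewrite addrC natr1.
have z n : Rintegral mu setT (f_ n) = 0.
  have [C hC] := trapv_bounded d c (p n) r.
  rewrite /f_ RintegralZl// ?H ?mulr0//.
  under eq_fun do rewrite mulrC.
  by apply: (@intgMb _ _ _ mu C W (trapv d c (p n) r)) => //; exact: measurable_trapv.
transitivity (Rintegral mu setT (fun x => \1_(box ab) x * W x)).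
  rewrite [LHS]Rintegral_mkcond; apply: eq_Rintegral => x _.
  by rewrite patchE indicE; case: ifP => _; rewrite ?mul1r ?mul0r.
rewrite -(cvg_lim _ cv)//; under eq_fun do rewrite z.
by rewrite lim_cst.
Unshelve. all: by end_near. Qed.

Lemma fourier_unique : {ae mu, forall xi, Wre xi = 0 /\ Wim xi = 0}.
Proof.
have tl z xi : tail d z xi = 0 by rewrite /tail big_pred0// => j; rewrite leqNgt ltn_ord.
have H1 : {ae mu, forall xi, Wre xi = 0}.
  apply: trapv_zero_ae => // c p q.
  rewrite -[RHS](phase_trapv (leqnn d) c p q (fun=> 0) 0); apply: eq_Rintegral => xi _.
  by rewrite tl addr0 /phase cos0 sin0 mulr1 mulr0 subr0.
have H2 : {ae mu, forall xi, Wim xi = 0}.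
  apply: trapv_zero_ae => // c p q.
  rewrite -[RHS](phase_trapv (leqnn d) c p q (fun=> 0) (- (pi / 2))); apply: eq_Rintegral => xi _.
  by rewrite tl add0r /phase cosN sinN cos_pihalf sin_pihalf; ring.
by apply: filterS2 H1 H2.
Qed.

End FourierUniqueness.

Section AlmostEverywhere.
Context dT (T : measurableType dT) (R : realType).
Variable mu : {measure set T -> \bar R}.
Implicit Types P Q S : T -> Prop.

Lemma ae_mono P Q : {ae mu, forall x, P x} -> (forall x, P x -> Q x) -> {ae mu, forall x, Q x}.
Proof. by move=> HP PQ; apply: filterS HP. Qed.

Lemma ae_mono2 P Q S : {ae mu, forall x, P x} -> {ae mu, forall x, Q x} ->
  (forall x, P x -> Q x -> S x) -> {ae mu, forall x, S x}.
Proof. by move=> HP HQ PQ; apply: filterS2 HP HQ. Qed.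

End AlmostEverywhere.

(** * The oscillator equation in the weak sense *)

Section Energy.
Variable R : realType.

Lemma derive0_interval_eq (a b : R) (f : R -> R) x y : (forall x : R, a < x < b -> is_derive x 1 f 0) ->
  a < x < b -> a < y < b -> f x = f y.
Proof.
move=> df; wlog xy : x y / x <= y.
  by move=> H hx hy; have [xy|/ltW yx] := leP x y; [exact: H|apply/esym; exact: H].
move=> /andP[ax _] /andP[_ yb].
have [c _] : exists2 c, c \in `[x, y] & f y - f x = (fun=> 0) c * (y - x).
  apply: (MVT_segment (df := fun=> 0)) => // [z|].
    by rewrite in_itv/= => /andP[h1 h2]; apply: df; apply/andP; split; lra.
  apply: derivable_within_continuous => z; rewrite in_itv/= => /andP[h1 h2].
  by have [] : is_derive z 1 f 0 by apply: df; apply/andP; split; lra.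
by rewrite mul0r => /eqP; rewrite subr_eq0 => /eqP.
Qed.

(* The energy [g1 ^ 2 + lam * g ^ 2] is constant along solutions. *)
Lemma oscillator_unique (a b c lam : R) (g g1 : R -> R) : 0 <= lam -> a < c < b ->
  (forall x : R, a < x < b -> is_derive x 1 g (g1 x)) ->
  (forall x : R, a < x < b -> is_derive x 1 g1 (- lam * g x)) ->
  g c = 0 -> g1 c = 0 -> forall x, a < x < b -> g x = 0.
Proof.
move=> lam0 hc dg dg1 gc g1c x hx.
have E y : a < y < b -> g1 y = 0.
  move=> hy.
  have : g1 y * g1 y + lam * (g y * g y) = g1 c * g1 c + lam * (g c * g c).
    apply: (@derive0_interval_eq a b (fun y => g1 y * g1 y + lam * (g y * g y))) => // z hz.
    have d1 := is_deriveM (dg1 z hz) (dg1 z hz).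
    have d2 := is_deriveZ lam (is_deriveM (dg z hz) (dg z hz)).
    have := is_deriveD d1 d2; rewrite /GRing.scale /=.
    by move/(@is_derive_eq _ _ _ _ _ _ _ _); apply; ring.
  rewrite gc g1c !mul0r mulr0 addr0 -!expr2 => H.
  have h1 := sqr_ge0 (g1 y); have h2 : 0 <= lam * g y ^+ 2 by rewrite mulr_ge0// sqr_ge0.
  by apply/eqP; rewrite -sqrf_eq0; apply/eqP; lra.
rewrite -gc; apply: (@derive0_interval_eq a b g) => // z hz.
by rewrite -(E z hz); exact: dg.
Qed.

(** As functions of [tau], both sides solve the same equation and have the same value and derivative
    at [tau = 0], so uniqueness applies to their difference [G]. The radius [r] keeps [q + x] and
    [q - x] in the interval where the equation is known. *)
Lemma oscillator_dalembert (F F1 : R -> R) (lam a b q tau : R) : 0 <= lam -> 0 <= tau ->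
  (forall x : R, is_derive x 1 F (F1 x)) ->
  (forall x : R, a < x < b -> is_derive x 1 F1 (- lam * F x)) ->
  a < q - tau -> q + tau < b ->
  F (q + tau) + F (q - tau) = 2 * cos (Num.sqrt lam * tau) * F q.
Proof.
move=> lam0 tau0 dF dF1 h1 h2; pose om := Num.sqrt lam.
have om2 : lam = om * om by rewrite -expr2 sqr_sqrtr.
pose r := Num.min (q - a) (b - q).
have rP x : - r < x < r -> [/\ a < q + x, q + x < b, a < q - x & q - x < b].
  rewrite /r ltrNl !lt_min => /andP[/andP[x1 x2] /andP[x3 x4]]; split; lra.
have daff (s x : R) (f : R -> R) (df : R) : is_derive (q + s * x) 1 f df ->
    is_derive x 1 (fun x => f (q + s * x)) (s * df).
  move=> H; have := @is_derive_affine _ f s q x df; rewrite addrC => /(_ H).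
  have -> : (fun x0 : R => f (s * x0 + q)) = (fun x => f (q + s * x)) by apply/funext => y; rewrite addrC.
  by rewrite (mulrC df).
have dcos (x : R) : is_derive x 1 (fun x => cos (om * x)) (- om * sin (om * x)).
  have := @is_derive_affine _ cos om 0 x _ (is_derive_cos _).
  have -> : (fun x0 : R => cos (om * x0 + 0)) = (fun x => cos (om * x)) by apply/funext => y; rewrite addr0.
  by rewrite addr0 mulNr (mulrC _ om) -mulNr.
have dsin (x : R) : is_derive x 1 (fun x => sin (om * x)) (om * cos (om * x)).
  have := @is_derive_affine _ sin om 0 x _ (is_derive_sin _).
  have -> : (fun x0 : R => sin (om * x0 + 0)) = (fun x => sin (om * x)) by apply/funext => y; rewrite addr0.
  by rewrite addr0 (mulrC om (cos _)).
pose G x := F (q + 1 * x) + F (q + (-1) * x) - (2 * F q) * cos (om * x).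
pose G1 x := F1 (q + 1 * x) - F1 (q + (-1) * x) + (2 * F q * om) * sin (om * x).
suff : G tau = 0 by rewrite /G mul1r mulN1r -/om; move=> /eqP; rewrite subr_eq0 => /eqP ->; ring.
have r0 : 0 <= tau < r by rewrite tau0 /r lt_min; apply/andP; split; lra.
have eqd (f : R -> R) (x u v : R) : is_derive x 1 f u -> u = v -> is_derive x 1 f v by move=> H <-.
have G0 : G 0 = 0 by rewrite /G !mulr0 addr0 cos0; ring.
have G10 : G1 0 = 0 by rewrite /G1 !mulr0 addr0 sin0; ring.
case/andP: r0 => u v.
have dG (x : R) : is_derive x 1 G (G1 x).
  apply: (eqd _ _ _ _ (is_deriveB (is_deriveD (daff 1 x F _ (dF _)) (daff (-1) x F _ (dF _))) (is_deriveZ (2 * F q) (dcos x)))).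
  by rewrite /G1 /GRing.scale /=; ring.
have dG1 (x : R) : - r < x < r -> is_derive x 1 G1 (- lam * G x).
  move=> /rP[x1 x2 x3 x4].
  have d1 : is_derive (q + 1 * x) 1 F1 (- lam * F (q + 1 * x)) by apply: dF1; rewrite mul1r x1 x2.
  have d2 : is_derive (q + -1 * x) 1 F1 (- lam * F (q + -1 * x)) by apply: dF1; rewrite mulN1r x3 x4.
  apply: (eqd _ _ _ _ (is_deriveD (is_deriveB (daff 1 x F1 _ d1) (daff (-1) x F1 _ d2)) (is_deriveZ (2 * F q * om) (dsin x)))).
  by rewrite /G /GRing.scale /= om2; ring.
have r00 : - r < 0 < r by apply/andP; split; lra.
have rt : - r < tau < r by apply/andP; split; lra.
exact: (oscillator_unique lam0 r00 (fun x _ => dG x) dG1 G0 G10 rt).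
Qed.

Lemma is_derive_sq_bound (f : R -> R) (q D C : R) :
  (forall k, `|f (q + k) - f q - D * k| <= C * k ^+ 2) -> is_derive q 1 f D.
Proof.
move=> H.
have C0 : 0 <= C by have := le_trans (normr_ge0 _) (H 1); rewrite expr1n mulr1.
have L : h^-1 *: (f (h *: 1 + q) - f q) @[h --> 0^'] --> D.
  apply/cvgrPdist_le => e e0; near=> h.
  have h0 : h != 0 by near: h; exact: nbhs_dnbhs_neq.
  rewrite scaler1 /GRing.scale/= distrC.
  have -> : h^-1 * (f (h + q) - f q) - D = h^-1 * (f (q + h) - f q - D * h).
    by rewrite (addrC h q); field.
  rewrite normrM normfV mulrC ler_pdivrMr ?normr_gt0//.
  apply: le_trans (H h) _.
  rewrite -(real_normK (num_real h)) expr2 mulrA ler_wpM2r//.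
  apply: (@le_trans _ _ ((C + 1) * `|h|)); first by rewrite ler_wpM2r// lerDl.
  rewrite -ler_pdivlMl ?ltr_wpDl// mulrC.
  near: h; apply: dnbhs0_le; by rewrite divr_gt0 // ltr_wpDl.
apply: DeriveDef; first by apply/cvg_ex; exists D.
exact: cvg_lim.
Unshelve. all: by end_near. Qed.

(** Only countably many tests can share one exceptional null set of frequencies; this recovers real
    centres from rational ones. *)
Lemma continuous_rat_eq0 (f : R -> R) (a b : R) : continuous f ->
  (forall q : rat, a < ratr q < b -> f (ratr q) = 0) -> forall x, a < x < b -> f x = 0.
Proof.
move=> cf H x /andP[ax xb]; apply/eqP; apply: contrapT => /negP fx.
have nx : \forall y \near x, f y != 0 by apply: (cvgr_neq0 _ (cf x)).
have [r /= r0 hr] := nx.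
have [q] : exists q : rat, ratr q \in `]Num.max a (x - r), Num.min b (x + r)[.
  apply: rat_in_itvoo; rewrite lt_min !gt_max; apply/andP; split; apply/andP; split; lra.
rewrite in_itv/= lt_min gt_max => /andP[/andP[aq xq] /andP[qb qx]].
have : f (ratr q) != 0 by apply: hr; rewrite /ball/= ltr_distlC; apply/andP; split; lra.
by rewrite H ?eqxx// aq qb.
Qed.

End Energy.

(** * Mollification and the oscillator equation *)

Section Mollify.
Variable R : realType.
Local Notation leb := (@lebesgue_measure R).
Variables (M : R) (Y : R -> R).
Hypothesis IY : intg leb Y.

(** The bump is centred at time [q / m]. Measuring the centre in units of [1 / m] keeps powers of
    [m] out of the derivatives in [q]. *)
Definition conv (eta : R -> R) (m q : R) : R := Rintegral leb setT (fun t => eta (m * t - q) * Y t).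

Lemma intg_conv eta m q : smooth1 eta -> (forall x, M < `|x| -> eta x = 0) ->
  intg leb (fun t => eta (m * t - q) * Y t).
Proof.
move=> se e0; have [B _ HB] := smooth_supp_bounded (smooth1_continuous se) e0.
under eq_fun do rewrite mulrC.
apply: (@intgMb _ _ _ leb B Y (fun t => eta (m * t - q))) => //.
apply: continuous_measurable_fun; apply: smooth1_continuous.
exact: (smooth1_affine m (- q) se).
Qed.

(** The Taylor remainder of [eta] is uniform in [t], so differentiation under the integral asks only
    that [Y] be integrable. *)
Lemma is_derive_conv eta m (q : R) : smooth1 eta -> (forall x, M < `|x| -> eta x = 0) ->
  is_derive q 1 (conv eta m) (- conv (derive1 eta) m q).
Proof.
move=> se e0; have se1 := smooth1_derive se.
have e1 x : M < `|x| -> derive1 eta x = 0 by exact: derive1_supp.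
have e2 x : M < `|x| -> derive1 (derive1 eta) x = 0 by exact: derive1_supp.
have [B B0 HB] := smooth_supp_bounded (smooth1_continuous (smooth1_derive se1)) e2.
apply: (@is_derive_sq_bound _ _ _ _ (B * Rintegral leb setT (fun t => `|Y t|))) => k.
have I1 := intg_conv m (q + k) se e0; have I2 := intg_conv m q se e0.
have I3 := intg_conv m q se1 e1.
have -> : conv eta m (q + k) - conv eta m q - - conv (derive1 eta) m q * k =
   Rintegral leb setT (fun t => (eta (m * t - (q + k)) * Y t - eta (m * t - q) * Y t) + k * (derive1 eta (m * t - q) * Y t)).
  rewrite RintegralD//; [|exact: intgB|exact: intgZl].
  rewrite RintegralB// RintegralZl// /conv; ring.
rewrite -mulrA (mulrC _ (k ^+ 2)) mulrA -RintegralZl//; last exact: intg_norm.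
apply: (@le_norm_Rintegral _ _ _ leb (fun t => eta (m * t - (q + k)) * Y t - eta (m * t - q) * Y t + k * (derive1 eta (m * t - q) * Y t)) (fun t => B * k ^+ 2 * `|Y t|)).
- by apply: intgZl; exact: intg_norm.
- by apply: (@intg_measurable _ _ _ leb); apply: intgD; [exact: intgB|exact: intgZl].
- move=> t.
  have -> : eta (m * t - (q + k)) * Y t - eta (m * t - q) * Y t + k * (derive1 eta (m * t - q) * Y t) =
    (eta ((m * t - q) - k) - eta (m * t - q) + derive1 eta (m * t - q) * k) * Y t.
    have -> : m * t - (q + k) = m * t - q - k by ring.
    by ring.
  by rewrite normrM ler_wpM2r// (taylor1 _ _ se HB).
Qed.

Lemma continuous_conv eta m : smooth1 eta -> (forall x, M < `|x| -> eta x = 0) -> continuous (conv eta m).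
Proof.
move=> se e0 q; apply/differentiable_continuous/derivable1_diffP.
by have [] := is_derive_conv m q se e0.
Qed.

Lemma is_derive_conv2 eta m (q : R) : smooth1 eta -> (forall x, M < `|x| -> eta x = 0) ->
  is_derive q 1 (fun q => - conv (derive1 eta) m q) (conv (derive1 (derive1 eta)) m q).
Proof.
move=> se e0; rewrite -[X in is_derive _ _ _ X]opprK.
by apply: is_deriveN; apply: is_derive_conv; [exact: smooth1_derive|move=> x; exact: derive1_supp].
Qed.

Lemma conv_dalembert eta m lam a b q tau : smooth1 eta -> (forall x, M < `|x| -> eta x = 0) ->
  0 <= lam -> 0 <= tau ->
  (forall x, a < x < b -> conv (derive1 (derive1 eta)) m x = - lam * conv eta m x) ->
  a < q - tau -> q + tau < b ->
  conv eta m (q + tau) + conv eta m (q - tau) = 2 * cos (Num.sqrt lam * tau) * conv eta m q.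
Proof.
move=> se e0 lam0 tau0 ode h1 h2.
apply: (@oscillator_dalembert _ _ (fun x => - conv (derive1 eta) m x) lam a b) => //.
  by move=> x; exact: is_derive_conv.
by move=> x hx; rewrite -ode//; exact: is_derive_conv2.
Qed.

End Mollify.

Section Approximation.
Variable R : realType.
Local Notation leb := (@lebesgue_measure R).

Lemma ge0_Rintegral_affine (c q : R) (f : R -> R) : 0 < c -> measurable_fun setT f ->
  (forall x, 0 <= f x) -> intg leb f ->
  Rintegral leb setT (fun s => f (c * s - q)) = c^-1 * Rintegral leb setT f.
Proof.
move=> c0 mf f0 If.
have mg : measurable_fun setT (fun x : R => f (x - q)).
  by apply: (measurableT_comp mf); exact: measurable_funD.
have := @ge0_integral_dilate R c (fun x => (f (x - q))%:E) c0 (proj2 (measurable_EFinP _ _) mg) (fun x => f0 _).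
rewrite (integral_shift (- q) (f := EFin \o f)); last exact/measurable_EFinP.
have fI := integrable_fin_num measurableT If.
move=> /(congr1 (fun x => (c^-1)%:E * x)%E); rewrite muleA -EFinM mulVf ?gt_eqF// mul1e => E.
rewrite /Rintegral [X in fine X = _]E fineM//.
Qed.

Lemma conv_lebesgue (Y : R -> R) (eta : R -> R) (B : R) : intg leb Y -> continuous eta -> (forall x, 1 < `|x| -> eta x = 0) ->
  (forall x, 0 <= eta x <= B) ->
  {ae leb, forall t, n.+1%:R * conv Y eta n.+1%:R (n.+1%:R * t) @[n --> \oo] --> Rintegral leb setT eta * Y t}.
Proof.
move=> IY ce e0 eB.
have mY := intg_measurable IY.
have lY : locally_integrable setT Y by apply: open_integrable_locally => //; exact: openT.
have Ieta : intg leb eta by exact: continuous_supp_intg ce e0.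
have meta := intg_measurable Ieta.
refine (@ae_mono _ _ _ leb (lebesgue_pt Y) _ (lebesgue_differentiation lY) _) => t ht.
(* The rescaled bump lives on [|s - t| <= 1 / (n + 1)], inside the open ball of twice that radius;
   the measure of this ball, [4 / (n + 1)], explains the factor 4 in [key]. *)
pose r (n : nat) : R := 2 * n.+1%:R^-1.
have r0 n : 0 < r n by rewrite mulr_gt0// invr_gt0.
have cr : r n @[n --> \oo] --> 0.
  by rewrite -[X in _ --> X](mulr0 2); apply: cvgMl_tmp; exact: cvg_harmonic.
have fd : fine (davg Y t (r n)) @[n --> \oo] --> 0.
  by apply: (proj1 (cvg_at_rightP (fine \o davg Y t) 0 0)) => //; exact: fine_cvg.
have n0 n : n.+1%:R != 0 :> R by rewrite pnatr_eq0.
have B0 : 0 <= B by case/andP: (eB 0) => u v; exact: le_trans v.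
have key n : `|n.+1%:R * conv Y eta n.+1%:R (n.+1%:R * t) - Rintegral leb setT eta * Y t| <= 4 * B * fine (davg Y t (r n)).
  pose m : R := n.+1%:R; have m0 : 0 < m by rewrite ltr0n.
  have mn0 : m != 0 by rewrite gt_eqF.
  have Ee := ge0_Rintegral_affine (m * t) m0 meta (fun x => proj1 (andP (eB x))) Ieta.
  have mA : measurable_fun setT (fun s : R => eta (m * s - m * t)).
    by apply: (measurableT_comp meta); apply: measurable_funB => //; exact: measurable_funM.
  have I1 : intg leb (fun s => eta (m * s - m * t) * Y s).
    under eq_fun do rewrite mulrC.
    apply: (@intgMb _ _ _ leb B Y (fun s => eta (m * s - m * t))) => // x.
    by case/andP: (eB (m * x - m * t)) => u v; rewrite ger0_norm.
  have I2 : intg leb (fun s => eta (m * s - m * t)).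
    apply: (@continuous_supp_intg _ (m^-1 + `|t|)).
      move=> x; apply: continuous_comp; last exact: ce.
      by apply: cvgB; [apply: cvgM; [exact: cvg_cst|exact: cvg_id]|exact: cvg_cst].
    move=> x hx; apply: e0; rewrite -mulrBr normrM gtr0_norm// -ltr_pdivrMl// mulr1.
    by apply: lt_le_trans (lerB_dist x t); rewrite ltrBrDr.
  pose A := ball t (r n).
  have mBall : measurable A by exact: measurable_ball.
  have lA : leb A = (r n *+ 2)%:E by apply: lebesgue_measure_ball; exact: ltW.
  have IC : leb.-integrable A (EFin \o (fun s => Y s - Y t)).
    apply: (@integrableB _ _ _ leb A mBall (EFin \o Y) (EFin \o cst (Y t))).
      exact: integrableS IY.
    apply/integrableP; split; first by apply/measurable_EFinP; exact: measurable_cst.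
    under eq_integral do rewrite /=.
    by rewrite integral_cst// [X in (_ * X < _)%E]lA -EFinM ltry.
  have ID : leb.-integrable A (EFin \o (fun s => `|Y s - Y t|)) by exact: integrable_abse IC.
  have Ed : Rintegral leb A (fun s => `|Y s - Y t|) = r n * 2 * fine (davg Y t (r n)).
    rewrite /davg /iavg -/A [X in (X^-1 * _)%E]lA inver gt_eqF; last by rewrite pmulrn_lgt0.
    have -> : (\int[leb]_(y in A) `|(((center (Y t)) \o Y) y)%:E| = (Rintegral leb A (fun s => `|Y s - Y t|))%:E)%E.
      by rewrite /Rintegral fineK//; exact: integrable_fin_num.
    rewrite -EFinM /= mulr2n; field.
    by rewrite gt_eqF// -mulr2n pmulrn_lgt0.
  have -> : m * conv Y eta m (m * t) - Rintegral leb setT eta * Y t =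
      m * Rintegral leb setT (fun s => eta (m * s - m * t) * Y s - Y t * eta (m * s - m * t)).
    rewrite RintegralB//; last exact: intgZl.
    by rewrite RintegralZl// Ee /conv; field.
  rewrite normrM gtr0_norm// -/m.
  have -> : 4 * B * fine (davg Y t (r n)) = m * (B * Rintegral leb A (fun s => `|Y s - Y t|)).
    by rewrite Ed /r -/m; field.
  have IR : intg leb ((fun s => `|Y s - Y t|) \_ A).
    by have := proj1 (@integrable_mkcond _ _ _ leb A (EFin \o (fun s => `|Y s - Y t|)) mBall) ID; rewrite restrict_EFin.
  apply: ler_wpM2l; first exact: ltW.
  rewrite [X in _ <= _ * X]Rintegral_mkcond -RintegralZl//.
  apply: (@le_norm_Rintegral _ _ _ leb (fun s => eta (m * s - m * t) * Y s - Y t * eta (m * s - m * t))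
     (fun s => B * ((fun s => `|Y s - Y t|) \_ A) s)).
  - exact: intgZl.
  - by apply: (@intg_measurable _ _ _ leb); apply: intgB => //; exact: intgZl.
  - move=> s; rewrite (mulrC (Y t)) -mulrBr normrM patchE; case: ifPn => sA.
      by rewrite ler_wpM2r//; case/andP: (eB (m * s - m * t)) => u v; rewrite ger0_norm.
    rewrite e0 ?normr0 ?mul0r ?mulr0// -mulrBr normrM gtr0_norm// -ltr_pdivrMl// mulr1.
    apply: contraNT sA; rewrite -leNgt inE /A /ball/= distrC => /le_lt_trans; apply.
    by rewrite /r -/m mulr_natl mulr2n ltrDl invr_gt0.
apply/cvgrPdist_le => e e0'.
have c1 : 4 * B * fine (davg Y t (r n)) @[n --> \oo] --> 0.
  by rewrite -[X in _ --> X](mulr0 (4 * B)); apply: cvgMl_tmp.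
near=> n; rewrite distrC; apply: le_trans (key n) _.
by apply: ltW; near: n; exact: (cvgr_lt _ c1).
Unshelve. all: by end_near. Qed.

End Approximation.

Section WeakOscillator.
Variable R : realType.
Local Notation leb := (@lebesgue_measure R).

Lemma ae_shift (P : R -> Prop) (c : R) : {ae leb, forall t, P t} -> {ae leb, forall t, P (t + c)}.
Proof.
move=> [A [mA A0 PA]]; exists ((fun t => t + c) @^-1` A); split.
- rewrite -[X in measurable X]setTI.
  by apply: (measurable_funD (@measurable_id _ R setT) (measurable_cst c)).
- by rewrite -A0; exact: lebesgue_measure_shift.
- by move=> t /= h; apply: PA.
Qed.

(* Dilating one fixed bump, rather than taking [bumpf r] with [r] small, keeps the sup norm
   comparable to the mean, as Lebesgue differentiation requires. *)
Definition tbump (n : nat) (q t : R) : R := bumpf 1 (n.+1%:R * t - q).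

Definition weak_oscillator (y : R -> R) (lam : R) (n : nat) (q : R) : Prop :=
  Rintegral leb setT (fun t => (derive1 (derive1 (tbump n q)) t + lam * tbump n q t) * y t) = 0.

Lemma smooth1_tbump n q : smooth1 (tbump n q).
Proof. exact: (smooth1_affine n.+1%:R (- q) (smooth1_bump 1)). Qed.

Lemma derive2_tbump n q t :
  derive1 (derive1 (tbump n q)) t = n.+1%:R ^+ 2 * derive1 (derive1 (@bumpf R 1)) (n.+1%:R * t - q).
Proof.
have d1 (f : R -> R) : smooth1 f ->
    derive1 (fun t => f (n.+1%:R * t - q)) = (fun t => derive1 f (n.+1%:R * t - q) * n.+1%:R).
  move=> sf; apply: is_derive_derive1 => x.
  by apply: (@is_derive_affine _ f n.+1%:R (- q)); exact: smooth1_is_derive.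
rewrite /tbump d1; last exact: smooth1_bump.
have sb := smooth1_derive (@smooth1_bump R 1).
suff hd (x : R) : is_derive x 1 (fun t => derive1 (@bumpf R 1) (n.+1%:R * t - q) * n.+1%:R)
    (derive1 (derive1 (@bumpf R 1)) (n.+1%:R * x - q) * n.+1%:R * n.+1%:R).
  by rewrite (is_derive_derive1 hd); ring.
have := @is_derive_affine _ (fun s => derive1 (@bumpf R 1) s * n.+1%:R) n.+1%:R (- q) x
  (derive1 (derive1 (@bumpf R 1)) (n.+1%:R * x - q) * n.+1%:R).
apply; have := is_deriveZ n.+1%:R (smooth1_is_derive (n.+1%:R * x - q) sb).
rewrite /GRing.scale /= [X in is_derive _ _ _ X -> _]mulrC.
by have -> : n.+1%:R \*: derive1 (@bumpf R 1) = (fun s => derive1 (@bumpf R 1) s * n.+1%:R)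
  by apply/funext => s; exact: mulrC.
Qed.

Lemma bump_supp1 (x : R) : 1 < `|x| -> bumpf 1 x = 0 :> R.
Proof. exact: bump_supp. Qed.

Lemma bump2_supp1 (x : R) : 1 < `|x| -> derive1 (derive1 (@bumpf R 1)) x = 0.
Proof. by apply: derive1_supp => z; apply: derive1_supp => w; exact: bump_supp. Qed.

(** The conditions on [a] and [b] keep the support of the rescaled bump in [[c, N]], where
    truncation does not alter [y]. Two time derivatives of the bump bring out the square of
    [n.+1%:R], by which [lam] is therefore divided. *)
Lemma weak_ode (y : R -> R) (lam c N a b : R) (n : nat) :
  intg leb (fun t => y t * \1_(`[c, N]%classic) t) ->
  (forall q : rat, a < ratr q < b -> weak_oscillator y lam n (ratr q)) ->
  n.+1%:R * c + 1 <= a -> b <= n.+1%:R * N - 1 ->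
  forall x, a < x < b ->
    conv (fun t => y t * \1_(`[c, N]%classic) t) (derive1 (derive1 (@bumpf R 1))) n.+1%:R x =
    - (lam / n.+1%:R ^+ 2) * conv (fun t => y t * \1_(`[c, N]%classic) t) (@bumpf R 1) n.+1%:R x.
Proof.
move=> IY H ha hb.
pose m : R := n.+1%:R; have m0 : 0 < m by rewrite ltr0n.
pose Y t := y t * \1_(`[c, N]%classic) t.
have sb := @smooth1_bump R 1; have sb2 := smooth1_derive (smooth1_derive sb).
have I1 q := intg_conv IY m q sb bump_supp1.
have I2 q := intg_conv IY m q sb2 bump2_supp1.
suff E x : a < x < b -> conv Y (derive1 (derive1 (@bumpf R 1))) m x + (lam / m ^+ 2) * conv Y (@bumpf R 1) m x = 0.
  by move=> x hx; apply/eqP; rewrite mulNr -subr_eq0 opprK; apply/eqP; exact: E.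
apply: (@continuous_rat_eq0 _ (fun x => conv Y (derive1 (derive1 (@bumpf R 1))) m x + (lam / m ^+ 2) * conv Y (@bumpf R 1) m x)).
  have c1 := continuous_conv IY (m := m) sb2 bump2_supp1.
  have c2 := continuous_conv IY (m := m) sb bump_supp1.
  move=> z; apply: (@continuousD _ _ _ (conv Y (derive1 (derive1 (@bumpf R 1))) m) (fun x => (lam / m ^+ 2) * conv Y (@bumpf R 1) m x) z (c1 z)).
  by apply: cvgMl_tmp; exact: (c2 z).
move=> q hq.
have Hq : Rintegral leb setT (fun t => m ^+ 2 * (derive1 (derive1 (@bumpf R 1)) (m * t - ratr q) * Y t) + lam * (bumpf 1 (m * t - ratr q) * Y t)) = 0.
  rewrite -[RHS](H q hq); apply: eq_Rintegral => t _.
  rewrite derive2_tbump /tbump -/m /Y indicE.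
  case: (boolP (t \in _)) => tI; first by rewrite mulr1; ring.
  have hs : 1 < `|m * t - ratr q|.
    rewrite ltNge; apply: contra tI => h.
    move: h; rewrite ler_distlC => /andP[h1 h2]; rewrite inE /= in_itv/=.
    case/andP: hq => h3 h4.
    apply/andP; split; rewrite -(ler_pM2l m0); rewrite -/m in ha hb; lra.
  by rewrite bump2_supp1// bump_supp1//; ring.
rewrite RintegralD// in Hq; [|exact: intgZl|exact: intgZl].
rewrite !RintegralZl// in Hq.
have m2 : m ^+ 2 != 0 by rewrite expf_neq0// gt_eqF.
apply: (mulfI m2); rewrite mulr0 -[RHS]Hq /conv mulrDr; congr (_ + _).
by rewrite mulrA mulrCA mulfV// mulr1.
Qed.

Lemma Rintegral_bump_gt0 : 0 < Rintegral leb setT (@bumpf R 1).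
Proof.
have := @fcos_bump_gt0 R 1 0; rewrite /fcos normr0 mulr0 => /(_ ltr01 ler01).
by under eq_Rintegral do rewrite mulr0 cos0 mulr1.
Qed.

Lemma conv_bump_lebesgue (Y : R -> R) : intg leb Y ->
  {ae leb, forall t, n.+1%:R * conv Y (@bumpf R 1) n.+1%:R (n.+1%:R * t) @[n --> \oo] --> Rintegral leb setT (@bumpf R 1) * Y t}.
Proof.
move=> IY; have sb := @smooth1_bump R 1.
have [B B0 HB] := smooth_supp_bounded (smooth1_continuous sb) bump_supp1.
apply: (conv_lebesgue IY) => //; [exact: smooth1_continuous|exact: bump_supp1|].
by move=> x; rewrite bump_ge0/=; apply: le_trans (HB x); exact: ler_norm.
Qed.

Lemma three_term_bound (k a b c m : R) : 0 <= m -> `|k| <= 1 -> a + c = 2 * k * b ->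
  `|m * c| <= 2 * `|m * b| + `|m * a|.
Proof.
move=> m0 k1 E; have -> : c = 2 * (k * b) - a by lra.
rewrite !normrM (ger0_norm m0) (mulrCA 2 m) -mulrDr ler_wpM2l//.
apply: le_trans (ler_normB _ _) _; rewrite lerD2r !normrM (ger0_norm (ler0n _ 2)) ler_pM2l//.
by rewrite ler_piMl.
Qed.

Lemma weak_oscillator_ineq (y : R -> R) (lam : R) : 0 <= lam ->
  (forall k : nat, intg leb (fun t => y t * \1_(`[k.+2%:R^-1, k.+2%:R]%classic) t)) ->
  (forall n (q : rat), 1 < ratr q :> R -> weak_oscillator y lam n (ratr q)) ->
  {ae leb, forall t, 0 < t -> `|y t| <= 2 * `|y (t + 1)| + `|y (t + 2)|}.
Proof.
move=> lam0 Iy H.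
suff K k : {ae leb, forall t, k.+2%:R^-1 < t -> t + 2 < k.+2%:R -> `|y t| <= 2 * `|y (t + 1)| + `|y (t + 2)|}.
  refine (ae_mono (ae_foralln K) _) => t Ht t0.
  have [k1 _ h1] := near_infty_natSinv_lt (PosNum t0).
  pose k2 := Num.bound (t + 2).
  apply: (Ht (maxn k1 k2)); first by apply: (h1 (maxn k1 k2).+1); rewrite /= leqW// leq_maxl.
  apply: (@lt_le_trans _ _ k2%:R); first by apply: archi_boundP; lra.
  by rewrite ler_nat (leq_trans (leq_maxr k1 k2))// leqW.
pose c : R := k.+2%:R^-1; pose N : R := k.+2%:R.
pose Y t := y t * \1_(`[c, N]%classic) t.
have c0 : 0 < c by rewrite invr_gt0.
have IY : intg leb Y := Iy k.
(* The identity holds for the mollifications; it passes to the limit where [t], [t + 1] and [t + 2]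
   are all points of convergence. *)
have L := conv_bump_lebesgue IY.
refine (ae_mono2 (ae_mono2 L (ae_shift 1 L) (fun t h1 h2 => conj h1 h2)) (ae_shift 2 L) _) => t [h0 h1] h2 ct tN.
have Yin s : c <= s -> s <= N -> Y s = y s.
  by move=> s1 s2; rewrite /Y indicE mem_set ?mulr1//= in_itv/= s1 s2.
rewrite -(Yin t) -?(Yin (t + 1)) -?(Yin (t + 2)); try (rewrite -/c -/N in ct tN; lra).
pose I : R := Rintegral leb setT (@bumpf R 1).
have I0 : 0 < I := Rintegral_bump_gt0.
suff : `|I * Y t| <= 2 * `|I * Y (t + 1)| + `|I * Y (t + 2)|.
  rewrite !normrM (gtr0_norm I0) => h; rewrite -(ler_pM2l I0).
  by apply: le_trans h _; rewrite mulrDr mulrCA.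
pose u n s := n.+1%:R * conv Y (@bumpf R 1) n.+1%:R (n.+1%:R * s).
apply: (@ler_cvg_to _ \oo _ R (fun n => `|u n t|) (fun n => 2 * `|u n (t + 1)| + `|u n (t + 2)|)).
- exact: cvg_norm.
- by apply: cvgD; [apply: cvgMl_tmp|]; exact: cvg_norm.
have tc0 : 0 < t - c by rewrite subr_gt0.
have tN0 : 0 < N - (t + 2) by rewrite subr_gt0.
near=> n.
pose m : R := n.+1%:R; have m0 : 0 < m by rewrite ltr0n.
have n1 : 1 < m * (t - c).
  rewrite mulrC -ltr_pdivrMr// mul1r /m; near: n; exact: near_infty_natSinv_lt (PosNum tc0).
have n2 : 1 < m * (N - (t + 2)).
  rewrite mulrC -ltr_pdivrMr// mul1r /m; near: n; exact: near_infty_natSinv_lt (PosNum tN0).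
have mc : 0 < m * c by rewrite mulr_gt0.
have H' (q : rat) : m * c + 1 < ratr q < m * N - 1 -> weak_oscillator y lam n (ratr q).
  by case/andP => h _; apply: H; apply: lt_trans h; rewrite ltrDr.
have ode x := weak_ode IY H' (lexx _) (lexx _) (x := x).
(* A step [m] in the variable of [conv] is one unit of time, and the frequency [sqrt lam / m]
   compensates, so the cosine factor has modulus at most 1 for every [lam]. *)
have D : conv Y (@bumpf R 1) m (m * (t + 1) + m) + conv Y (@bumpf R 1) m (m * (t + 1) - m) =
    2 * cos (Num.sqrt (lam / m ^+ 2) * m) * conv Y (@bumpf R 1) m (m * (t + 1)).
  apply: (@conv_dalembert _ 1 Y IY _ m (lam / m ^+ 2) (m * c + 1) (m * N - 1)) => //.
  - exact: smooth1_bump.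
  - exact: bump_supp1.
  - by rewrite divr_ge0// sqr_ge0.
  - by move: n1; rewrite mulrBr mulrDr; lra.
  - by move: n2; rewrite mulrBr !mulrDr; lra.
have e1 : m * (t + 1) + m = m * (t + 2) by ring.
have e2 : m * (t + 1) - m = m * t by ring.
rewrite e1 e2 in D.
exact: (three_term_bound (ltW m0) (norm_cos_le1 _) D).
Unshelve. all: by end_near. Qed.

Lemma weak_oscillator_eq0 (y : R -> R) (lam : R) : 0 <= lam ->
  (forall k : nat, intg leb (fun t => y t * \1_(`[- k.+1%:R, k.+1%:R]%classic) t)) ->
  (forall t, t <= 0 -> y t = 0) ->
  (forall n (q : rat), weak_oscillator y lam n (ratr q)) ->
  {ae leb, forall t, y t = 0}.
Proof.
move=> lam0 Iy y0 H.
suff K k : {ae leb, forall t, `|t| < k.+1%:R -> y t = 0}.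
  by refine (ae_mono (ae_foralln K) _) => t Ht; apply: (Ht (Num.bound `|t|));
    apply: lt_trans (archi_boundP _) _; rewrite ?ltr_nat.
pose N : R := k.+1%:R.
pose Y t := y t * \1_(`[- N, N]%classic) t.
have IY : intg leb Y := Iy k.
have Y0 t : t <= 0 -> Y t = 0 by move=> t0; rewrite /Y y0// mul0r.
refine (ae_mono (conv_bump_lebesgue IY) _) => t ht tN.
have <- : Y t = y t.
  by rewrite /Y indicE mem_set ?mulr1//= in_itv/= -ler_norml ltW.
have tN0 : 0 < N - `|t| by rewrite subr_gt0.
have N1 : 1 <= N by rewrite ler1n.
suff c0 : n.+1%:R * conv Y (@bumpf R 1) n.+1%:R (n.+1%:R * t) @[n --> \oo] --> (0 : R).
  have E0 : limn (fun n : nat => n.+1%:R * conv Y (@bumpf R 1) n.+1%:R (n.+1%:R * t)) = 0 by apply: cvg_lim.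
  have /eqP : Rintegral leb setT (@bumpf R 1) * Y t = 0 by rewrite -E0; apply/esym; apply: cvg_lim.
  by rewrite mulf_eq0 gt_eqF ?Rintegral_bump_gt0//= => /eqP.
apply: (@cvg_trans _ ((0 : R) @[n --> \oo])); last exact: cvg_cst.
apply: near_eq_cvg; near=> n.
pose m : R := n.+1%:R; have m0 : 0 < m by rewrite ltr0n.
have n1 : 1 < m * (N - `|t|).
  rewrite mulrC -ltr_pdivrMr// mul1r /m; near: n; exact: near_infty_natSinv_lt (PosNum tN0).
(* This places the point [- 2] inside the interval where the mollified equation holds. A bump
   centred at [x < - 1] in this variable meets only negative times, where [Y] is 0, so the Cauchy
   data at [- 2] vanish. *)
have m4 : 4 <= m.
  have : (3 <= n)%N by near: n; exact: nbhs_infty_ge.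
  by rewrite /m ler_nat ltnS.
have mN : m <= m * N by rewrite ler_peMr// ltW.
have H' (q : rat) : m * - N + 1 < ratr q < m * N - 1 -> weak_oscillator y lam n (ratr q) by move=> _; exact: H.
have ode x := weak_ode IY H' (lexx _) (lexx _) (x := x).
have cz (eta : R -> R) x : (forall z, 1 < `|z| -> eta z = 0) -> x < - 1 -> conv Y eta m x = 0.
  move=> e0 x1; rewrite /conv /Rintegral integral0_eq// => s _.
  have [s0|s0] := leP s 0; first by rewrite Y0// mulr0.
  rewrite e0 ?mul0r//; apply: lt_le_trans (ler_norm _).
  have : 0 < m * s by rewrite mulr_gt0.
  by lra.
have sb := @smooth1_bump R 1.
have x2 : m * - N + 1 < - 2 < m * N - 1 by rewrite mulrN; apply/andP; split; lra.
have xt : m * - N + 1 < m * t < m * N - 1.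
  move: n1; rewrite mulrBr mulrN.
  have : m * `|t| = `|m * t| by rewrite normrM gtr0_norm.
  move=> -> h; have := ler_norm (m * t); have := ler_norm (- (m * t)); rewrite normrN.
  by move=> h1 h2; apply/andP; split; lra.
suff Z : conv Y (@bumpf R 1) m (m * t) = 0 by rewrite -/m Z mulr0.
apply: (@oscillator_unique _ _ _ (- 2) (lam / m ^+ 2) (conv Y (@bumpf R 1) m) (fun x => - conv Y (derive1 (@bumpf R 1)) m x) _ x2 _ _ _ _ _ xt).
- by rewrite divr_ge0// sqr_ge0.
- by move=> x _; exact: (is_derive_conv IY m x sb bump_supp1).
- by move=> x hx; rewrite -ode//; exact: (is_derive_conv2 IY m x sb bump_supp1).
- by apply: cz; [exact: bump_supp1|lra].
- by rewrite cz ?oppr0//; [move=> z; apply: derive1_supp; exact: bump_supp1|lra].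
Unshelve. all: by end_near. Qed.

End WeakOscillator.

(** * From the weak wave equation to fixed frequencies *)

Section Weight.
Variable R : realType.
Variable d : nat.
Local Notation V := (d.-tuple R).
Local Notation mu := (@mud R d).

(** A product weight fits the transforms of tensor products: it dominates [1 + |xi| ^ 2] and its
    inverse is integrable coordinate by coordinate. *)
Definition pone (xi : V) : R := \prod_(j < d) oneDsqr (tnth xi j).

Lemma pone_ge1 xi : 1 <= pone xi.
Proof.
apply: (big_ind (fun x => 1 <= x)) => [//|x y x1 y1|j _]; last exact: oneDsqr_ge1.
by rewrite (le_trans x1)// ler_peMr// (le_trans _ x1).
Qed.

Lemma pone_gt0 xi : 0 < pone xi.
Proof. exact: lt_le_trans (pone_ge1 xi). Qed.

Lemma measurable_pone : measurable_fun setT pone.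
Proof.
apply: (@measurable_fun_prod_tnth R d (fun _ => @oneDsqr R)) => j.
apply: continuous_measurable_fun; exact: continuous_oneDsqr.
Qed.

Lemma measurable_poneV N : measurable_fun setT (fun xi => pone xi ^- N).
Proof.
rewrite (_ : (fun xi => _) = fun xi => powR (pone xi ^+ N) (-1)).
  by apply: (measurableT_comp (measurable_powR (-1))); apply: measurable_funX; exact: measurable_pone.
by apply/funext => xi; rewrite powR_inv1// exprn_ge0// ltW// pone_gt0.
Qed.

Lemma intg_poneV : intg mu (fun xi => (pone xi)^-1).
Proof.
rewrite (_ : (fun xi => _) = fun xi => \prod_(j < d) (oneDsqr (tnth xi j))^-1).
  by apply: (@integrable_mud_prod R d (fun _ t => (oneDsqr t)^-1)) => j; exact: intg_oneDsqrV.
by apply/funext => xi; rewrite /pone prodfV.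
Qed.

Lemma oneD_dot_le_pone xi : 1 + dot xi xi <= pone xi.
Proof.
rewrite /dot /pone; suff [] : 1 + \sum_(i < d) tnth xi i * tnth xi i <= \prod_(j < d) oneDsqr (tnth xi j) /\
   0 <= \sum_(i < d) tnth xi i * tnth xi i by [].
apply: (big_ind2 (fun x y => 1 + x <= y /\ 0 <= x)) => [|x1 x2 y1 y2 [h1 h2] [h3 h4]|i _].
- by rewrite addr0.
- split; last by rewrite addr_ge0.
  have := mulr_ge0 h2 h4.
  have : (1 + x1) * (1 + y1) <= x2 * y2 by apply: ler_pM => //; rewrite addr_ge0.
  by rewrite !mulrDl !mulrDr !mul1r !mulr1; lra.
- by rewrite /oneDsqr -expr2 sqr_ge0.
Qed.

Lemma norm_tnth_le_pone xi i : `|tnth xi i| <= pone xi.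
Proof.
have := oneD_dot_le_pone xi; apply: le_trans.
rewrite /dot (bigD1 i)//=; have h : 0 <= \sum_(j < d | j != i) tnth xi j * tnth xi j.
  by apply: sumr_ge0 => j _; rewrite -expr2 sqr_ge0.
have := sqr_ge0 (`|tnth xi i| - 1); rewrite sqrrB real_normK ?num_real// mulr1 expr1n expr2.
have := normr_ge0 (tnth xi i); move: h; rewrite mulr2n; lra.
Qed.

Lemma norm1_le_pone xi : norm1 xi <= d%:R * pone xi.
Proof.
rewrite /norm1; apply: (@le_trans _ _ (\sum_(j < d) pone xi)).
  by apply: ler_sum => j _; exact: norm_tnth_le_pone.
by rewrite sumr_const card_ord mulr_natl.
Qed.

Lemma powR_oneD_dot_le_pone s m xi : `|s| <= m%:R -> powR (1 + dot xi xi) s <= pone xi ^+ m.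
Proof.
move=> sm.
have x1 : 1 <= 1 + dot xi xi.
  by rewrite lerDl; apply: sumr_ge0 => j _; rewrite -expr2 sqr_ge0.
apply: (@le_trans _ _ (powR (1 + dot xi xi) m%:R)).
  by apply: ler_powR => //; exact: le_trans (ler_norm s) sm.
rewrite -powR_mulrn; last exact: ltW (pone_gt0 _).
apply: ge0_ler_powR; rewrite ?nnegrE ?ler0n ?oneD_dot_le_pone//; first exact: le_trans x1.
exact: ltW (pone_gt0 _).
Qed.

Lemma fcosv_vopp (b : R -> R) (xi : V) : fcosv b (vopp xi) = fcosv b xi.
Proof. by apply: eq_bigr => j _; rewrite tnth_vopp fcos_even. Qed.

Lemma fcosv_decay M b N : even_bump M b -> exists2 C, 0 <= C & forall xi : V, `|fcosv b xi| <= C * pone xi ^- N.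
Proof.
move=> eb; have [C C0 HC] := fcos_decay N eb.
exists (C ^+ d); first exact: exprn_ge0.
move=> xi; have p0 : 0 < pone xi ^+ N by rewrite exprn_gt0// pone_gt0.
rewrite ler_pdivlMr// /fcosv normr_prod /pone -prodrXl -big_split/=.
rewrite (_ : C ^+ d = \prod_(j < d) C); last by rewrite prodr_const card_ord.
apply: ler_prod => j _; apply/andP; split.
  by rewrite mulr_ge0// exprn_ge0// (le_trans _ (oneDsqr_ge1 _)).
by rewrite mulrC; exact: HC.
Qed.

End Weight.

(** * From the Sobolev norm to a weighted integral *)

Section HsBound.
Variable R : realType.
Variable d : nat.
Local Notation V := (d.-tuple R).
Local Notation mu := (@mud R d).
Local Notation leb := (@lebesgue_measure R).

Lemma young (k x y : R) : 0 < k -> x * y <= k * x ^+ 2 + k^-1 * y ^+ 2.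
Proof.
move=> k0; rewrite -subr_ge0.
have -> : k * x ^+ 2 + k^-1 * y ^+ 2 - x * y = k^-1 * ((k * x - y / 2) ^+ 2 + 3 / 4 * y ^+ 2).
  by field; rewrite gt_eqF.
by rewrite mulr_ge0 ?invr_ge0 ?(ltW k0)// addr_ge0 ?sqr_ge0// mulr_ge0 ?sqr_ge0.
Qed.

Variables (s : R) (m : nat).
Hypothesis sm : `|s| <= m%:R.

(* AM-GM with the parameter [S = 1 + sqrt (hs2 s Ure Uim)] makes the bound linear in the norm,
   which is all that [L1loc_Hs] controls. *)
Lemma integral_weight_le (Ure Uim : V -> V) (i : 'I_d) (u : V -> R) :
  (forall j, measurable_fun setT (fun xi => tnth (Ure xi) j)) ->
  (forall j, measurable_fun setT (fun xi => tnth (Uim xi) j)) ->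
  measurable_fun setT u ->
  (forall xi, u xi ^+ 2 <= tnth (Ure xi) i ^+ 2 + tnth (Uim xi) i ^+ 2) ->
  (\int[mu]_xi (`|u xi| * pone xi ^- m.+1)%:E <=
   (1 + Rintegral mu setT (fun xi : V => (pone xi)^-1))%:E * (1 + esqrt (hs2 s Ure Uim)))%E.
Proof.
move=> mre mim mU uU.
pose E xi := \sum_(i < d) (tnth (Ure xi) i ^+ 2 + tnth (Uim xi) i ^+ 2).
pose w (xi : V) := powR (1 + dot xi xi) s.
have md : measurable_fun setT (fun xi : V => dot xi xi) by apply: measurable_dot; exact: measurable_id.
have mw : measurable_fun setT (fun xi => w xi * E xi).
  apply: measurable_funM.
    by apply: (measurableT_comp (measurable_powR s)); exact: measurable_funD.
  by apply: measurable_sum => j; apply: measurable_funD; exact: measurable_funX.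
have E0 xi : 0 <= w xi * E xi.
  by rewrite mulr_ge0 ?powR_ge0//; apply: sumr_ge0 => j _; rewrite addr_ge0// sqr_ge0.
have hsE : hs2 s Ure Uim = (\int[mu]_xi (w xi * E xi)%:E)%E.
  by rewrite integral_mud//; exact/measurable_EFinP.
set C1 := Rintegral _ _ _.
have C10 : 0 <= C1 by apply: Rintegral_ge0 => xi _; rewrite invr_ge0 ltW// pone_gt0.
have h0 : (0 <= hs2 s Ure Uim)%E by rewrite hsE; apply: integral_ge0 => xi _; rewrite lee_fin.
move: h0; case: (hs2 s Ure Uim) hsE => [r|//|//] hsE; last first.
  by rewrite [esqrt _]/= addey// gt0_muley ?leey// lte_fin; lra.
rewrite lee_fin => r0 /=.
pose S := 1 + Num.sqrt r; have S0 : 0 < S by rewrite ltr_wpDr ?sqrtr_ge0.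
apply: (@le_trans _ _ (\int[mu]_xi ((S^-1)%:E * (w xi * E xi)%:E + S%:E * ((pone xi)^-1)%:E))%E).
  apply: ge0_le_integral => //.
  - by move=> xi _; rewrite lee_fin mulr_ge0// invr_ge0 exprn_ge0// ltW// pone_gt0.
  - apply/measurable_EFinP; apply: measurable_funM; last exact: measurable_poneV.
    exact: measurableT_comp.
  - apply: emeasurable_funD; apply/measurable_EFinP; apply: measurable_funM => //.
    exact: (@measurable_poneV R d 1).
  - move=> xi _; rewrite -!EFinM -EFinD lee_fin.
    have x1 : 0 < 1 + dot xi xi.
      by rewrite ltr_wpDr//; apply: sumr_ge0 => j _; rewrite -expr2 sqr_ge0.
    have w0 : 0 < w xi by exact: powR_gt0.
    have p0 := pone_gt0 xi; have p1 := pone_ge1 xi.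
    apply: le_trans (young `|u xi| (pone xi ^- m.+1) (divr_gt0 w0 S0)) _.
    apply: lerD.
      rewrite mulrAC mulrC ler_wpM2l ?invr_ge0 ?(ltW S0)// ler_wpM2l ?(ltW w0)//.
      rewrite real_normK ?num_real//; apply: le_trans (uU xi) _.
      rewrite /E (bigD1 i)//= lerDl; apply: sumr_ge0 => j _.
      by rewrite addr_ge0// sqr_ge0.
    rewrite invf_div -mulrA ler_wpM2l ?(ltW S0)//.
    have -> : (w xi)^-1 = powR (1 + dot xi xi) (- s) by rewrite powRN.
    apply: (@le_trans _ _ (pone xi ^+ m * (pone xi ^- m.+1) ^+ 2)).
      by rewrite ler_wpM2r ?sqr_ge0// powR_oneD_dot_le_pone// normrN.
    have -> : pone xi ^+ m * (pone xi ^- m.+1) ^+ 2 = (pone xi)^-1 * pone xi ^- m.+1.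
      rewrite expr2 mulrA; congr (_ * _).
      by rewrite exprSr invfM mulrA mulfV ?mul1r// expf_neq0// gt_eqF.
    rewrite ler_piMr ?invr_ge0 ?(ltW p0)// invf_le1 ?exprn_gt0//.
    exact: exprn_ege1.
rewrite ge0_integralD//; last 4 first.
- by move=> xi _; rewrite -EFinM lee_fin mulr_ge0// invr_ge0 ltW.
- by apply/measurable_EFinP; apply: measurable_funM.
- by move=> xi _; rewrite -EFinM lee_fin mulr_ge0 ?(ltW S0)// invr_ge0 ltW// pone_gt0.
- by apply/measurable_EFinP; apply: measurable_funM => //; exact: (@measurable_poneV R d 1).
rewrite ge0_integralZl//; last 3 first.
- exact/measurable_EFinP.
- by move=> xi _; rewrite lee_fin.
- by rewrite lee_fin invr_ge0 ltW.
rewrite ge0_integralZl//; last 3 first.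
- by apply/measurable_EFinP; exact: (@measurable_poneV R d 1).
- by move=> xi _; rewrite lee_fin invr_ge0 ltW// pone_gt0.
- by rewrite lee_fin ltW.
have -> : (\int[mu]_xi ((pone xi)^-1)%:E = C1%:E)%E.
  by rewrite /C1 /Rintegral fineK//; apply: integrable_fin_num => //; exact: intg_poneV.
have H : S^-1 * r + S * C1 <= (1 + C1) * S.
  have -> : (1 + C1) * S = S + S * C1 by ring.
  rewrite lerD2r mulrC ler_pdivrMr//.
  by rewrite -{1}(sqr_sqrtr r0) expr2 ler_pM ?sqrtr_ge0// /S lerDr.
by move: H; rewrite -lee_fin EFinD !EFinM hsE.
Qed.

End HsBound.

Section WeakEquation.
Variable R : realType.
Variable d : nat.
Local Notation V := (d.-tuple R).
Local Notation mu := (@mud R d).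
Local Notation leb := (@lebesgue_measure R).
Variables (s : R) (m : nat).
Hypothesis sm : `|s| <= m%:R.
Variables (Ure Uim : R -> V -> V).
Hypothesis mre : forall i, measurable_fun setT (fun p : R * V => tnth (Ure p.1 p.2) i).
Hypothesis mim : forall i, measurable_fun setT (fun p : R * V => tnth (Uim p.1 p.2) i).

(** With this exponent [rho ^ 2 * (1 + |xi| ^ 2) ^ (- s)] is at most [(pone xi)^-1], hence
    integrable, and the norm of [H^s] controls the integral of [|\hat u| * rho]. *)
Definition rho (xi : V) : R := pone xi ^- m.+1.

Lemma rho_gt0 xi : 0 < rho xi.
Proof. by rewrite invr_gt0 exprn_gt0// pone_gt0. Qed.

(** Extension by zero to [t <= 0] reflects the support condition on solutions. The frequency comes
    first in the pair, so slices at fixed [xi] are functions of time. *)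
Definition cutoff (u : R -> V -> R) (p : V * R) : R := if 0 < p.2 then u p.2 p.1 else 0.

Lemma measurable_cutoff u : measurable_fun setT (fun p : R * V => u p.1 p.2) ->
  measurable_fun setT (cutoff u).
Proof.
move=> mu1; apply: measurable_fun_ifT.
- by apply: measurable_fun_ltr; [exact: measurable_cst|exact: measurable_snd].
- apply: (measurableT_comp (f := fun p : R * V => u p.1 p.2) (g := fun p : V * R => (p.2, p.1))) => //.
  by apply: measurable_fun_pair; [exact: measurable_snd|exact: measurable_fst].
- exact: measurable_cst.
Qed.

Let slice (f : R * V -> R) (t : R) : measurable_fun setT f -> measurable_fun setT (fun xi => f (t, xi)).
Proof. by move=> mf; apply: (measurableT_comp mf); exact: measurable_fun_pair. Qed.

Lemma measurable_hs2_integrand t : measurable_fun setT (fun xi : V =>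
  (powR (1 + dot xi xi) s * \sum_(i < d) (tnth (Ure t xi) i ^+ 2 + tnth (Uim t xi) i ^+ 2))%:E).
Proof.
apply/measurable_EFinP; apply: measurable_funM.
  apply: (measurableT_comp (measurable_powR s)); apply: measurable_funD => //.
  by apply: measurable_dot; exact: measurable_id.
apply: measurable_sum => j; apply: measurable_funD; apply: measurable_funX.
  exact: (slice t (mre j)).
exact: (slice t (mim j)).
Qed.

Lemma hs2_integral t : hs2 s (Ure t) (Uim t) =
  (\int[mu]_xi (powR (1 + dot xi xi) s * \sum_(i < d) (tnth (Ure t xi) i ^+ 2 + tnth (Uim t xi) i ^+ 2))%:E)%E.
Proof.
rewrite integral_mud//; first exact: measurable_hs2_integrand.
move=> xi; rewrite lee_fin mulr_ge0 ?powR_ge0//.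
by apply: sumr_ge0 => j _; rewrite addr_ge0// sqr_ge0.
Qed.

Lemma measurable_esqrt_hs2 : measurable_fun setT (fun t => esqrt (hs2 s (Ure t) (Uim t))).
Proof.
rewrite (_ : (fun t => _) = fun t => er_map Num.sqrt (\int[mu]_xi (powR (1 + dot xi xi) s * \sum_(i < d) (tnth (Ure t xi) i ^+ 2 + tnth (Uim t xi) i ^+ 2))%:E)%E); last first.
  apply/funext => t; rewrite hs2_integral.
  have : (0 <= \int[mu]_xi (powR (1 + dot xi xi) s * \sum_(i < d) (tnth (Ure t xi) i ^+ 2 + tnth (Uim t xi) i ^+ 2))%:E)%E.
    apply: integral_ge0 => xi _; rewrite lee_fin mulr_ge0 ?powR_ge0//.
    by apply: sumr_ge0 => j _; rewrite addr_ge0// sqr_ge0.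
  by case: (integral _ _ _).
apply: (measurableT_comp (f := er_map Num.sqrt)).
  have ms : measurable_fun setT (@Num.sqrt R) by apply: continuous_measurable_fun; exact: sqrt_continuous.
  exact: (@measurable_er_map _ V R _ ms).
apply: (@measurable_param_integral _ _ _ _ _ mu (fun p : R * V => (powR (1 + dot p.2 p.2) s * \sum_(i < d) (tnth (Ure p.1 p.2) i ^+ 2 + tnth (Uim p.1 p.2) i ^+ 2))%:E)).
apply/measurable_EFinP; apply: measurable_funM.
  apply: (measurableT_comp (measurable_powR s)); apply: measurable_funD => //.
  by apply: measurable_dot; exact: measurable_snd.
by apply: measurable_sum => j; apply: measurable_funD; apply: measurable_funX.
Qed.

Lemma measurable_rho : measurable_fun setT rho.
Proof. exact: measurable_poneV. Qed.

Definition windowed (u : R -> V -> R) (A : set R) (p : V * R) : R := cutoff u p * rho p.1 * \1_A p.2.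

Lemma measurable_windowed (u : R -> V -> R) (A : set R) : measurable_fun setT (fun p : R * V => u p.1 p.2) -> measurable A ->
  measurable_fun setT (windowed u A).
Proof.
move=> mu1 mA; apply: measurable_funM.
  apply: measurable_funM; first exact: measurable_cutoff.
  by apply: (measurableT_comp measurable_rho); exact: measurable_fst.
by apply: (measurableT_comp (f := \1_A : R -> R)); [exact: measurable_indic|exact: measurable_snd].
Qed.

Hypothesis HL : forall a b, 0 < a -> a < b ->
  (\int[leb]_(t in `[a, b]) esqrt (hs2 s (Ure t) (Uim t)) < +oo)%E.

(** Local integrability in time of the norm becomes joint integrability in frequency and time, the
    form in which Fubini can use it. *)
Lemma intg_windowed (u : R -> V -> R) (i : 'I_d) (c N : R) :
  measurable_fun setT (fun p : R * V => u p.1 p.2) ->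
  (forall t xi, u t xi ^+ 2 <= tnth (Ure t xi) i ^+ 2 + tnth (Uim t xi) i ^+ 2) ->
  0 < c -> c < N -> intg (mu \x leb)%E (windowed u `[c, N]%classic).
Proof.
move=> mu1 uU c0 cN.
have mA : measurable (`[c, N]%classic : set R) by exact: measurable_itv.
apply/intg_prodP2; first exact: measurable_windowed.
set C1 := Rintegral mu setT (fun xi : V => (pone xi)^-1).
have C10 : 0 <= C1 by apply: Rintegral_ge0 => xi _; rewrite invr_ge0 ltW// pone_gt0.
have e0 t : (0 <= esqrt (hs2 s (Ure t) (Uim t)))%E.
  by case: (hs2 _ _ _) => [r||] //=; rewrite lee_fin sqrtr_ge0.
pose G (t : R) := (\int[mu]_xi (`|u t xi| * rho xi)%:E)%E.
have mG : measurable_fun setT G.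
  apply: (@measurable_param_integral _ _ _ _ _ mu (fun p : R * V => (`|u p.1 p.2| * rho p.2)%:E)).
  apply/measurable_EFinP; apply: measurable_funM; first exact: measurableT_comp.
  by apply: (measurableT_comp measurable_rho); exact: measurable_snd.
have -> : (\int[leb]_t \int[mu]_xi (`|windowed u `[c, N]%classic (xi, t)|)%:E = \int[leb]_(t in `[c, N]) G t)%E.
  rewrite [RHS]integral_mkcond; apply: eq_integral => t _; rewrite patchE.
  case: ifPn => tA.
    have t0 : 0 < t by move: tA; rewrite inE /= in_itv/= => /andP[h _]; exact: lt_le_trans h.
    apply: eq_integral => xi _; rewrite /windowed /cutoff /= t0 indicE tA mulr1 normrM.
    by rewrite (gtr0_norm (rho_gt0 xi)).
  by rewrite integral0_eq// => xi _; rewrite /windowed indicE (negbTE tA) mulr0 normr0.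
apply: (@le_lt_trans _ _ (\int[leb]_(t in `[c, N]) ((1 + C1)%:E * (1 + esqrt (hs2 s (Ure t) (Uim t)))))%E).
  apply: ge0_le_integral => //.
  - by move=> t _; apply: integral_ge0 => xi _; rewrite lee_fin mulr_ge0// ltW// rho_gt0.
  - exact: measurable_funS mG.
  - apply: (measurable_funS measurableT) => //; apply: measurable_funeM.
    by apply: emeasurable_funD => //; exact: measurable_esqrt_hs2.
  - move=> t _; apply: (@integral_weight_le _ _ s m sm _ _ i (u t)) => //.
    + by move=> j; exact: (slice t (mre j)).
    + by move=> j; exact: (slice t (mim j)).
    + exact: (slice t mu1).
have mh : measurable_fun `[c, N] (fun t => esqrt (hs2 s (Ure t) (Uim t))).
  by apply: (measurable_funS measurableT) => //; exact: measurable_esqrt_hs2.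
rewrite ge0_integralZl//; last 3 first.
- exact: emeasurable_funD.
- by move=> t _; rewrite adde_ge0.
- by rewrite lee_fin addr_ge0.
rewrite ge0_integralD// integral_cst// mul1e.
apply: lte_mul_pinfty => //; first by rewrite lee_fin addr_ge0.
apply: lte_add_pinfty; last exact: HL.
by rewrite [X in (X < _)%E]lebesgue_measure_itv/= lte_fin cN -EFinB ltry.
Qed.

End WeakEquation.

(** * Localisation of the equation at a fixed frequency *)

Section PointwiseEquation.
Variable R : realType.
Variable d : nat.
Local Notation V := (d.-tuple R).
Local Notation mu := (@mud R d).
Local Notation leb := (@lebesgue_measure R).
Variables (kappa alpha delta : R) (chi : R -> R).
Hypothesis kappa0 : 0 < kappa.
Hypothesis alpha01 : 0 < alpha < 1.
Hypothesis delta0 : 0 < delta.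
Hypothesis mchi : measurable_fun setT chi.
Hypothesis chi01 : forall r, 0 <= chi r <= 1.
Hypothesis chi_supp : forall r, 1 < `|r| -> chi r = 0.
Local Notation symb := (@symbol R d kappa alpha delta chi).

Lemma symbol_ge0 xi : 0 <= symb xi.
Proof. by rewrite mulr_ge0 ?Omega_ge0// divr_ge0 ?powR_ge0// ltW. Qed.

Lemma symbol_vopp xi : symb (vopp xi) = symb xi.
Proof. by rewrite /symbol Omega_vopp. Qed.

Lemma measurable_symbol : measurable_fun setT symb.
Proof. by apply: measurable_funM => //; exact: measurable_Omega. Qed.

Lemma symbol_le_pone : exists2 C, 0 <= C & forall xi, symb xi <= C * pone xi ^+ 2.
Proof.
pose I := Rintegral mu setT (fun y : V => ker alpha delta chi y * enorm y ^+ 2).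
have I0 : 0 <= I by apply: Rintegral_ge0 => y _; rewrite mulr_ge0 ?ker_ge0// sqr_ge0.
pose k := kappa / powR delta (2 * (1 - alpha)).
have k0 : 0 <= k by rewrite divr_ge0 ?powR_ge0// ltW.
exists (k * (d%:R ^+ 2 / 2 * I)); first by rewrite mulr_ge0// mulr_ge0// divr_ge0// sqr_ge0.
move=> xi; rewrite /symbol -/k -(mulrA k (d%:R ^+ 2 / 2 * I)) ler_wpM2l//.
apply: le_trans (Omega_le alpha01 delta0 mchi chi01 chi_supp xi) _.
have -> : d%:R ^+ 2 / 2 * I * pone xi ^+ 2 = (d%:R * pone xi) ^+ 2 / 2 * I by rewrite exprMn; ring.
rewrite -/I ler_wpM2r// ler_wpM2r//.
apply: lerXn2r; rewrite ?nnegrE ?norm1_le_pone//; first exact: sumr_ge0.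
by rewrite mulr_ge0// ltW// pone_gt0.
Qed.

Variable m : nat.
Variables (Ure Uim : R -> V -> V).
Hypothesis mre : forall i, measurable_fun setT (fun p : R * V => tnth (Ure p.1 p.2) i).
Hypothesis mim : forall i, measurable_fun setT (fun p : R * V => tnth (Uim p.1 p.2) i).
Hypothesis symre : forall t xi, Ure t (vopp xi) = Ure t xi.
Hypothesis symim : forall t xi, Uim t (vopp xi) = vopp (Uim t xi).
Hypothesis Hsol : dist_solution_zero kappa alpha chi delta Ure Uim.
Variables (a : R -> R) (N : R) (i : 'I_d).
Hypothesis sa : smooth1 a.
Hypothesis a_supp : forall t, N < `|t| -> a t = 0.
Local Notation a2 := (derive1 (derive1 a)).
Let ure t xi := tnth (Ure t xi) i.
Let uim t xi := tnth (Uim t xi) i.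
(** Integrability is required only for the bump [a] at hand, so the argument serves both before and
    after integrability up to [t = 0] is known. *)
Let size (p : V * R) : R := rho m p.1 * (`|a p.2| + `|a2 p.2|).
Hypothesis Jre : intg (mu \x leb)%E (fun p => size p * cutoff ure p).
Hypothesis Jim : intg (mu \x leb)%E (fun p => size p * cutoff uim p).

Section FixedBump.
Variables (M : R) (b : R -> R).
Hypothesis eb : even_bump M b.

Let q (p : V * R) : R := fnorm R d * fcosv b p.1 * (a2 p.2 + symb p.1 * a p.2).

Let measurable_q : measurable_fun setT q.
Proof.
have [sb _ _] := eb.
have m1 (f : V -> R) : measurable_fun setT f -> measurable_fun setT (fun p : V * R => f p.1).
  by move=> mf; apply: (measurableT_comp mf); exact: measurable_fst.
have m2 (f : R -> R) : smooth1 f -> measurable_fun setT (fun p : V * R => f p.2).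
  move=> sf; apply: (measurableT_comp (f := f)); last exact: measurable_snd.
  by apply: continuous_measurable_fun; exact: smooth1_continuous.
apply: measurable_funM.
  apply: measurable_funM => //; apply: m1; apply: measurable_fcosv.
  by apply: continuous_measurable_fun; exact: smooth1_continuous.
apply: measurable_funD; first by apply: m2; do 2 apply: smooth1_derive.
by apply: measurable_funM; [apply: m1; exact: measurable_symbol|exact: m2].
Qed.

Let q_bound : exists2 C, 0 <= C & forall p, `|q p| <= C * size p.
Proof.
(* Of the decay order [m.+3], the part [m.+1] produces [rho] and the remaining 2 compensates the
   growth of the symbol. *)
have [C1 C10 H1] := fcosv_decay d m.+3 eb.
have [C2 C20 H2] := symbol_le_pone.
have f0 : 0 <= fnorm R d by exact: powR_ge0.
exists (fnorm R d * C1 * (1 + C2)); first by rewrite !mulr_ge0// addr_ge0.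
move=> [xi t]; rewrite /q /size /rho /= (normrM (fnorm R d * _)) (normrM (fnorm R d)) (ger0_norm f0).
have p0 := pone_gt0 xi; have p1 := pone_ge1 xi.
have p2 : 1 <= pone xi ^+ 2 by exact: exprn_ege1.
have -> : fnorm R d * C1 * (1 + C2) * (pone xi ^- m.+1 * (`|a t| + `|a2 t|)) =
    fnorm R d * (C1 * ((1 + C2) * (pone xi ^- m.+1 * (`|a t| + `|a2 t|)))) by ring.
rewrite -mulrA ler_wpM2l//.
apply: (@le_trans _ _ (C1 * pone xi ^- m.+3 * ((1 + C2) * pone xi ^+ 2 * (`|a t| + `|a2 t|)))).
  apply: ler_pM => //; apply: le_trans (ler_normD _ _) _.
  rewrite normrM (ger0_norm (symbol_ge0 xi)) mulrDr addrC.
  apply: lerD.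
    by rewrite ler_wpM2r//; apply: le_trans (H2 xi) _; rewrite ler_wpM2r ?sqr_ge0// lerDr.
  by rewrite ler_peMl// (le_trans p2)// ler_peMl ?sqr_ge0// lerDl.
rewrite le_eqVlt; apply/orP; left; apply/eqP.
rewrite -!mulrA; congr (_ * _); rewrite mulrCA; congr (_ * _); rewrite !mulrA; congr (_ * _).
have -> : m.+3 = (m.+1 + 2)%N by rewrite addn2.
by rewrite -mulrA -expr2 exprD invfM mulfVK// expf_neq0// gt_eqF.
Qed.

Let intg_q (u : R -> V -> R) : measurable_fun setT (fun p : R * V => u p.1 p.2) ->
  intg (mu \x leb)%E (fun p => size p * cutoff u p) -> intg (mu \x leb)%E (fun p => q p * cutoff u p).
Proof.
move=> mu1 J; have [C C0 HC] := q_bound.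
apply: (@intg_le _ _ _ (mu \x leb)%E (fun p => q p * cutoff u p) (fun p => C * `|size p * cutoff u p|)).
- by apply: measurable_funM => //; exact: measurable_cutoff.
- move=> p; rewrite (normrM (q p)) (normrM (size p)) mulrA ler_wpM2r//; apply: le_trans (HC p) _.
  by rewrite ler_wpM2l// ler_norm.
- by apply: intgZl; exact: intg_norm.
Qed.

(** As functions of [xi] the two time integrals are integrable and have the symmetry of the
    transform of a real field. The equation tested with all translates [z] says exactly that their
    Fourier transform vanishes. *)
Lemma weak_ae_bump : {ae mu, forall xi,
  Rintegral leb setT (fun t => q (xi, t) * cutoff ure (xi, t)) = 0 /\
  Rintegral leb setT (fun t => q (xi, t) * cutoff uim (xi, t)) = 0}.
Proof.
have Ire := intg_q (mre i) Jre; have Iim := intg_q (mim i) Jim.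
pose Wre xi := Rintegral leb setT (fun t => q (xi, t) * cutoff ure (xi, t)).
pose Wim xi := Rintegral leb setT (fun t => q (xi, t) * cutoff uim (xi, t)).
have IWre : intg mu Wre := intg_fubini1 Ire.
have IWim : intg mu Wim := intg_fubini1 Iim.
have qv xi t : q (vopp xi, t) = q (xi, t) by rewrite /q /= fcosv_vopp symbol_vopp.
apply: (fourier_unique IWre IWim).
- by move=> xi; apply: eq_Rintegral => t _; rewrite qv /cutoff /= /ure symre.
- move=> xi; rewrite /Wim -RintegralN.
  apply: eq_Rintegral => t _; rewrite qv /cutoff /= /uim symim tnth_vopp.
  by case: ifP => _; rewrite ?mulrN// mulr0 oppr0.
move=> z.
have mz : measurable_fun setT (fun xi : V => dot z xi).
  by apply: measurable_dot => //; exact: measurable_cst.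
have mc : measurable_fun setT (fun p : V * R => cos (dot z p.1)).
  by apply: (measurableT_comp (@measurable_cos R)); apply: (measurableT_comp mz); exact: measurable_fst.
have ms : measurable_fun setT (fun p : V * R => sin (dot z p.1)).
  by apply: (measurableT_comp (@measurable_sin R)); apply: (measurableT_comp mz); exact: measurable_fst.
pose Phi (p : V * R) := q p * cutoff ure p * cos (dot z p.1) - q p * cutoff uim p * sin (dot z p.1).
have IPhi : intg (mu \x leb)%E Phi.
  apply: intgB.
    by apply: (@intgMb _ _ _ (mu \x leb)%E 1 (fun p => q p * cutoff ure p) (fun p => cos (dot z p.1))) => // p; exact: norm_cos_le1.
  by apply: (@intgMb _ _ _ (mu \x leb)%E 1 (fun p => q p * cutoff uim p) (fun p => sin (dot z p.1))) => // p; exact: norm_sin_le1.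
have mPhi := intg_measurable IPhi.
transitivity (Rintegral mu setT (fun xi => Rintegral leb setT (fun t => Phi (xi, t)))).
  apply: ae_eq_Rintegral.
  - apply: measurable_funB; apply: measurable_funM.
    + exact: intg_measurable IWre.
    + exact: (measurableT_comp (@measurable_cos R)).
    + exact: intg_measurable IWim.
    + exact: (measurableT_comp (@measurable_sin R)).
  - exact: (@measurable_param_Rintegral _ _ _ _ _ leb Phi).
  - refine (ae_mono2 (intg_prod_ae1 Ire) (intg_prod_ae1 Iim) _) => xi I1 I2.
    rewrite /Phi /= RintegralB//.
    + by rewrite !RintegralZr.
    + by under eq_fun do rewrite mulrC; apply: (intgZl (mu := leb) (cos (dot z xi)) I1).
    + by under eq_fun do rewrite mulrC; apply: (intgZl (mu := leb) (sin (dot z xi)) I2).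
rewrite RFubini//.
(* The iterated integral in [pairing] agrees with the integral against [mud] at those [t] whose
   slice is integrable, that is, for almost every [t]. *)
transitivity (Rintegral leb setT (fun t => intR (fun xi => Phi (xi, t)))).
  apply: ae_eq_Rintegral.
  - apply: (@measurable_param_Rintegral _ _ _ _ _ mu (fun p : R * V => Phi (p.2, p.1))).
    by apply: (measurableT_comp mPhi); apply: measurable_fun_pair; [exact: measurable_snd|exact: measurable_fst].
  - have H := @measurable_iintR_param R d _ R d (fun p : R * V => Phi (p.2, p.1)).
    apply: (measurableT_comp (f := fun p : R * V => iintR d (fun y => Phi (y, p.1)) p.2) (g := fun t => (t, vzero R d))).
      by apply: H; apply: (measurableT_comp mPhi); apply: measurable_fun_pair; [exact: measurable_snd|exact: measurable_fst].
    by apply: measurable_fun_pair => //; exact: measurable_cst.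
  - by refine (ae_mono (intg_prod_ae2 IPhi) _) => t It; rewrite intR_mud.
rewrite -[RHS](Hsol (test_fun_wave eb i z sa a_supp)) [RHS]Rintegral_mkcond.
apply: eq_Rintegral => t _; rewrite patchE; case: ifPn => [|/negP]; rewrite inE /= => t0.
  rewrite (pairing_wave kappa alpha01 delta0 mchi chi01 chi_supp eb Ure Uim i z t sa).
  by congr intR; apply/funext => xi; rewrite /Phi /q /pairint /cutoff /= t0 /ure /uim; ring.
rewrite (_ : (fun xi => _) = fun=> 0).
  rewrite intR_mud; last exact: intg0.
  by rewrite /Rintegral integral0_eq.
by apply/funext => xi; rewrite /Phi /cutoff /= (negbTE (introN idP t0)) !mulr0 !mul0r subrr.
Qed.

End FixedBump.

(** The transform of one bump may have zeros, but the bump of radius [1 / (n + 1)] has a positive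
    transform wherever [norm1 xi <= n + 1]. Countably many radii cover all frequencies with a single
    null set. *)
Lemma weak_ae : {ae mu, forall xi,
  Rintegral leb setT (fun t => (a2 t + symb xi * a t) * cutoff ure (xi, t)) = 0 /\
  Rintegral leb setT (fun t => (a2 t + symb xi * a t) * cutoff uim (xi, t)) = 0}.
Proof.
have r0 (n : nat) : 0 < n.+1%:R^-1 :> R by rewrite invr_gt0.
have fn0 : 0 < fnorm R d by rewrite powR_gt0// mulr_gt0// pi_gt0.
have mcut (u : R -> V -> R) (xi : V) : measurable_fun setT (fun p : R * V => u p.1 p.2) ->
    measurable_fun setT (fun t => cutoff u (xi, t)).
  move=> mu1; apply: (measurableT_comp (measurable_cutoff mu1)).
  by apply: measurable_fun_pair => //; exact: measurable_cst.
have ma (f : R -> R) : smooth1 f -> measurable_fun setT f.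
  by move=> sf; apply: continuous_measurable_fun; exact: smooth1_continuous.
have ma2 := ma _ (smooth1_derive (smooth1_derive sa)).
have main (u : R -> V -> R) (xi : V) n : measurable_fun setT (fun p : R * V => u p.1 p.2) ->
    intg leb (fun t => size (xi, t) * cutoff u (xi, t)) ->
    0 < fcosv (bumpf n.+1%:R^-1) xi ->
    Rintegral leb setT (fun t => fnorm R d * fcosv (bumpf n.+1%:R^-1) xi * (a2 t + symb xi * a t) * cutoff u (xi, t)) = 0 ->
    Rintegral leb setT (fun t => (a2 t + symb xi * a t) * cutoff u (xi, t)) = 0.
  move=> mu1 I1 f0 E.
  have I2 : intg leb (fun t => (a2 t + symb xi * a t) * cutoff u (xi, t)).
    apply: (@intg_le _ _ _ leb _ (fun t => ((1 + symb xi) / rho m xi) * `|size (xi, t) * cutoff u (xi, t)|)).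
    - apply: measurable_funM; last exact: mcut.
      by apply: measurable_funD => //; apply: measurable_funM => //; exact: ma.
    - move=> t; rewrite (normrM (a2 t + _)) (normrM (size _)) mulrA ler_wpM2r//.
      have rh := rho_gt0 m xi; have s0 := symbol_ge0 xi.
      rewrite /size /= normrM (gtr0_norm rh) mulrA mulfVK ?gt_eqF// ger0_norm ?addr_ge0//.
      apply: le_trans (ler_normD _ _) _; rewrite normrM (ger0_norm s0) mulrDl mul1r mulrDr addrC.
      have := normr_ge0 (a t); have := normr_ge0 (a2 t).
      have : 0 <= symb xi * `|a2 t| by rewrite mulr_ge0.
      lra.
    - by apply: intgZl; exact: intg_norm.
  move: E; under eq_Rintegral do rewrite -mulrA.
  rewrite RintegralZl// => /eqP.
  by rewrite !mulf_eq0 (gt_eqF fn0) (gt_eqF f0) => /eqP.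
have B n := weak_ae_bump (even_bump_bump (n.+1%:R^-1 : R)).
refine (ae_mono2 (ae_mono2 (intg_prod_ae1 Jre) (intg_prod_ae1 Jim) (fun xi h1 h2 => conj h1 h2)) (ae_foralln B) _) => xi [I1 I2] H.
pose n := Num.bound (norm1 xi).
have f0 : 0 < fcosv (bumpf n.+1%:R^-1) xi.
  apply: prodr_gt0 => j _; apply: fcos_bump_gt0 => //.
  rewrite mulrC ler_pdivrMr// mul1r; apply: (@le_trans _ _ (norm1 xi)).
    by rewrite /norm1 (bigD1 j)//= lerDl sumr_ge0.
  apply: ltW; apply: lt_trans (archi_boundP _) _; first exact: sumr_ge0.
  by rewrite ltr_nat.
have [E1 E2] := H n; split.
  exact: (main ure xi n (mre i) I1 f0 E1).
exact: (main uim xi n (mim i) I2 f0 E2).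
Qed.

End PointwiseEquation.

Section ProductSpaces.
Context d1 d2 (T1 : measurableType d1) (T2 : measurableType d2) (R : realType).
Variable m1 : {sigma_finite_measure set T1 -> \bar R}.
Variable m2 : {sigma_finite_measure set T2 -> \bar R}.

Lemma intg_ae_le (F G : T1 * T2 -> R) : measurable_fun setT F ->
  {ae m1, forall x, {ae m2, forall y, `|F (x, y)| <= G (x, y)}} ->
  intg (m1 \x m2)%E G -> intg (m1 \x m2)%E F.
Proof.
move=> mF FG IG; have mG := intg_measurable IG.
have sl (H : T1 * T2 -> R) x : measurable_fun setT H -> measurable_fun setT (fun y => (`|H (x, y)|)%:E).
  move=> mH; apply/measurable_EFinP; apply: measurableT_comp => //.
  by apply: (measurableT_comp mH); exact: measurable_fun_pair.
have ml (H : T1 * T2 -> R) : measurable_fun setT H -> measurable_fun setT (fun x => \int[m2]_y (`|H (x, y)|)%:E)%E.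
  move=> mH; apply: (@measurable_param_integral _ _ _ _ _ m2 (fun p => (`|H p|)%:E)).
  by apply/measurable_EFinP; exact: measurableT_comp.
apply/intg_prodP => //; apply: le_lt_trans (proj1 (intg_prodP m1 m2 mG) IG).
apply: ae_ge0_le_integral => //.
- by move=> x _; exact: integral_ge0.
- exact: ml.
- by move=> x _; exact: integral_ge0.
- exact: ml.
refine (ae_mono FG _) => x Hx _; apply: ae_ge0_le_integral => //; [exact: sl|exact: sl|].
by refine (ae_mono Hx _) => y h _; rewrite lee_fin; apply: le_trans h (ler_norm _).
Qed.

(** By Tonelli both statements express that the double integral of [|F|] is 0. The oscillator
    argument works at fixed frequency, whereas the Sobolev norm is taken at fixed time. *)
Lemma ae_swap (F : T1 * T2 -> R) : measurable_fun setT F ->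
  {ae m1, forall x, {ae m2, forall y, F (x, y) = 0}} ->
  {ae m2, forall y, {ae m1, forall x, F (x, y) = 0}}.
Proof.
move=> mF H.
have mE : measurable_fun setT (fun p => (`|F p|)%:E) by apply/measurable_EFinP; exact: measurableT_comp.
have E1 : (\int[m1]_x \int[m2]_y (`|F (x, y)|)%:E = 0)%E.
  rewrite -(integral0 m1 setT); apply: ae_eq_integral => //.
    exact: (@measurable_param_integral _ _ _ _ _ m2 (fun p => (`|F p|)%:E)).
  refine (ae_mono H _) => x Hx _.
  rewrite -(integral0 m2 setT); apply: ae_eq_integral => //.
    by apply: (measurableT_comp mE); exact: measurable_fun_pair.
  by refine (ae_mono Hx _) => y h _; rewrite h normr0.
have E2 : (\int[m2]_y \int[m1]_x (`|F (x, y)|)%:E = 0)%E.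
  by rewrite -E1; apply/esym; exact: (@fubini_tonelli _ _ _ _ _ m1 m2 (fun p => (`|F p|)%:E) mE).
have mS : measurable_fun setT (fun y => \int[m1]_x (`|F (x, y)|)%:E)%E.
  apply: (@measurable_param_integral _ _ _ _ _ m1 (fun p : T2 * T1 => (`|F (p.2, p.1)|)%:E)).
  by apply: (measurableT_comp mE); apply: measurable_fun_pair; [exact: measurable_snd|exact: measurable_fst].
have /(ae_eq_integral_abs _ measurableT mS) : (\int[m2]_y `|\int[m1]_x (`|F (x, y)|)%:E| = 0)%E.
  by rewrite -E2; apply: eq_integral => y _; rewrite gee0_abs// integral_ge0.
move=> K; refine (ae_mono K _) => y /(_ I) Ey.
have mFy : measurable_fun setT (fun x => (F (x, y))%:E).
  by apply/measurable_EFinP; apply: (measurableT_comp mF); exact: measurable_fun_pair.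
have /(ae_eq_integral_abs _ measurableT mFy) : (\int[m1]_x `|(F (x, y))%:E| = 0)%E by [].
by move=> L; refine (ae_mono L _) => x /(_ I)[].
Qed.

End ProductSpaces.

(** * Integrability up to the initial time, and vanishing *)

Section Vanishing.
Variable R : realType.
Variable d : nat.
Local Notation V := (d.-tuple R).
Local Notation mu := (@mud R d).
Local Notation leb := (@lebesgue_measure R).
Variables (m : nat) (u : R -> V -> R) (lam : V -> R).
Hypothesis mu1 : measurable_fun setT (fun p : R * V => u p.1 p.2).
Hypothesis lam0 : forall xi, 0 <= lam xi.

Lemma intg_shift (F : V * R -> R) (c : R) : intg (mu \x leb)%E F ->
  intg (mu \x leb)%E (fun p => F (p.1, p.2 + c)).
Proof.
move=> IF; have mF := intg_measurable IF.
apply/intg_prodP.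
  apply: (measurableT_comp mF); apply: measurable_fun_pair; first exact: measurable_fst.
  by apply: measurable_funD => //; exact: measurable_snd.
have H := proj1 (intg_prodP mu leb mF) IF.
suff -> : (\int[mu]_xi \int[leb]_t (`|F ((xi, t).1, (xi, t).2 + c)|)%:E = \int[mu]_xi \int[leb]_t (`|F (xi, t)|)%:E)%E by [].
apply: eq_integral => xi _; apply: (integral_shift c (f := fun t => (`|F (xi, t)|)%:E)).
apply/measurable_EFinP; apply: measurableT_comp => //.
by apply: (measurableT_comp mF); exact: measurable_fun_pair.
Qed.

Lemma intg_slice A : intg (mu \x leb)%E (windowed m u A) ->
  {ae mu, forall xi, intg leb (fun t => cutoff u (xi, t) * \1_A t)}.
Proof.
move=> IW; refine (ae_mono (intg_prod_ae1 IW) _) => xi Ix.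
rewrite (_ : (fun t => cutoff u (xi, t) * \1_A t) = fun t => (rho m xi)^-1 * windowed m u A (xi, t)).
  exact: (intgZl (mu := leb) (rho m xi)^-1 Ix).
apply/funext => t; rewrite /windowed /=; field.
by rewrite gt_eqF// rho_gt0.
Qed.

(* d'Alembert's formula bounds the solution on (0, 1] by its values on (1, 3]. *)
Lemma intg_windowed0 :
  (forall c N, 0 < c -> c < N -> intg (mu \x leb)%E (windowed m u `[c, N]%classic)) ->
  {ae mu, forall xi, forall n (q : rat), 1 < ratr q :> R ->
     weak_oscillator (fun t => cutoff u (xi, t)) (lam xi) n (ratr q)} ->
  forall k : nat, intg (mu \x leb)%E (windowed m u `[- k.+1%:R, k.+1%:R]%classic).
Proof.
move=> IW H.
have I12 : intg (mu \x leb)%E (windowed m u `[1, 2]%classic) by apply: IW; lra.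
have I23 : intg (mu \x leb)%E (windowed m u `[2, 3]%classic) by apply: IW; lra.
have Wk k : intg (mu \x leb)%E (windowed m u `[k.+2%:R^-1, k.+2%:R]%classic).
  apply: IW; first by rewrite invr_gt0.
  apply: (@lt_trans _ _ 1); last by rewrite ltr1n.
  by rewrite invf_lt1 ?ltr0n// ltr1n.
have ineq : {ae mu, forall xi, {ae leb, forall t, 0 < t ->
    `|cutoff u (xi, t)| <= 2 * `|cutoff u (xi, t + 1)| + `|cutoff u (xi, t + 2)|}}.
  refine (ae_mono2 (ae_foralln (fun k => intg_slice (Wk k))) H _) => xi Ix Hx.
  exact: (weak_oscillator_ineq (lam0 xi) Ix Hx).
(* The weight [rho] depends on the frequency only, so the pointwise inequality can be multiplied by
   it and the shifts in time leave it unchanged. *)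
have I01 : intg (mu \x leb)%E (windowed m u `[0, 1]%classic).
  apply: (@intg_ae_le _ _ _ _ _ mu leb _ (fun p => 2 * `|windowed m u `[1, 2]%classic (p.1, p.2 + 1)| + `|windowed m u `[2, 3]%classic (p.1, p.2 + 2)|)).
  - by apply: measurable_windowed => //; exact: measurable_itv.
  - refine (ae_mono ineq _) => xi Hx; refine (ae_mono Hx _) => t Ht.
    rewrite /windowed /= !normrM.
    have [t01|t01] := boolP (t \in `[0%R, 1%R]%classic); last first.
      rewrite [X in _ * `|X|]indicE (negbTE t01) normr0 mulr0.
      by rewrite addr_ge0// !mulr_ge0.
    move: (t01); rewrite inE /= in_itv/= => /andP[t0 t1].
    have [->|tn0] := eqVneq t 0.
      by rewrite {1}/cutoff ltxx normr0 !mul0r addr_ge0// !mulr_ge0.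
    have tp : 0 < t by rewrite lt_neqAle eq_sym tn0.
    rewrite !indicE t01 !mem_set /= ?in_itv/=; try (apply/andP; split; lra).
    rewrite normr1 !mulr1 mulrA -mulrDl ler_wpM2r//.
    exact: Ht.
  - apply: intgD; first apply: intgZl; apply: intg_norm.
      exact: (intg_shift 1 I12).
    exact: (intg_shift 2 I23).
move=> k.
(* Every positive time of the symmetric window lies in [[0, 1]] or [[1, k + 2]], and [cutoff]
   vanishes at the other times. *)
have I1k : intg (mu \x leb)%E (windowed m u `[1, k.+2%:R]%classic) by apply: IW => //; rewrite ltr1n.
apply: (@intg_le _ _ _ (mu \x leb)%E _ (fun p => `|windowed m u `[0, 1]%classic p| + `|windowed m u `[1, k.+2%:R]%classic p|)).
- by apply: measurable_windowed => //; exact: measurable_itv.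
- move=> [xi t]; rewrite /windowed /= !normrM.
  have [t0|t0] := leP t 0; first by rewrite /cutoff/= ltNge t0/= normr0 !mul0r addr0.
  rewrite -mulrDr ler_wpM2l ?mulr_ge0//.
  have [tk|tk] := boolP (t \in `[- k.+1%:R, k.+1%:R]%classic); last first.
    by rewrite (indicE _ `[- k.+1%:R, k.+1%:R]%classic) (negbTE tk) normr0 addr_ge0.
  rewrite (indicE _ `[- k.+1%:R, k.+1%:R]%classic) tk normr1.
  move: tk; rewrite inE /= in_itv/= => /andP[_ tk].
  have [t1|t1] := leP t 1.
    rewrite (indicE _ `[0, 1]%classic) mem_set ?normr1 ?lerDl//.
    by rewrite /= in_itv/= (ltW t0).
  rewrite (indicE _ `[1, k.+2%:R]%classic) mem_set ?normr1 ?lerDr//.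
  by rewrite /= in_itv/= (ltW t1) (le_trans tk)// ler_nat.
- by apply: intgD; exact: intg_norm.
Qed.

Lemma cutoff_ae0 :
  (forall k : nat, intg (mu \x leb)%E (windowed m u `[- k.+1%:R, k.+1%:R]%classic)) ->
  {ae mu, forall xi, forall n (q : rat), weak_oscillator (fun t => cutoff u (xi, t)) (lam xi) n (ratr q)} ->
  {ae leb, forall t, {ae mu, forall xi, cutoff u (xi, t) = 0}}.
Proof.
move=> IW H; apply: (@ae_swap _ _ _ _ _ mu leb (cutoff u)); first exact: measurable_cutoff.
refine (ae_mono2 (ae_foralln (fun k => intg_slice (IW k))) H _) => xi Ix Hx.
apply: (weak_oscillator_eq0 (lam0 xi) Ix _ Hx).
by move=> t t0; rewrite /cutoff /= ltNge t0.
Qed.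

End Vanishing.

Section Component.
Variable R : realType.
Variable d : nat.
Local Notation V := (d.-tuple R).
Local Notation mu := (@mud R d).
Local Notation leb := (@lebesgue_measure R).

Lemma ae_forall_count (I : countType) dT (T : measurableType dT) (nu : {measure set T -> \bar R})
    (P : I -> T -> Prop) :
  (forall i, {ae nu, forall x, P i x}) -> {ae nu, forall x, forall i, P i x}.
Proof.
move=> H; pose Q (n : nat) x := if unpickle n is Some i then P i x else True.
have HQ n : {ae nu, forall x, Q n x}.
  by rewrite /Q; case: (unpickle n) => [i|]; [exact: H|exact: aeW].
by refine (ae_mono (ae_foralln HQ) _) => x Hx i; have := Hx (pickle i); rewrite /Q pickleK.
Qed.

Lemma tbump_supp n (q t : R) : `|q| + 1 < `|t| -> tbump n q t = 0.
Proof.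
move=> h; apply: bump_supp1.
have n1 : 1 <= n.+1%:R :> R by rewrite ler1n.
have h1 : `|t| <= `|n.+1%:R * t| by rewrite normrM ger0_norm// ler_peMl.
have := lerB_dist (n.+1%:R * t) q; lra.
Qed.

(** At positive times the bump vanishes outside [A], so the indicator of [A] can be inserted at no
    cost; at other times [cutoff] is already 0. *)
Lemma intg_tbump_window m (u : R -> V -> R) (A : set R) n (q : R) :
  (forall t, 0 < t -> ~ A t -> 1 < `|n.+1%:R * t - q|) ->
  intg (mu \x leb)%E (windowed m u A) ->
  intg (mu \x leb)%E (fun p => rho m p.1 * (`|tbump n q p.2| + `|derive1 (derive1 (tbump n q)) p.2|) * cutoff u p).
Proof.
move=> HA IW; have st := smooth1_tbump n q.
have s0 := @tbump_supp n q.
have s2 t : `|q| + 1 < `|t| -> derive1 (derive1 (tbump n q)) t = 0.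
  by move=> h; apply: derive1_supp h => x h; exact: derive1_supp h.
have [B1 B10 H1] := smooth_supp_bounded (smooth1_continuous st) s0.
have [B2 B20 H2] := smooth_supp_bounded (smooth1_continuous (smooth1_derive (smooth1_derive st))) s2.
rewrite (_ : (fun p => _) = fun p => windowed m u A p * (`|tbump n q p.2| + `|derive1 (derive1 (tbump n q)) p.2|)).
  apply: (@intgMb _ _ _ (mu \x leb)%E (B1 + B2) (windowed m u A) (fun p : V * R => `|tbump n q p.2| + `|derive1 (derive1 (tbump n q)) p.2|)) => //.
    have mf (f : R -> R) : smooth1 f -> measurable_fun setT (fun p : V * R => `|f p.2|).
      move=> sf; apply: measurableT_comp => //; apply: (measurableT_comp (f := f)); last exact: measurable_snd.
      by apply: continuous_measurable_fun; exact: smooth1_continuous.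
    apply: measurable_funD; first exact: mf.
    by apply: mf; do 2 apply: smooth1_derive.
  by move=> p; rewrite ger0_norm ?addr_ge0// lerD.
apply/funext => -[xi t]; rewrite /windowed /cutoff /=.
case: ifPn => t0; last by rewrite !mulr0 !mul0r.
have [tA|tA] := pselect (A t); first by rewrite indicE mem_set// mulr1; ring.
have h := HA t t0 tA.
by rewrite derive2_tbump /tbump bump_supp1// bump2_supp1// mulr0 normr0 addr0 !mulr0 mul0r.
Qed.

End Component.

Theorem theorem1p2 (R : realType) (d : nat) (kappa alpha : R) (chi : R -> R)
    (s delta : R) (Ure Uim : R -> d.-tuple R -> d.-tuple R) :
  (1 <= d)%N -> 0 < kappa -> 0 < alpha < 1 ->
  measurable_fun setT chi -> (forall r, 0 <= chi r <= 1) ->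
  (forall r, 1 < `|r| -> chi r = 0) -> (forall r, `|r| <= 2^-1 -> chi r = 1) ->
  0 < delta ->
  L1loc_Hs s Ure Uim ->
  defines_distribution Ure Uim ->
  dist_solution_zero kappa alpha chi delta Ure Uim ->
  {ae @lebesgue_measure R, forall t, 0 < t -> hs2 s (Ure t) (Uim t) = 0%E}.
Proof.
move=> _ kappa0 alpha01 mchi chi01 chi_supp _ delta0 [meas [sym HL]] _ Hsol.
pose m := Num.bound `|s|.
have sm : `|s| <= m%:R by apply: ltW; exact: archi_boundP.
have mre i := proj1 (meas i); have mim i := proj2 (meas i).
have symre t xi := proj1 (sym t xi); have symim t xi := proj2 (sym t xi).
pose lam := @symbol R d kappa alpha delta chi.
have lam0 : forall xi, 0 <= lam xi by move=> xi; exact: symbol_ge0.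
pose ure i t xi := tnth (Ure t xi) i; pose uim i t xi := tnth (Uim t xi) i.
pose weak u n (q : rat) xi := weak_oscillator (fun t => cutoff u (xi, t)) (lam xi) n (ratr q).
have weakT i n (q : rat) A : (forall t, 0 < t -> ~ A t -> 1 < `|n.+1%:R * t - ratr q|) ->
    intg (@mud R d \x @lebesgue_measure R)%E (windowed m (ure i) A) ->
    intg (@mud R d \x @lebesgue_measure R)%E (windowed m (uim i) A) ->
    {ae @mud R d, forall xi, weak (ure i) n q xi /\ weak (uim i) n q xi}.
  move=> HA I1 I2.
  apply: (weak_ae kappa0 alpha01 delta0 mchi chi01 chi_supp mre mim symre symim Hsol
    (smooth1_tbump n (ratr q)) (@tbump_supp R n (ratr q))).
    exact: (intg_tbump_window HA I1).
  exact: (intg_tbump_window HA I2).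
have W1 i c N : 0 < c -> c < N ->
    intg (@mud R d \x @lebesgue_measure R)%E (windowed m (ure i) `[c, N]%classic).
  move=> c0 cN; apply: (intg_windowed sm mre mim HL (i := i) (mre i)) => // t xi.
  by rewrite lerDl sqr_ge0.
have W2 i c N : 0 < c -> c < N ->
    intg (@mud R d \x @lebesgue_measure R)%E (windowed m (uim i) `[c, N]%classic).
  move=> c0 cN; apply: (intg_windowed sm mre mim HL (i := i) (mim i)) => // t xi.
  by rewrite lerDr sqr_ge0.
(* For [q > 1] the support [[(q - 1) / (n + 1), (q + 1) / (n + 1)]] of the bump lies in positive
   times, where integrability is given. *)
have S1 i : {ae @mud R d, forall xi n (q : rat), 1 < ratr q :> R ->
    weak (ure i) n q xi /\ weak (uim i) n q xi}.
  apply: ae_foralln => n; apply: ae_forall_count => q.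
  have [q1|q1] := boolP (1 < ratr q :> R); last by apply: aeW.
  have n0 : 0 < n.+1%:R :> R by rewrite ltr0n.
  have c0 : 0 < (ratr q - 1) / n.+1%:R :> R by rewrite divr_gt0// subr_gt0.
  have cN : (ratr q - 1) / n.+1%:R < (ratr q + 1) / n.+1%:R :> R by rewrite ltr_pM2r ?invr_gt0//; lra.
  have HA t : 0 < t -> ~ (`[(ratr q - 1) / n.+1%:R, (ratr q + 1) / n.+1%:R]%classic : set R) t ->
      1 < `|n.+1%:R * t - ratr q|.
    move=> _ tA; rewrite ltNge; apply/negP => h; apply: tA.
    move: h; rewrite ler_distlC => /andP[h1 h2]; rewrite /= in_itv/=.
    by rewrite ler_pdivrMr// ler_pdivlMr// (mulrC t); apply/andP; split; lra.
  refine (ae_mono (weakT i n q _ HA (W1 i _ _ c0 cN) (W2 i _ _ c0 cN)) _) => xi H _.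
  exact: H.
have V1 i := intg_windowed0 (mre i) lam0 (W1 i) (ae_mono (S1 i) (fun xi H n q h => proj1 (H n q h))).
have V2 i := intg_windowed0 (mim i) lam0 (W2 i) (ae_mono (S1 i) (fun xi H n q h => proj2 (H n q h))).
(* The bumps may now charge [t = 0]: with nonzero initial data these tests would have a nonzero
   right-hand side, so this is where zero data are used. *)
have S2 i : {ae @mud R d, forall xi n (q : rat), weak (ure i) n q xi /\ weak (uim i) n q xi}.
  apply: ae_foralln => n; apply: ae_forall_count => q.
  (* The bump lives on [|t| <= |q| + 1] whatever [n] is, because dilation by [n + 1 >= 1] only
     narrows it around a centre closer to 0. *)
  pose k := Num.bound (`|ratr q| + 1 : R).
  have HA t : 0 < t -> ~ (`[- k.+1%:R, k.+1%:R]%classic : set R) t -> 1 < `|n.+1%:R * t - ratr q|.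
    move=> _ tA.
    have kt : k.+1%:R < `|t|.
      by rewrite ltNge; apply/negP => h; apply: tA; rewrite /= in_itv/= -ler_norml.
    have qk : `|ratr q| + 1 < k%:R :> R by apply: archi_boundP; rewrite addr_ge0.
    have kk : k%:R < k.+1%:R :> R by rewrite ltr_nat.
    have h1 : `|t| <= `|n.+1%:R * t| by rewrite normrM ger0_norm// ler_peMl// ler1n.
    have := lerB_dist (n.+1%:R * t) (ratr q); lra.
  exact: weakT HA (V1 i k) (V2 i k).
have Z1 i := cutoff_ae0 (mre i) lam0 (V1 i) (ae_mono (S2 i) (fun xi H n q => proj1 (H n q))).
have Z2 i := cutoff_ae0 (mim i) lam0 (V2 i) (ae_mono (S2 i) (fun xi H n q => proj2 (H n q))).
have Z : {ae @lebesgue_measure R, forall t i, {ae @mud R d, forall xi,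
    cutoff (ure i) (xi, t) = 0 /\ cutoff (uim i) (xi, t) = 0}}.
  apply: ae_forall_count => i; refine (ae_mono2 (Z1 i) (Z2 i) _) => t h1 h2.
  by refine (ae_mono2 h1 h2 _).
refine (ae_mono Z _) => t Ht t0.
rewrite (hs2_integral s mre mim).
rewrite -(integral0 (@mud R d) setT); apply: ae_eq_integral => //.
  exact: measurable_hs2_integrand.
refine (ae_mono (ae_forall_count Ht) _) => xi Hxi _.
rewrite big1 ?mulr0// => i _; have [] := Hxi i.
by rewrite /cutoff /= t0 => E1 E2; rewrite -/(ure i t xi) -/(uim i t xi) E1 E2 expr0n addr0.
Qed.
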